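(* Let $Q>0$, let $(Z,d,\mu)$ be a $Q$-Ahlfors regular metric measure space, let $\lambda\in(0,Q]$, and let $F\subset Z$ be a closed and porous $\lambda$-Ahlfors regular subset, equipped with the metric $d_{|F}$ and the Hausdorff $\lambda$-measure $\nu$. Suppose that $\max\big(Q/(\lambda+1),Q-\lambda\big)<p<\infty$. Then there exist bounded linear operators $$\mathcal R\colon \dot{M}^{1,p}(Z)\to \dot{\mathcal B}^{1-\frac{Q-\lambda}{p}}_{p,p}(F)\quad\text{and}\quad \mathcal E\colon \dot{\mathcal B}^{1-\frac{Q-\lambda}{p}}_{p,p}(F)\to\dot{M}^{1,p}(Z)$$ such that (i) $\mathcal R f=f_{|F}$ for all continuous functions $f$ in $\dot{M}^{1,p}(Z)$, and (ii) $\mathcal R(\mathcal E f)=f$ for all $f\in\dot{\mathcal B}^{1-\frac{Q-\lambda}{p}}_{p,p}(F)$ (pointwise $\nu$-almost everywhere in $F$).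
   Context: **Metric measure spaces.** All metric measure spaces $(Z,d,\mu)$ are such that $\mu$ is Borel regular and every ball $B(\xi,r)=\{\eta: d(\eta,\xi)<r\}$ has positive and finite measure. $(Z,d,\mu)$ is $Q$-Ahlfors regular if $\mu(B(\xi,r))\approx r^Q$ uniformly in $\xi\in Z$ and $0<r<\operatorname{diam}Z$. A closed subset $F\subset Z$ (of Hausdorff dimension $\lambda$) is $\lambda$-Ahlfors regular if the metric measure space $(F,d_{|F},\nu)$, with $\nu$ the Hausdorff $\lambda$-measure on $F$, is $\lambda$-Ahlfors regular. A closed set $F\subset Z$ is porous if there exists $c\in(0,1)$ such that for all balls $B\subset Z$ with radius $r<\operatorname{diam}Z$ and $B\cap F\ne\emptyset$ there exists $\xi\in Z$ with $B(\xi,cr)\subset B\setminus F$. **Hajłasz–Sobolev space.** $\dot M^{1,p}(Z)$ ($0<p<\infty$) is the class of $\mu$-measurable $f\colon Z\to\mathbb C$ for which there exists $g\colon Z\to[0,\infty]$ in $L^p(Z)$ with $|f(\xi)-f(\eta)|\le d(\xi,\eta)(g(\xi)+g(\eta))$ for all $\xi,\eta\in Z$; $\|f\|_{\dot M^{1,p}(Z)}$ is the infimum of $\|g\|_{L^p(Z)}$ over all admissible $g$. **Besov space on $F$.** $L^1_{\rm loc}(F)$ denotes the complex-valued $\nu$-measurable functions on $F$ that are integrable on every ball of $F$. For each $n\in\mathbb Z$ let $(\xi_x)_{x\in X_n}$ be a maximal set of points of $F$ with $d(\xi_x,\xi_{x'})\ge 2^{-n-1}$ for distinct $x,x'\in X_n$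 ($X_n$ an index set). Put $B(x):=B_F(\xi_x,2^{-n})$ (ball in $F$) and $|x|:=n$ for $x\in X_n$, and $X:=\bigsqcup_{n\in\mathbb Z}X_n$. The graph $(X,E)$ has an edge joining $x$ and $x'$ iff $x\ne x'$, $||x|-|x'||\le1$ and $B(x)\cap B(x')\neq\emptyset$. Each edge is given one orientation, with starting point $e_-$ and endpoint $e_+$, such that $e_+$ is the vertex of higher level when the levels differ. Put $|e|:=\min(|e_-|,|e_+|)$ and $B(e):=B(e_-)\cup B(e_+)$. For $u\colon X\to\mathbb C$ let $du(e):=u(e_+)-u(e_-)$, and for $f\in L^1_{\rm loc}(F)$ let $Pf(x):=\frac1{\nu(B(x))}\int_{B(x)}f\,d\nu$. For $0<\sigma\le1$, $\lambda/(\lambda+\sigma)<p<\infty$ and $0<q<\infty$, $\dot{\mathcal B}^\sigma_{p,q}(F)$ is the space of $f\in L^1_{\rm loc}(F)$ with $$\|f\|_{\dot{\mathcal B}^\sigma_{p,q}(F)}:=\Big(\sum_{k\in\mathbb Z}2^{k\sigma q}\Big\|\sum_{|e|=k}|d(Pf)(e)|\chi_{B(e)}\Big\|_{L^p(F)}^q\Big)^{1/q}<\infty.$$ Different choices of $(X,E)$ give equivalent quasi-norms. Strictly speaking both kinds of spaces are quasi-normed spaces after dividing out functions that are constant almost everywhere; ''$f\in$'' is used both for functions and for equivalence classes. *)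

(* Defs.v *)
From HB Require Import structures.
From mathcomp Require Import all_boot all_order all_algebra.
From mathcomp Require Import all_classical all_reals all_analysis.
From mathcomp Require Import measurable_realfun complex.

Set Implicit Arguments.
Unset Strict Implicit.
Unset Printing Implicit Defensive.

Import Order.TTheory GRing.Theory Num.Theory.
Import numFieldNormedType.Exports.
Import Normc.

Local Open Scope classical_set_scope.
Local Open Scope ring_scope.

(* Measurable types are pointed in MathComp-Analysis, so metric spaces that
   carry measures are taken pointed; the base point plays no role. *)
#[short(type="pmetricType")]
HB.structure Definition PointedMetric (K : numDomainType) :=
  {T of Pointed T & Metric K T}.

(* The metric space (F, d_{|F}) for a nonempty F. *)
Definition metric_subspace {R : realType} {Z : metricType R} {F : set Z}
  (F0 : F !=set0) : Type := F.

Section metric_subspace.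
Context {R : realType} {Z : metricType R} {F : set Z} (F0 : F !=set0).

Definition subspace_val (x : metric_subspace F0) : Z := val (x : F).

HB.instance Definition _ := PseudoMetric.copy (metric_subspace F0) (F : Type).

Let mdistF (x y : metric_subspace F0) : R :=
  mdist (subspace_val x) (subspace_val y).

Let mdistF_ge0 x y : 0 <= mdistF x y.
Proof. exact: mdist_ge0. Qed.

Let mdistF_positivity x y : mdistF x y = 0 -> x = y.
Proof. by move/mdist_positivity/val_inj. Qed.

Let ballEmdistF (x : metric_subspace F0) d :
  ball x d = [set y | mdistF x y < d].
Proof.
by rewrite -[LHS]/(subspace_val @^-1` ball (subspace_val x) d) ballEmdist.
Qed.

HB.instance Definition _ := @PseudoMetric_isMetric.Build R
  (metric_subspace F0) mdistF mdistF_ge0 mdistF_positivity ballEmdistF.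

Let point_subspace : metric_subspace F0 :=
  exist _ (projT1 (cid F0)) (mem_set (projT2 (cid F0))).

HB.instance Definition _ := isPointed.Build (metric_subspace F0) point_subspace.

End metric_subspace.

(* [diam set0] is -oo. *)
Definition diam {R : realType} {T : metricType R} (A : set T) : \bar R :=
  ereal_sup [set (mdist xy.1 xy.2)%:E | xy in A `*` A].

Section hausdorff_measure.
Context {R : realType} {T : metricType R}.
Local Open Scope ereal_scope.

Definition hausdorff_gauge (s : R) (A : set T) : \bar R :=
  if A == set0 then 0 else diam A `^ s.

Definition hausdorff_content (s delta : R) (A : set T) : \bar R :=
  ereal_inf [set \sum_(k <oo) hausdorff_gauge s (U k) |
    U in [set U : (set T)^nat |
      (forall k, diam (U k) <= delta%:E) /\ A `<=` \bigcup_k U k]].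

Definition hausdorff_measure (s : R) (A : set T) : \bar R :=
  ereal_sup [set hausdorff_content s delta A | delta in [set d : R | (0 < d)%R]].

Definition hausdorff_dim (A : set T) : \bar R :=
  ereal_inf [set s%:E | s in [set s : R | (0 < s)%R /\ hausdorff_measure s A = 0]].

End hausdorff_measure.

Section hausdorff_outer_measure.
Context {R : realType} {T : metricType R}.
Local Open Scope ereal_scope.
Implicit Types (A : set T) (s delta : R).

Lemma hausdorff_gauge0 s : hausdorff_gauge s (set0 : set T) = 0.
Proof. by rewrite /hausdorff_gauge eqxx. Qed.

Lemma hausdorff_gauge_ge0 s A : 0 <= hausdorff_gauge s A.
Proof. by rewrite /hausdorff_gauge; case: ifP => // _; exact: poweR_ge0. Qed.

Lemma diam_set0 : diam (set0 : set T) = -oo.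
Proof. by rewrite /diam setX0 image_set0 ereal_sup0. Qed.

Lemma hausdorff_content_ge0 s delta A : 0 <= hausdorff_content s delta A.
Proof.
apply: le_ereal_inf_tmp => _ [U _ <-].
by apply: nneseries_ge0 => k _ _; exact: hausdorff_gauge_ge0.
Qed.

Lemma hausdorff_content0 s delta : hausdorff_content s delta (set0 : set T) = 0.
Proof.
apply/eqP; rewrite eq_le hausdorff_content_ge0 andbT.
apply: ereal_inf_lbound; exists (fun=> set0).
  by split => [k|]; [rewrite diam_set0 leNye | exact: sub0set].
by apply: eseries0 => k _ _; rewrite hausdorff_gauge0.
Qed.

Lemma le_hausdorff_content s delta :
  {homo (hausdorff_content s delta : set T -> \bar R) : A B / A `<=` B >-> A <= B}.
Proof.
move=> A B AB; apply/ereal_inf_le_tmp => _ [U [dU BU] <-].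
by exists U => //; split => //; exact: subset_trans BU.
Qed.

Lemma hausdorff_content_sigma_subadditive s delta :
  sigma_subadditive (hausdorff_content s delta : set T -> \bar R).
Proof.
move=> A; have [[i ioo]|] := pselect (exists i,
    hausdorff_content s delta (A i) = +oo).
  rewrite (eseries_pinfty _ _ ioo) ?leey// => n _.
  by rewrite -ltNye (lt_le_trans _ (hausdorff_content_ge0 _ _ _)).
rewrite -forallNE => Aoo.
suff add2e (e : {posnum R}) : hausdorff_content s delta (\bigcup_n A n) <=
    \sum_(i <oo) hausdorff_content s delta (A i) + e%:num%:E.
  by apply/lee_addgt0Pr => _/posnumP[].
rewrite (le_trans _ (epsilon_trick _ _ _))//; last first.
  by move=> n; exact: hausdorff_content_ge0.
pose P n (B : (set T)^nat) :=
  ((forall k, diam (B k) <= delta%:E) /\ A n `<=` \bigcup_k B k) /\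
  \sum_(k <oo) hausdorff_gauge s (B k) <=
    hausdorff_content s delta (A n) + (e%:num / (2 ^ n.+1)%:R)%:E.
have [G PG] : {G : ((set T)^nat)^nat & forall n, P n (G n)}.
  apply: (@choice _ _ P) => n; rewrite /P.
  have fA : hausdorff_content s delta (A n) \is a fin_num.
    by rewrite ge0_fin_numE ?hausdorff_content_ge0// ltey; exact/eqP/Aoo.
  have en1 : (0 < e%:num / (2 ^ n.+1)%:R :> R)%R by [].
  have [_ [B BA <-] Bx] := lb_ereal_inf_adherent en1 fA.
  by exists B; split => //; exact/ltW.
have gG0 x : 0 <= (hausdorff_gauge s \o uncurry G) x.
  exact: hausdorff_gauge_ge0.
apply: (@le_trans _ _
    (\esum_(i in setT) (hausdorff_gauge s \o uncurry G) i)).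
  apply: ereal_inf_lbound => /=.
  have /card_esym/ppcard_eqP[f] := card_nat2.
  exists (uncurry G \o f).
    split => [i|t [i _ Ait]] /=.
      by case: (f i) => n k; exact: (PG n).1.1.
    have [j _ Gij] := (PG i).1.2 _ Ait.
    by exists (f^-1%FUN (i, j)) => //=; rewrite invK ?inE.
  rewrite -(esum_pred_image (hausdorff_gauge s \o uncurry G) _ xpredT)
    ?[fun=> _]set_true//.
  by rewrite image_eq.
rewrite (_ : esum _ _ =
    \sum_(i <oo) \sum_(j <oo) hausdorff_gauge s (G i j)); last first.
  pose J : nat -> set (nat * nat) := fun i => [set (i, j) | j in setT].
  rewrite (_ : setT = \bigcup_k J k); last first.
    by rewrite predeqE => -[a b]; split => // _; exists a => //; exists b.
  rewrite esum_bigcupT /=; last 2 first.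
    - apply/trivIsetP => i j _ _ ij.
      rewrite predeqE => -[n m] /=; split => //= -[] [_] _ [<-{n} _].
      by move=> [m' _] [] /esym/eqP; rewrite (negbTE ij).
    - by move=> /= [n m]; exact: (gG0 (n, m)).
  rewrite -(image_id [set: nat]) -fun_true esum_pred_image//; last first.
    by move=> n _; apply: esum_ge0 => x _; exact: gG0.
  apply: eq_eseriesr => /= j _.
  rewrite -(esum_pred_image (hausdorff_gauge s \o uncurry G) (pair j) predT)//=; last 2 first.
  - by move=> n _; exact: (gG0 (j, n)).
  - by move=> ? ? _ _; exact: (@can_inj _ _ _ snd).
  by congr esum; rewrite predeqE => -[a b]; split; move=> [i _ <-]; exists i.
apply: lee_nneseries => [n _ _|n _]; last exact: (PG n).2.
by apply: nneseries_ge0 => m *; exact: (gG0 (n, m)).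
Qed.

Lemma hausdorff_measure_ge0 s A : 0 <= hausdorff_measure s A.
Proof.
apply: le_trans (hausdorff_content_ge0 s 1 A) _.
by apply: ereal_sup_ubound; exists 1%R => /=.
Qed.

Lemma hausdorff_measure0 s : hausdorff_measure s (set0 : set T) = 0.
Proof.
apply/eqP; rewrite eq_le hausdorff_measure_ge0 andbT.
by apply: ge_ereal_sup => _ [d _ <-]; rewrite hausdorff_content0.
Qed.

Lemma hausdorff_content_le_measure s delta A : (0 < delta)%R ->
  hausdorff_content s delta A <= hausdorff_measure s A.
Proof. by move=> d0; apply: ereal_sup_ubound; exists delta. Qed.

Lemma le_hausdorff_measure s :
  {homo (hausdorff_measure s : set T -> \bar R) : A B / A `<=` B >-> A <= B}.
Proof.
move=> A B AB; apply: ge_ereal_sup => _ [d d0 <-].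
apply: le_trans (hausdorff_content_le_measure s B d0).
exact: le_hausdorff_content.
Qed.

Lemma hausdorff_measure_sigma_subadditive s :
  sigma_subadditive (hausdorff_measure s : set T -> \bar R).
Proof.
move=> A; apply: ge_ereal_sup => _ [d d0 <-].
apply: le_trans (hausdorff_content_sigma_subadditive _ _ _) _.
apply: lee_nneseries => [n _ _|n _]; first exact: hausdorff_content_ge0.
exact: hausdorff_content_le_measure.
Qed.

HB.instance Definition _ (s : R) := isOuterMeasure.Build R T
  (hausdorff_measure s : set T -> \bar R)
  (hausdorff_measure0 s) (hausdorff_measure_ge0 s)
  (@le_hausdorff_measure s) (@hausdorff_measure_sigma_subadditive s).

End hausdorff_outer_measure.

(* The measure obtained by restricting [mu] to its Caratheodory-measurable
   sets; "mu-measurable" always refers to this sigma-algebra. *)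
Definition measure_of {R : realType} {T : pmetricType R}
    (mu : {outer_measure set T -> \bar R}) :
  {measure set (caratheodory_type mu) -> \bar R} :=
  mu : set (caratheodory_type mu) -> \bar R.

Section metric_measure_spaces.
Context {R : realType} {T : pmetricType R}.
Implicit Type mu : {outer_measure set T -> \bar R}.
Local Open Scope ereal_scope.

Definition borel_regular mu :=
  (forall B : set T, <<s open >> B -> mu.-caratheodory B) /\
  (forall A : set T, exists B : set T, [/\ <<s open >> B, A `<=` B & mu B = mu A]).

Definition metric_measure_space mu :=
  borel_regular mu /\
  (forall (x : T) (r : R), (0 < r)%R -> 0 < mu (ball x r) < +oo).

Definition ahlfors_regular (Q : R) mu :=
  metric_measure_space mu /\
  exists2 C : R, (0 < C)%R & forall (x : T) (r : R),
    (0 < r)%R -> r%:E < diam [set: T] ->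
    (C^-1 * r `^ Q)%:E <= mu (ball x r) <= (C * r `^ Q)%:E.

End metric_measure_spaces.

Section subsets.
Context {R : realType} {Z : pmetricType R}.

Definition ahlfors_regular_subset (lambda : R) {F : set Z} (F0 : F !=set0) :=
  [/\ closed F, hausdorff_dim F = lambda%:E &
    @ahlfors_regular R (metric_subspace F0) lambda (hausdorff_measure lambda)].

Definition porous (F : set Z) :=
  closed F /\
  exists c : R, [/\ 0 < c, c < 1 & forall (z : Z) (r : R),
    0 < r -> (r%:E < diam [set: Z])%E -> ball z r `&` F !=set0 ->
    exists xi : Z, ball xi (c * r) `<=` ball z r `\` F].

End subsets.

Section complex_functions.
Context {R : realType} {T : pmetricType R}.
Variable mu : {outer_measure set T -> \bar R}.
Implicit Type f : T -> R[i].

Definition cmeasurable f :=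
  measurable_fun [set: caratheodory_type mu] (fun x => complex.Re (f x)) /\
  measurable_fun [set: caratheodory_type mu] (fun x => complex.Im (f x)).

Definition cintegrable (A : set T) f :=
  (measure_of mu).-integrable A (fun x => (complex.Re (f x))%:E) /\
  (measure_of mu).-integrable A (fun x => (complex.Im (f x))%:E).

Definition cintegral (A : set T) f : R[i] :=
  Complex (\int[measure_of mu]_(x in A) complex.Re (f x))
          (\int[measure_of mu]_(x in A) complex.Im (f x)).

Definition L1loc : set (T -> R[i]) :=
  [set f | cmeasurable f /\ forall x r, cintegrable (ball x r) f].

Definition ae_equal (f g : T -> R[i]) :=
  {ae measure_of mu, forall x, f x = g x}.

Definition ae_equal_mod_cst (f g : T -> R[i]) :=
  exists c : R[i], ae_equal (fun x => f x - g x) (fun=> c).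

End complex_functions.

Section hajlasz_sobolev.
Context {R : realType} {Z : pmetricType R}.
Variables (mu : {outer_measure set Z -> \bar R}) (p : R).
Implicit Type f : Z -> R[i].
Local Open Scope ereal_scope.

Definition hajlasz_gradient f : set (Z -> \bar R) :=
  [set g | [/\ forall x, 0 <= g x,
    measurable_fun [set: caratheodory_type mu] g,
    'N[measure_of mu]_(p%:E)[g] < +oo &
    forall x y, (normc (f x - f y))%:E <= (mdist x y)%:E * (g x + g y)]].

Definition hajlasz_space : set (Z -> R[i]) :=
  [set f | cmeasurable mu f /\ hajlasz_gradient f !=set0].

Definition hajlasz_norm f : \bar R :=
  ereal_inf [set 'N[measure_of mu]_(p%:E)[g] | g in hajlasz_gradient f].

End hajlasz_sobolev.

(* The vertex (n, xi) stands for the point xi of the net at level n, so that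
   X_n is [net n]; points of one net are distinct by separation. The oriented
   edge e is the pair (e_-, e_+). *)
Section filling.
Context {R : realType} {T : metricType R}.

Definition net_separated (n : int) (A : set T) :=
  forall x y, A x -> A y -> x <> y -> (2 : R) ^ (- n - 1) <= mdist x y.

Definition vball (v : int * T) : set T := ball v.2 ((2 : R) ^ (- v.1)).

Definition adjacent (net : int -> set T) (v w : int * T) :=
  [/\ net v.1 v.2, net w.1 w.2, v <> w, `|v.1 - w.1| <= 1 &
    vball v `&` vball w !=set0].

Definition elevel (e : (int * T) * (int * T)) : int := Num.min e.1.1 e.2.1.

Definition eball (e : (int * T) * (int * T)) : set T := vball e.1 `|` vball e.2.

End filling.

Record hyperbolic_filling (R : realType) (T : metricType R) := HyperbolicFilling {
  net : int -> set T ;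
  net_is_separated : forall n, net_separated n (net n) ;
  net_is_maximal : forall n A,
    net_separated n A -> net n `<=` A -> A = net n ;
  edge : set ((int * T) * (int * T)) ;
  edge_adjacent : forall v w, edge (v, w) -> adjacent net v w ;
  edge_level : forall v w, edge (v, w) -> v.1 <= w.1 ;
  adjacent_edge : forall v w, adjacent net v w -> edge (v, w) \/ edge (w, v) ;
  edge_asym : forall v w, edge (v, w) -> ~ edge (w, v)
}.

Section besov.
Context {R : realType} {T : pmetricType R}.
Variables (nu : {outer_measure set T -> \bar R}) (X : hyperbolic_filling T).
Implicit Type f : T -> R[i].

Definition vaverage f (v : int * T) : R[i] :=
  (real_complex R (fine (nu (vball v))))^-1 * cintegral nu (vball v) f.

Definition edge_diff (u : int * T -> R[i]) (e : (int * T) * (int * T)) : R[i] :=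
  u e.2 - u e.1.

Definition besov_level f (k : int) (x : T) : \bar R :=
  \esum_(e in [set e | edge X e /\ elevel e = k])
    (normc (edge_diff (vaverage f) e) * \1_(eball e) x)%:E.

Definition besov_norm (sigma p q : R) f : \bar R :=
  ((\esum_(k in [set: int]) ((2 `^ (k%:~R * sigma * q))%:E *
     'N[measure_of nu]_(p%:E)[besov_level f k] `^ q)) `^ q^-1)%E.

Definition besov_space (sigma p q : R) : set (T -> R[i]) :=
  [set f | L1loc nu f /\ (besov_norm sigma p q f < +oo)%E].

End besov.

(* Elements of the function spaces are classes of functions, so an operator is
   given on representatives: it is linear up to almost everywhere equality and
   compatible both with almost everywhere equality and with almost everywhere
   equality modulo constants. *)
Definition bounded_linear_operator {R : realType} {S T : pmetricType R}
    (mu : {outer_measure set S -> \bar R}) (nu : {outer_measure set T -> \bar R})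
    (V : set (S -> R[i])) (normV : (S -> R[i]) -> \bar R)
    (W : set (T -> R[i])) (normW : (T -> R[i]) -> \bar R)
    (L : (S -> R[i]) -> (T -> R[i])) :=
  [/\ forall f, V f -> W (L f),
    forall f g, V f -> V g -> ae_equal mu f g -> ae_equal nu (L f) (L g),
    forall f g, V f -> V g ->
      ae_equal_mod_cst mu f g -> ae_equal_mod_cst nu (L f) (L g),
    forall (a : R[i]) f g, V f -> V g ->
      ae_equal nu (L (fun x => a * f x + g x)) (fun x => a * L f x + L g x) &
    exists2 C : R, 0 <= C & forall f, V f -> (normW (L f) <= C%:E * normV f)%E].

(* Main.v *)
Require Import Defs.
From mathcomp Require Import all_boot all_order all_algebra.
From mathcomp Require Import finmap.
From mathcomp Require Import all_classical all_reals all_analysis.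
From mathcomp Require Import measurable_realfun complex.
From mathcomp Require Import ring lra zify.
Import Order.TTheory GRing.Theory Num.Theory.
Import numFieldNormedType.Exports.
Import Normc.
Set Implicit Arguments.
Unset Strict Implicit.
Unset Printing Implicit Defensive.
Local Open Scope classical_set_scope.
Local Open Scope ring_scope.

(** Off [F] a vertex function [u] on the filling is extended by a partition of
    unity of Whitney type, whose Hajlasz gradient at [y] is a constant times the
    largest [|du(e)| / 2^(-|e|)] over the edges [e] near [y] at the scale of the
    distance to [F]; its [p]-th power integrates to the energy
    [sum_e 2^(-|e|(Q - p)) |du(e)|^p], which is comparable to the [p]-th power of
    the Besov norm when [u] consists of averages.  Conversely every vertex owns a
    ball in the complement of [F] of comparable size (a hole), and the holes have
    bounded overlap.  A function with Hajlasz gradient [g] varies little on most of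
    a hole, so it has a limit in measure along the holes over almost every point of
    [F]; this limit is the trace.  Its oscillation at a vertex is controlled by the
    mean of [g^p] over holes at finer levels, and the assumption
    [p > Q / (lambda + 1)] makes the resulting geometric sums over levels converge
    (with weights from concavity if [p <= 1], from Young's inequality otherwise).
    The trace of an extension is the limit of the averages of [f] at its vertices,
    which is [f] by the Lebesgue differentiation theorem. *)

(** * Unordered sums of nonnegative families *)

(** The argument is carried out for an isometric embedding [i : T -> Z] with closed porous range and
    an Ahlfors regular measure on [T]; the subset [F] appears only in the final theorem. The value
    of sigma is dictated by s - sigma p = Q - p: the weight of an edge in the Besov norm then equals
    the p-th power integral over a ball of [Z] of a gradient of size |du| / rr.

    The two bounds on p have different tasks. The bound p > Q - s says sigma > 0, so that values
    along a chain of vertices above a point converge. The bound p > Q / (s + 1), that is s p + p >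
    Q, is the stronger one for p <= 1 and controls the trace there; for p > 1 the trace uses p > Q -
    s.

    Two obstacles shape the details. If [T] is bounded, lower regularity fails for large radii; at
    those coarse levels every vertex ball is all of [T], so averages do not vary and the edges
    contribute nothing. And [range i] is a null set, so a class of functions on [Z] has no values
    there: the trace must be read from the holes, while the gradient of an extension may be infinite
    on [range i]. *)

Section ereal_power.
Context {R : realType}.
Implicit Types (x y : \bar R) (p r : R).
Local Open Scope ereal_scope.

Lemma le_poweR2 r x y : (0 <= r)%R -> 0 <= x -> x <= y -> x `^ r <= y `^ r.
Proof.
move=> r0 x0 xy; apply: gt0_ler_poweR => //; rewrite in_itv/= leey andbT//.
exact: le_trans xy.
Qed.

Lemma poweRVK p x : p != 0%R -> 0 <= x -> (x `^ p^-1) `^ p = x.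
Proof. by move=> p0 x0; rewrite -poweRrM mulVf// poweRe1. Qed.

Lemma poweRKV p x : p != 0%R -> 0 <= x -> (x `^ p) `^ p^-1 = x.
Proof. by move=> p0 x0; rewrite -poweRrM mulfV// poweRe1. Qed.

Lemma lee_poweRV p x y : (0 < p)%R -> 0 <= x -> 0 <= y ->
  x `^ p <= y -> x <= y `^ p^-1.
Proof.
move=> p0 x0 y0 xy; rewrite -[x](poweRKV (lt0r_neq0 p0))//.
apply: le_poweR2 => //; first by rewrite invr_ge0 ltW.
exact: poweR_ge0.
Qed.

End ereal_power.

(** * Counting bounds *)

Section at_most.
Implicit Types (I J : choiceType).

(** Phrasing the bound through duplicate-free lists yields finiteness and the numerical bound
    together, and it composes well under unions and fibrations. *)
Definition at_most I (M : nat) (D : set I) :=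
  forall s : seq I, uniq s -> (forall x, x \in s -> D x) -> (size s <= M)%N.

Lemma at_most_sub I M (D D' : set I) : D `<=` D' -> at_most M D' -> at_most M D.
Proof. by move=> DD' D'M s us sD; apply: D'M => // x /sD /DD'. Qed.

Lemma at_mostW I M N (D : set I) : (M <= N)%N -> at_most M D -> at_most N D.
Proof. by move=> MN DM s us sD; apply: leq_trans MN; exact: DM. Qed.

Lemma at_mostU I M N (A B : set I) :
  at_most M A -> at_most N B -> at_most (M + N) (A `|` B).
Proof.
move=> AM BN s us sAB; rewrite -(count_predC (fun x => x \in A)) leq_add//.
- rewrite -size_filter; apply: AM; first exact: filter_uniq.
  by move=> x; rewrite mem_filter => /andP[/set_mem].
- rewrite -size_filter; apply: BN; first exact: filter_uniq.
  move=> x; rewrite mem_filter => /andP[/= xA /sAB[Ax|//]].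
  by rewrite mem_set in xA.
Qed.

Lemma at_most_bind I J (f : I -> J) M N (D : set I) (A : set J) :
  (forall x, D x -> A (f x)) -> at_most M A ->
  (forall y, A y -> at_most N [set x | D x /\ f x = y]) ->
  at_most (M * N) D.
Proof.
move=> DA AM fN s us sD.
(* Generalised to a list [t] of possible images, so that each induction step splits off one fibre
   with at most [N] elements. *)
have tN (t : seq J) : (forall y, y \in t -> A y) ->
    forall s' : seq I, uniq s' -> (forall x, x \in s' -> D x /\ f x \in t) ->
    (size s' <= size t * N)%N.
  elim: t => [_ [//|a s'] _ /(_ a)|y t IH tA s' us' s't].
    by rewrite inE eqxx => /(_ isT) -[].
  rewrite -(count_predC (fun x => f x == y)) mulSn leq_add//.
    rewrite -size_filter; apply: (fN y); first by apply: tA; rewrite mem_head.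
      exact: filter_uniq.
    by move=> x; rewrite mem_filter => /andP[/eqP fxy /s't[]].
  rewrite -size_filter; apply: IH; [|exact: filter_uniq|].
    by move=> z zt; apply: tA; rewrite inE zt orbT.
  move=> x; rewrite mem_filter => /andP[/= fxy /s't[Dx]].
  by rewrite inE (negbTE fxy).
have := tN (undup (map f s)); move=> /(_ _ s us) H.
apply: leq_trans (H _ _) _.
- by move=> y; rewrite mem_undup => /mapP[x /sD/DA Ax ->].
- by move=> x xs; split; [exact: sD|rewrite mem_undup map_f].
- rewrite leq_mul2r; apply/orP; right; apply: AM; first exact: undup_uniq.
  by move=> y; rewrite mem_undup => /mapP[x /sD/DA Ax ->].
Qed.

Lemma at_most_finite I M (D : set I) : at_most M D -> finite_set D.
Proof.
move=> DM; apply: contrapT => /(infinite_set_fset M.+1)[B BD].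
by apply/negP; rewrite -ltnNge ltnS; apply: DM => // x xB; exact: BD.
Qed.

Lemma at_most_subsingle I (D : set I) : (forall x y, D x -> D y -> x = y) ->
  at_most 1 D.
Proof.
move=> DE [//|a [//|b s]] /=; rewrite inE negb_or => /andP[/andP[ab _] _] sD.
case/negP: ab; apply/eqP/DE; apply: sD; rewrite !inE eqxx ?orbT//.
Qed.

End at_most.

Section esum_lemmas.
Context {R : realType}.
Implicit Types (I J K : choiceType).
Local Open Scope ereal_scope.

Lemma esum_term I (D : set I) (a : I -> \bar R) x :
  D x -> 0 <= a x -> a x <= \esum_(i in D) a i.
Proof.
move=> Dx ax; apply: esum_ge; exists [set x]; last by rewrite fsbig_set1.
by split=> // y ->.
Qed.

Lemma at_most_esum I M (D : set I) (a : I -> \bar R) (c : \bar R) :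
  at_most M D -> 0 <= c -> (forall x, D x -> a x <= c) ->
  \esum_(i in D) a i <= M%:R%:E * c.
Proof.
move=> DM c0 ac; apply: ge_ereal_sup => _ [X [finX XD] <-].
rewrite fsbig_finite//=.
have aXc i : i \in fset_set X -> a i <= c.
  by rewrite in_fset_set// inE => /XD/ac.
rewrite big_seq; apply: le_trans (lee_sum _ aXc) _; rewrite -big_seq.
rewrite big_const_seq count_predT.
have -> n : iter n (+%E c) 0 = n%:R%:E * c.
  elim: n => [|n IH]; first by rewrite mul0e.
  by rewrite iterS IH -add1n natrD EFinD ge0_muleDl ?lee_fin// mul1e.
rewrite lee_wpmul2r// lee_fin ler_nat; apply: DM => // x.
by rewrite in_fset_set// inE => /XD.
Qed.

Lemma le_esum_sub I (D D' : set I) (a b : I -> \bar R) : D `<=` D' ->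
  (forall i, D i -> a i <= b i) -> (forall i, D' i -> 0 <= b i) ->
  \esum_(i in D) a i <= \esum_(i in D') b i.
Proof.
move=> DD' ab b0; apply: (@le_trans _ _ (\esum_(i in D) b i)).
  exact: le_esum.
apply: ge_ereal_sup => _ [X [finX XD] <-]; apply: esum_ge; exists X => //.
by split=> // x /XD/DD'.
Qed.

Lemma esumZl_le I (D : set I) (a : I -> \bar R) (c : R) : (0 <= c)%R ->
  (forall i, 0 <= a i) ->
  \esum_(i in D) (c%:E * a i) <= c%:E * \esum_(i in D) a i.
Proof.
move=> c0 a0; apply: ge_ereal_sup => _ [X [finX XD] <-].
rewrite -ge0_mule_fsumr// lee_wpmul2l ?lee_fin//.
by apply: esum_ge; exists X.
Qed.

Lemma esumZl I (D : set I) (a : I -> \bar R) (c : R) : (0 <= c)%R ->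
  (forall i, 0 <= a i) ->
  \esum_(i in D) (c%:E * a i) = c%:E * \esum_(i in D) a i.
Proof.
move=> c0 a0; apply/eqP; rewrite eq_le esumZl_le//=.
have [->|cn0] := eqVneq c 0%R.
  by rewrite mul0e; apply: esum_ge0 => i _; rewrite mul0e.
have cp : (0 < c)%R by rewrite lt_neqAle eq_sym cn0.
(* For c > 0 the reverse inequality is [esumZl_le] with factor 1/c, applied to the scaled family. *)
rewrite -(@lee_pmul2l _ c^-1%:E) ?lte_fin ?invr_gt0//.
rewrite muleA -EFinM mulVf// mul1e.
apply: le_trans (@esumZl_le _ _ _ c^-1 _ _); rewrite ?invr_ge0//; last first.
  by move=> i; rewrite mule_ge0.
by apply: le_esum => i _; rewrite muleA -EFinM mulVf// mul1e.
Qed.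

Lemma esum_fibre I K (l : I -> K) (D : set I) (a : I -> \bar R) :
  (forall i, D i -> 0 <= a i) ->
  \esum_(i in D) a i =
  \esum_(k in [set: K]) \esum_(i in [set i | D i /\ l i = k]) a i.
Proof.
move=> a0; rewrite esum_esum//; last by move=> k i _ [Di _]; exact: a0.
rewrite (reindex_esum ([set: K] `*`` (fun k => [set i | D i /\ l i = k])) D snd)//.
split.
- by move=> [k i] [_ []].
- move=> [k i] [k' i']; rewrite !inE => -[/= _ [_ <-]] [/= _ [_ <-]] ->//.
- by move=> i Di; exists (l i, i).
Qed.

Lemma exchange_esum I J (A : set I) (B : set J) (P : I -> J -> Prop)
    (a : I -> J -> \bar R) : (forall i j, 0 <= a i j) ->
  \esum_(i in A) \esum_(j in [set j | B j /\ P i j]) a i j =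
  \esum_(j in B) \esum_(i in [set i | A i /\ P i j]) a i j.
Proof.
move=> a0; rewrite !esum_esum//.
rewrite (reindex_esum (B `*`` (fun j => [set i | A i /\ P i j])) _
  (fun x => (x.2, x.1)))//=; split => /=.
- by move=> [j i] /= [Bj [Ai Pij]].
- by move=> [j i] [j' i'] _ _ /= [-> ->].
- by move=> [i j] /= [Ai [Bj Pij]]; exists (j, i).
Qed.

(** Each term is at most the p-th root of the sum of p-th powers, and there are at most [M] terms.
    The argument does not distinguish p < 1 from p >= 1. *)
Lemma esum_poweR_card I M p (D : set I) (a : I -> \bar R) : (0 < p)%R ->
  at_most M D -> (forall i, 0 <= a i) ->
  (\esum_(i in D) a i) `^ p <= (M%:R `^ p)%:E * \esum_(i in D) (a i `^ p).
Proof.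
move=> p0 DM a0; set S := \esum_(i in D) (a i `^ p).
have S0 : 0 <= S by apply: esum_ge0 => i _; exact: poweR_ge0.
have : \esum_(i in D) a i <= M%:R%:E * S `^ p^-1.
  apply: at_most_esum => //; first exact: poweR_ge0.
  move=> i Di; apply: lee_poweRV => //.
  by apply: (esum_term (a := fun i => a i `^ p)) => //; exact: poweR_ge0.
move=> /(le_poweR2 (ltW p0) (esum_ge0 (fun i _ => a0 i))).
rewrite poweRM ?lee_fin ?poweR_ge0// poweRVK ?gt_eqF// => /le_trans; exact.
Qed.

(** With S the right-hand side, each a is at most S^(1/p), hence a = a^(1-p) a^p <= S^(1/p - 1) a^p;
    summing gives S^(1/p). The cases S = 0 and S infinite are treated apart. *)
Lemma esum_poweR_le1 I p (D : set I) (a : I -> \bar R) : (0 < p <= 1)%R ->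
  (forall i, 0 <= a i) ->
  (\esum_(i in D) a i) `^ p <= \esum_(i in D) (a i `^ p).
Proof.
move=> /andP[p0 p1] a0; set S := \esum_(i in D) (a i `^ p).
have S0 : 0 <= S by apply: esum_ge0 => i _; exact: poweR_ge0.
have aS i : D i -> a i `^ p <= S.
  by move=> Di; apply: (esum_term (a := fun i => a i `^ p)) => //; exact: poweR_ge0.
have pn0 : p != 0%R by rewrite gt_eqF.
case: (eqVneq S +oo) => [->|Soo]; first by rewrite leey.
have [S00|Sn0] := eqVneq S 0.
  rewrite S00 esum1 ?poweR0r// => i Di.
  have := aS i Di; rewrite S00 => h; apply: (@poweR_eq0_eq0 _ _ p) => //.
  by apply/eqP; rewrite eq_le h poweR_ge0.
have Sf : S \is a fin_num by rewrite ge0_fin_numE// ltey.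
have [s Ss] : exists s, S = s%:E by exists (fine S); rewrite fineK.
rewrite Ss in aS Sn0 S0 *.
have s0 : (0 < s)%R by rewrite -lte_fin lt_neqAle eq_sym Sn0.
suff : \esum_(i in D) a i <= s%:E `^ p^-1.
  move=> /(le_poweR2 (ltW p0) (esum_ge0 (fun i _ => a0 i))).
  by rewrite poweRVK.
have ai i : D i -> a i <= (s `^ (p^-1 - 1))%:E * (a i `^ p).
  move=> Di; have ais := lee_poweRV p0 (a0 i) S0 (aS _ Di).
  have aif : a i \is a fin_num.
    by rewrite ge0_fin_numE// (le_lt_trans ais)// poweR_EFin ltry.
  move: ais (a0 i); rewrite -(fineK aif) !poweR_EFin !lee_fin => ais ai0.
  have [->|an0] := eqVneq (fine (a i)) 0%R.
    by rewrite powR0// mulr0.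
  rewrite -{1}[fine (a i)]powRr1// -{1}(subrK p 1%R) powRD ?an0 ?implybT//.
  rewrite ler_wpM2r ?powR_ge0//.
  have -> : (p^-1 - 1 = p^-1 * (1 - p))%R by rewrite mulrBr mulr1 mulVf.
  by rewrite powRrM ge0_ler_powR ?nnegrE ?subr_ge0 ?powR_ge0.
apply: le_trans (le_esum ai) _; rewrite esumZl ?powR_ge0//; last first.
  by move=> i; exact: poweR_ge0.
rewrite -/S Ss -EFinM poweR_EFin lee_fin -{2}[s](powRr1 (ltW s0)).
by rewrite -powRD ?subrK// (gt_eqF s0) implybT.
Qed.

End esum_lemmas.

Section integral_esum.
Context d {T : measurableType d} {R : realType} (m : {measure set T -> \bar R}).
Variables (I : choiceType) (D : set I) (E : set T) (f : I -> T -> \bar R).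
Hypothesis cD : countable D.
Hypothesis mE : measurable E.
Hypothesis f0 : forall i x, (0 <= f i x)%E.
Hypothesis mf : forall i, D i -> measurable_fun E (f i).
Local Open Scope ereal_scope.

Let enum : exists e : I -> nat, {in D &, injective e}.
Proof. exact/countable_injP. Qed.

Let e := projT1 (cid enum).
Let e_inj : {in D &, injective e} := projT2 (cid enum).

(** Fibres of the injection [e] are empty or singletons, which turns the unordered sum into a series
    of measurable functions, open to monotone convergence. *)
Let J n := [set i | D i /\ e i = n].

Let JP n : J n = set0 \/ exists2 i, D i & J n = [set i].
Proof.
have [->|/set0P[i [Di ein]]] := eqVneq (J n) set0; first by left.
right; exists i => //; apply/seteqP; split=> [j [Dj ejn]|j ->//].
by apply: e_inj; rewrite ?inE// ein.
Qed.

Let esumE (a : I -> \bar R) : (forall i, 0 <= a i) ->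
  \esum_(i in D) a i = \sum_(n <oo) \esum_(i in J n) a i.
Proof.
move=> a0; rewrite (esum_fibre e)//; rewrite nneseries_esumT// => n.
exact: esum_ge0.
Qed.

Let mfJ n : measurable_fun E (fun x => \esum_(i in J n) f i x).
Proof.
have [->|[i Di ->]] := JP n.
  rewrite (_ : (fun _ => _) = cst 0)//; apply/funext => x.
  exact: esum_set0.
rewrite (_ : (fun _ => _) = f i); first exact: mf.
by apply/funext => x; rewrite esum_set1.
Qed.

Lemma emeasurable_esum : measurable_fun E (fun x => \esum_(i in D) f i x).
Proof.
rewrite (_ : (fun _ => _) = (fun x => \sum_(n <oo) \esum_(i in J n) f i x)).
  by apply: (@ge0_emeasurable_sum _ _ _ _ _ xpredT) => // n x _ _; exact: esum_ge0.
by apply/funext => x; rewrite esumE.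
Qed.

Lemma integral_esum : \int[m]_(x in E) (\esum_(i in D) f i x) =
  \esum_(i in D) \int[m]_(x in E) f i x.
Proof.
rewrite esumE; last by move=> i; exact: integral_ge0.
under eq_integral do rewrite esumE//.
rewrite integral_nneseries//; last by move=> n x _; exact: esum_ge0.
apply: eq_eseriesr => n _; have [->|[i Di ->]] := JP n.
  by rewrite esum_set0; under eq_integral do rewrite esum_set0; rewrite integral0.
by rewrite esum_set1 ?integral_ge0//; under eq_integral do rewrite esum_set1//.
Qed.

End integral_esum.

Section geometric.
Context {R : realType}.
Local Open Scope ereal_scope.

Lemma nneseries_geometric_le (q : R) : (0 <= q < 1)%R ->
  \sum_(n <oo) (q ^+ n)%:E <= ((1 - q)^-1)%:E.
Proof.
move=> /andP[q0 q1]; apply: lime_le.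
  by apply: is_cvg_nneseries => n _ _; rewrite lee_fin exprn_ge0.
apply: nearW => n; rewrite sumEFin lee_fin -[leRHS]mul1r ler_pdivlMr ?subr_gt0//.
rewrite big_mkord mulrC.
by have := subrX1 q n; have := exprn_ge0 n q0; lra.
Qed.

Lemma esum_geometric_le (q : R) (j : int) : (0 <= q < 1)%R ->
  \esum_(k in [set k : int | (k <= j)%R]) (q ^ (j - k))%:E <= ((1 - q)^-1)%:E.
Proof.
move=> q01; have q0 : (0 <= q)%R by case/andP: q01.
rewrite (reindex_esum [set: nat] _ (fun n : nat => j - n%:Z)%R); last first.
  split.
  - by move=> n _ /=; rewrite lerBlDr lerDl.
  - by move=> n n' _ _ /(congr1 (fun z => j - z)%R); rewrite !subKr => -[].
  - move=> k /= kj; exists `|j - k|%N => //=.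
    by rewrite gez0_abs ?subr_ge0// subKr.
rewrite -nneseries_esumT; last first.
  by move=> n; rewrite subKr lee_fin exprn_ge0.
under eq_eseriesr do rewrite subKr.
exact: nneseries_geometric_le.
Qed.

End geometric.

(** * Nets and chains of vertices *)

Section complex_modulus.
Context {R : realType}.
Implicit Types x y z : R[i].

Lemma ler_normcD x y : normc (x + y) <= normc x + normc y.
Proof. exact: le_normcD. Qed.

Lemma normc_opp x : normc (- x) = normc x.
Proof. exact: normcN. Qed.

Lemma normc_sub x y : normc (x - y) = normc (y - x).
Proof. by rewrite -opprB normc_opp. Qed.

Lemma normc_triangle y x z : normc (x - z) <= normc (x - y) + normc (y - z).
Proof. by apply: le_trans (ler_normcD _ _); rewrite addrA subrK. Qed.

Lemma normc_ge0 x : 0 <= normc x.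
Proof. by case: x => a b; rewrite sqrtr_ge0. Qed.

Lemma normc_Re x : `|complex.Re x| <= normc x.
Proof.
case: x => a b /=; rewrite -sqrtr_sqr ler_wsqrtr// lerDl sqr_ge0//.
Qed.

Lemma normc_Im x : `|complex.Im x| <= normc x.
Proof.
case: x => a b /=; rewrite -sqrtr_sqr ler_wsqrtr// lerDr sqr_ge0//.
Qed.

Lemma normc_ReIm x : normc x <= `|complex.Re x| + `|complex.Im x|.
Proof.
case: x => a b /=; rewrite -(ler_sqr (x := Num.sqrt _)) ?nnegrE ?sqrtr_ge0 ?addr_ge0//.
rewrite sqr_sqrtr ?addr_ge0 ?sqr_ge0// sqrrD !real_normK ?num_real//.
by rewrite lerD2r lerDl mulrn_wge0// mulr_ge0.
Qed.

Lemma ReB x y : complex.Re (x - y) = complex.Re x - complex.Re y.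
Proof. by case: x; case: y. Qed.

Lemma ImB x y : complex.Im (x - y) = complex.Im x - complex.Im y.
Proof. by case: x; case: y. Qed.

End complex_modulus.

Section dyadic_radius.
Context {R : realType}.
Implicit Types (m n k : int).

Definition rr n : R := 2 ^ (- n).

Lemma rr_gt0 n : 0 < rr n. Proof. by rewrite exprz_gt0. Qed.
Lemma rr_ge0 n : 0 <= rr n. Proof. exact/ltW/rr_gt0. Qed.
Hint Extern 0 (is_true (0 < rr _)) => solve [exact: rr_gt0] : core.
Hint Extern 0 (is_true (0 <= rr _)) => solve [exact: rr_ge0] : core.

Lemma rrD m n : rr (m + n) = rr m * rr n.
Proof. by rewrite /rr opprD expfzDr. Qed.

Lemma rrS n : rr (n + 1) = rr n / 2.
Proof. by rewrite rrD. Qed.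

Lemma rr_nat (n : nat) : rr n%:Z = (2^-1) ^+ n.
Proof. by rewrite /rr -invr_expz exprVn. Qed.

Lemma ler_rr m n : m <= n -> rr n <= rr m.
Proof. by move=> mn; rewrite ler_eXz2l ?lerN2// ltr1n. Qed.

Lemma powR_rr n a : (2:R) `^ (n%:~R * a) = rr n `^ (- a).
Proof.
rewrite powRrM powR_intmul// /rr -invr_expz -powR_inv1 ?exprz_ge0//.
by rewrite -powRrM mulN1r opprK.
Qed.

Lemma exists_level (r : R) : 0 < r -> exists n, rr n <= r < 2 * rr n.
Proof.
(* [L] is the base-two logarithm of [r]; the sign appears because larger levels have smaller
   radii. *)
move=> r0; pose L := ln r / ln 2; exists (- Num.floor L).
have ln2 : 0 < ln (2 : R) by rewrite ln_gt0// ltr1n.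
have rL : r = expR (L * ln 2) by rewrite mulfVK ?lnK ?gt_eqF// posrE.
have rrE : rr (- Num.floor L) = expR ((Num.floor L)%:~R * ln 2).
  by rewrite /rr opprK -powR_intmul// /powR pnatr_eq0.
rewrite rrE {1 2}rL ler_expR ler_pM2r// floor_le.
rewrite -[X in _ < X * _]lnK ?posrE// -expRD ltr_expR -{2}[ln 2]mul1r -mulrDl.
by rewrite ltr_pM2r// addrC -intrD1 floorD1_gt.
Qed.

End dyadic_radius.
#[global] Hint Extern 0 (is_true (0 < rr _)) => solve [exact: rr_gt0] : core.
#[global] Hint Extern 0 (is_true (0 <= rr _)) => solve [exact: rr_ge0] : core.

Section filling_geometry.
Context {R : realType} {T : pmetricType R} (X : hyperbolic_filling T).
Implicit Types (u : int * T -> R[i]) (v w : int * T) (n m : int).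
Implicit Types (e : (int * T) * (int * T)).

Lemma mdist_tri (y x z : T) : mdist x z <= mdist x y + mdist y z.
Proof. exact: metric_triangle. Qed.

(** Otherwise [x] could be added to the net without losing separation, against maximality. *)
Lemma net_cover n x : exists2 xi, net X n xi & mdist x xi < rr n / 2.
Proof.
apply: contrapT => H.
have far xi : net X n xi -> rr n / 2 <= mdist x xi.
  by move=> nxi; rewrite leNgt; apply/negP => xxi; apply: H; exists xi.
have rE : (2 : R) ^ (- n - 1) = rr n / 2 by rewrite -opprD -[LHS]/(rr _) rrS.
have sepU : net_separated n (net X n `|` [set x]).
  move=> y z [ny|->] [nz|->] yz.
  - exact: (net_is_separated ny nz yz).
  - by rewrite metric_sym rE far.
  - by rewrite rE far.
  - by [].
have := net_is_maximal sepU (@subsetUl _ _ _) => nE.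
have nx : net X n x by rewrite -nE; right.
by have := far _ nx; rewrite mdistxx leNgt divr_gt0//.
Qed.

Lemma net_sep n x y : net X n x -> net X n y -> mdist x y < rr n / 2 -> x = y.
Proof.
move=> nx ny xy; apply: contrapT => /(net_is_separated nx ny).
by rewrite -opprD -[X in X <= _]/(rr _) rrS leNgt xy.
Qed.

(** The orientation puts the coarser vertex first, so [e.1.1] serves as the level of the edge from
    here on. *)
Lemma edgeP e : edge X e -> [/\ net X e.1.1 e.1.2, net X e.2.1 e.2.2,
  e.2.1 = e.1.1 \/ e.2.1 = e.1.1 + 1, elevel e = e.1.1 &
  mdist e.1.2 e.2.2 < 2 * rr e.1.1].
Proof.
case: e => [[n xi] [k eta]] evw; have /= vw := edge_level evw.
have /= [nv nw _ lvw [z [vz wz]]] := edge_adjacent evw; split => //=.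
- by move: lvw vw; rewrite /= ler_norml; lia.
- by rewrite /elevel /= min_l.
- move: vz wz; rewrite /vball !ballEmdist /= => vz wz.
  have wv : rr k <= rr n :> R by exact: ler_rr.
  have := mdist_tri z xi eta; rewrite (metric_sym z eta).
  move: vz wz; rewrite -/(rr n) -/(rr k); lra.
Qed.

(** Two vertices whose balls share [z] are equal or joined by an edge. Between different levels the
    edge starts at [v]; at equal levels the orientation is unknown, which explains the disjunction
    in the hypothesis on edges. *)
Lemma link u v w (z : T) (B : R) : 0 <= B ->
  net X v.1 v.2 -> net X w.1 w.2 -> v.1 <= w.1 <= v.1 + 1 ->
  mdist v.2 z < rr v.1 -> mdist w.2 z < rr w.1 ->
  (forall e, edge X e -> e.1.1 = v.1 ->
    e.1 = v \/ (e.1 = w /\ v.1 = w.1) -> normc (edge_diff u e) <= B) ->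
  normc (u v - u w) <= B.
Proof.
case: v w => [n xi] [k eta] /= B0 nv nw /andP[vw wv] vz wz eB.
pose v := (n, xi); pose w := (k, eta).
have [->|vnw] := pselect ((n, xi) = (k, eta)); first by rewrite subrr normc0.
have adj : Defs.adjacent (net X) v w.
  split=> //=; first by rewrite ler_norml; lia.
  by exists z; rewrite /vball !ballEmdist.
case: (adjacent_edge adj) => evw.
  have := eB _ evw erefl (or_introl erefl).
  by rewrite /edge_diff /= normc_sub.
have /= lwv := edge_level evw; have lE : n = k by lia.
by apply: (eB (w, v)) => //=; right.
Qed.

Section ladder.
Variables (u : int * T -> R[i]) (a S : R) (m : int).
Hypothesis a0 : 0 < a.
Hypothesis S0 : 0 <= S.

(** The sum of the geometric series of ratio 2^(-a). *)
Definition ladder_const := (1 - 2 `^ (- a))^-1 : R.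

Lemma two_powRN_lt1 : 2 `^ (- a) < 1 :> R.
Proof.
have E : (1 : R) = 1 `^ a by rewrite powR1.
by rewrite powRN invf_lt1 ?powR_gt0// [ltLHS]E gt0_ltr_powR ?nnegrE ?ltr1n.
Qed.

Lemma ladder_const_gt0 : 0 < ladder_const.
Proof. by rewrite invr_gt0 subr_gt0 two_powRN_lt1. Qed.

(** The geometric series in telescoping form: the bounds of successive steps in [descent] add up to
    a difference of powers. *)
Lemma ladder_constE n :
  rr n `^ a = ladder_const * (rr n `^ a - rr (n + 1) `^ a).
Proof.
rewrite rrS powRM// -powR_inv1// -powRrM mulN1r -{2}[rr n `^ a]mulr1 -mulrBr.
by rewrite /ladder_const mulrCA mulVf ?mulr1// gt_eqF// subr_gt0 two_powRN_lt1.
Qed.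

(** A Hoelder bound of exponent [a] on the edges met when passing from the vertex at [xi] to coarser
    vertices, up to level [m]. *)
Definition edges_below n xi := forall e, edge X e -> m <= e.1.1 <= n ->
  mdist xi e.1.2 < rr e.1.1 -> normc (edge_diff u e) <= rr e.1.1 `^ a * S.

(** At every level the next vertex is chosen close to the fixed point [xi], not to the previous
    vertex, so errors in position do not accumulate. *)
Lemma descent n xi (k : nat) : net X n xi -> edges_below n xi ->
  m <= n - k%:Z -> exists eta, [/\ net X (n - k%:Z) eta,
    mdist xi eta < rr (n - k%:Z) / 2 &
    normc (u (n, xi) - u (n - k%:Z, eta)) <=
      ladder_const * (rr (n - k%:Z) `^ a - rr n `^ a) * S].
Proof.
move=> nxi eb; elim: k => [|k IH] mk.
  exists xi; rewrite subr0 mdistxx; split=> //; first by rewrite divr_gt0.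
  by rewrite !subrr normc0 mulr0 mul0r.
have [|eta [neta xieta IHe]] := IH; first lia.
have [eta' neta' xieta'] := net_cover (n - k.+1%:Z) xi.
exists eta'; split=> //.
apply: le_trans (normc_triangle (u (n - k%:Z, eta)) _ _) _.
have kE : n - k%:Z = n - k.+1%:Z + 1 by lia.
have -> : ladder_const * (rr (n - k.+1%:Z) `^ a - rr n `^ a) * S =
   ladder_const * (rr (n - k%:Z) `^ a - rr n `^ a) * S + rr (n - k.+1%:Z) `^ a * S.
  rewrite [X in _ = _ + X * _]ladder_constE -kE; ring.
apply: lerD => //; rewrite normc_sub.
have rrh j : rr j / 2 < rr j :> R by have := @rr_gt0 R j; lra.
apply: (@link _ _ _ xi) => //=.
- by rewrite mulr_ge0 ?powR_ge0.
- lia.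
- by rewrite metric_sym (lt_trans xieta').
- by rewrite metric_sym (lt_trans xieta).
- move=> e ee le [e1|[_]]; last lia.
  rewrite -le; apply: eb => //; first lia.
  by rewrite e1 /= (lt_trans xieta').
Qed.

(** Both vertices are followed up to level [m]. The two vertices reached there have balls containing
    the second starting point, so one application of [link] joins them. *)
Lemma ladder v v' : net X v.1 v.2 -> net X v'.1 v'.2 -> m <= v.1 -> m <= v'.1 ->
  mdist v.2 v'.2 <= rr m / 2 -> edges_below v.1 v.2 -> edges_below v'.1 v'.2 ->
  normc (u v - u v') <= (2 * ladder_const + 1) * (rr m `^ a * S).
Proof.
case: v v' => [n xi] [n' xi'] /= nv nv' mn mn' dvv' eb eb'.
have kE j : m <= j -> j - `|j - m|%N%:Z = m by lia.
have [|eta [neta xieta De]] := @descent n xi `|n - m|%N nv eb.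
  by rewrite kE.
have [|eta' [neta' xieta' De']] := @descent n' xi' `|n' - m|%N nv' eb'.
  by rewrite kE.
rewrite !kE// in neta xieta De neta' xieta' De'.
have L0 := ladder_const_gt0.
have H1 j : ladder_const * (rr m `^ a - rr j `^ a) * S <= ladder_const * (rr m `^ a * S).
  by rewrite -mulrA ler_pM2l// ler_wpM2r// gerBl powR_ge0.
have E1 : normc (u (m, eta) - u (m, eta')) <= rr m `^ a * S.
  have B0 : 0 <= rr m `^ a * S by rewrite mulr_ge0 ?powR_ge0.
  apply: (@link _ _ _ xi') => //=.
  - lia.
  - by have := mdist_tri xi eta xi'; rewrite (metric_sym eta xi); lra.
  - by rewrite metric_sym; have := @rr_gt0 R m; lra.
  - have rm := @rr_gt0 R m.
    move=> e ee le [e1|[e1 _]]; rewrite -le.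
      by apply: eb => //; rewrite ?le ?e1/=; [lia|lra].
    by apply: eb' => //; rewrite ?le ?e1/=; [lia|lra].
apply: le_trans (normc_triangle (u (m, eta)) _ _) _.
have := normc_triangle (u (m, eta')) (u (m, eta)) (u (n', xi')).
rewrite [normc (u (m, eta') - _)]normc_sub.
by have := H1 n; have := H1 n'; lra.
Qed.

End ladder.

(** A doubling condition, uniform in the level; it is the form in which regularity of [T] enters the
    combinatorial estimates. *)
Definition net_count := forall A : R, exists M : nat, forall n (D : set T),
  D `<=` net X n -> (forall x y, D x -> D y -> mdist x y < A * rr n) ->
  at_most M D.

Lemma edge_count : net_count -> forall A : R, exists M : nat,
  forall n (D : set ((int * T) * (int * T))),
  D `<=` edge X -> (forall e, D e -> e.1.1 = n) ->
  (forall e e', D e -> D e' -> mdist e.1.2 e'.1.2 < A * rr n) -> at_most M D.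
Proof.
(* For a fixed first end, second ends are within 4 [rr n] of each other, which is 8 radii when they
   live at level [n + 1]. The two possible levels give [M2 + M2]. *)
move=> cX A; have [M1 HM1] := cX A; have [M2 HM2] := cX 8%:R.
exists (M1 * (M2 + M2))%N => n D DX Dn DA.
apply: (at_most_bind (f := fun e => e.1.2) (A := [set e.1.2 | e in D])).
- by move=> e De; exists e.
- apply: (HM1 n).
    by move=> _ [e De <-]; have [+ _ _ _ _] := edgeP (DX _ De); rewrite Dn.
  by move=> _ _ [e De <-] [e' De' <-]; exact: DA.
move=> xi _; rewrite -[X in at_most X]mul1n mulnC.
pose A_ k := [set w : int * T | w.1 = n + k /\ net X w.1 w.2 /\
  mdist xi w.2 < 2 * rr n].
apply: (at_most_bind (f := snd) (A := A_ 0 `|` A_ 1)).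
- move=> [[k1 x1] [k2 x2]] [/= De exi].
  have /= [_ nw lw _ dw] := edgeP (DX _ De).
  have /= k1n := Dn _ De; rewrite exi k1n in dw; rewrite k1n in lw.
  by case: lw => k2n; [left|right]; rewrite /A_/= ?addr0.
- have A_M k : 0 <= k <= 1 -> at_most M2 (A_ k).
    move=> k01; rewrite -[M2]muln1.
    apply: (at_most_bind (f := snd) (A := [set w.2 | w in A_ k])).
    + by move=> w; exists w.
    + apply: (HM2 (n + k)); first by move=> _ [w [wk [nw _]] <-]; rewrite -wk.
      move=> _ _ [w [_ [_ dw]] <-] [w' [_ [_ dw']] <-].
      have := mdist_tri xi w.2 w'.2; rewrite (metric_sym w.2 xi).
      have : rr (n + 1) <= rr (n + k) :> R by apply: ler_rr; lia.
      rewrite rrS; lra.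
    + move=> x _; apply: at_most_subsingle => -[k1 x1] [k2 x2].
      by move=> [[/= -> _] ->] [[/= -> _] ->].
  by apply: at_mostU; exact: A_M.
- move=> w _; apply: at_most_subsingle => -[[k1 x1] w1] [[k2 x2] w2].
  move=> [[/= D1 ->] ->] [[/= D2 ->] ->].
  by move: (Dn _ D1) (Dn _ D2) => /= -> ->.
Qed.

End filling_geometry.

(** * Ahlfors regularity and cells *)

Lemma countable_bigcup_measurable d (T : measurableType d) (I : choiceType)
    (D : set I) (F : I -> set T) : countable D ->
  (forall i, D i -> measurable (F i)) -> measurable (\bigcup_(i in D) F i).
Proof.
move=> /countable_injP[f finj] mF.
have -> : \bigcup_(i in D) F i =
    \bigcup_n \bigcup_(i in [set i | D i /\ f i = n]) F i.
  apply/seteqP; split=> [x [i Di Fix]|x [n _ [i [Di _] Fix]]]; last by exists i.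
  by exists (f i) => //; exists i.
apply: bigcupT_measurable => n.
have [->|/set0P[i [Di fi]]] := eqVneq [set i | D i /\ f i = n] set0.
  by rewrite bigcup_set0.
rewrite (_ : [set i | _] = [set i]) ?bigcup_set1; first exact: mF.
apply/seteqP; split=> [j [Dj fj]|j ->//].
by apply: finj; rewrite ?inE// fi.
Qed.

Section metric_borel.
Context {R : realType} {T : pmetricType R} (mu : {outer_measure set T -> \bar R}).

Lemma open_mball (x : T) r : open (ball x r).
Proof.
rewrite openE => y; rewrite ballEmdist /= => xy.
rewrite /interior -nbhs_ballE; exists (r - mdist x y) => /=; first by rewrite subr_gt0.
move=> z; rewrite !ballEmdist /= => yz.
by have := metric_triangle x y z; lra.
Qed.

Hypothesis mur : borel_regular mu.

Lemma open_measurable_cara (A : set T) : open A ->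
  measurable (A : set (caratheodory_type mu)).
Proof. by move=> oA; apply: mur.1; exact: sub_sigma_algebra. Qed.

Lemma closed_measurable_cara (A : set T) : closed A ->
  measurable (A : set (caratheodory_type mu)).
Proof.
move=> cA; rewrite -[A]setCK; apply: measurableC; apply: open_measurable_cara.
exact: closed_openC.
Qed.

Lemma measurable_mball (x : T) r : measurable (ball x r : set (caratheodory_type mu)).
Proof. exact/open_measurable_cara/open_mball. Qed.

(** Balls are removed one at a time through the Caratheodory identity, which splits an arbitrary set
    [U]. *)
Lemma packing (I : eqType) (s : seq I) (B : I -> set T) (U : set T) (c : \bar R) :
  uniq s -> (0 <= c)%E -> (forall i, i \in s -> open (B i)) ->
  (forall i j, i \in s -> j \in s -> i != j -> B i `&` B j = set0) ->
  (forall i, i \in s -> B i `<=` U) -> (forall i, i \in s -> (c <= mu (B i))%E) ->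
  ((size s)%:R%:E * c <= mu U)%E.
Proof.
elim: s U => [|i s IH] U /=; first by move=> *; rewrite mul0e outer_measure_ge0.
move=> /andP[nis us] c0 oB dB BU cB.
have mB : mu.-caratheodory (B i).
  by apply: open_measurable_cara; apply: oB; rewrite mem_head.
rewrite (mB U) -add1n natrD EFinD ge0_muleDl ?lee_fin// mul1e leeD//.
  apply: le_trans (cB i (mem_head _ _)) _; apply: le_outer_measure.
  by move=> x Bx; split=> //; exact: (BU i (mem_head _ _) x Bx).
apply: IH => //.
- by move=> j js; apply: oB; rewrite inE js orbT.
- by move=> j k js ks; apply: dB; rewrite inE ?js ?ks orbT.
- move=> j js x Bjx; split; first by apply: (BU j) => //; rewrite inE js orbT.
  move=> Bix; have ij : i != j by apply: contraNneq nis => ->.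
  have jis : j \in i :: s by rewrite inE js orbT.
  have /seteqP[+ _] := dB i j (mem_head _ _) jis ij.
  by move=> /(_ x); apply.
- by move=> j js; apply: cB; rewrite inE js orbT.
Qed.

End metric_borel.

Section diameter.
Context {R : realType} {T : pmetricType R}.

Lemma le_diamT (x y : T) : ((mdist x y)%:E <= diam [set: T])%E.
Proof. by apply: ereal_sup_ubound; exists (x, y). Qed.

Lemma diamT_le (r : R) : ~ (r%:E < diam [set: T])%E -> forall x y : T, mdist x y <= r.
Proof.
move=> /negP; rewrite -leNgt => dr x y; rewrite -lee_fin.
exact: le_trans (le_diamT x y) dr.
Qed.

End diameter.

(** On a one-point space the diameter is 0, so for s > 0 the gauge and the measure vanish, although
    balls must have positive measure. *)
Lemma hausdorff_nontrivial {R : realType} {T : pmetricType R} (s : R) : 0 < s ->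
  @metric_measure_space R T (hausdorff_measure s) -> exists x y : T, x <> y.
Proof.
move=> s0 [_ mT]; apply: contrapT => H.
have xy (x y : T) : x = y by apply: contrapT => xy; apply: H; exists x, y.
have d0 : diam [set: T] = 0%E.
  rewrite /diam (_ : [set _ | _ in _] = [set 0%E]) ?ereal_sup1//.
  apply/seteqP; split=> [_ [[x y] _ <-]|_ ->] /=; first by rewrite (xy x y) mdistxx.
  by exists (point, point) => //=; rewrite mdistxx.
have /andP[+ _] := mT point 1 ltr01; apply/negP; rewrite -leNgt.
apply: ge_ereal_sup => _ [d dp <-]; apply: ereal_inf_lbound.
exists (fun=> setT).
  by split=> [k|x _]; [rewrite d0 lee_fin ltW|exists 0].
rewrite eseries0// => k _ _; rewrite /hausdorff_gauge; case: ifP => // _.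
by rewrite d0 poweR0r// gt_eqF.
Qed.

Section ahlfors.
Context {R : realType} {T : pmetricType R} (nu : {outer_measure set T -> \bar R}).
Variable s : R.
Hypothesis s0 : 0 < s.
Hypothesis nuA : ahlfors_regular s nu.
Hypothesis T2 : exists x y : T, x <> y.

(** The definition speaks only of radii below the diameter D. If D is finite, the whole space has
    finite measure K, and for r >= D one has K <= (K / D^s) r^s. *)
Lemma ahlfors_upper : exists2 C : R, 0 < C &
  forall (x : T) r, 0 < r -> (nu (ball x r) <= (C * r `^ s)%:E)%E.
Proof.
have [[_ nub] [C C0 HC]] := nuA.
have [x0 [y0 xy0]] := T2.
have [D0 D0p D0xy] : exists2 D0 : R, 0 < D0 & (D0%:E <= diam [set: T])%E.
  by exists (mdist x0 y0); [rewrite mdist_gt0; apply/eqP|exact: le_diamT].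
have [Doo|Dfin] := eqVneq (diam [set: T]) +oo%E.
  by exists C => // x r r0; have := HC x r r0; rewrite Doo ltry => /(_ isT)/andP[].
have Df : diam [set: T] \is a fin_num.
  by rewrite ge0_fin_numE ?ltey// (le_trans _ D0xy)// lee_fin ltW.
pose D := fine (diam [set: T]); have DE : diam [set: T] = D%:E by rewrite fineK.
have Dp : 0 < D by rewrite -lte_fin -DE (lt_le_trans _ D0xy) ?lte_fin.
have D1 : 0 < D + 1 by lra.
have /andP[K0 Kfin] := nub x0 (D + 1) D1.
have KE : nu (ball x0 (D + 1)) = (fine (nu (ball x0 (D + 1))))%:E.
  by rewrite fineK// ge0_fin_numE// ltW.
set K := fine _ in KE; have Kp : 0 < K by rewrite -lte_fin -KE.
have Ds : 0 < D `^ s by rewrite powR_gt0.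
exists (C + K / D `^ s) => [|x r r0]; first by rewrite addr_gt0 ?divr_gt0.
have [rD|rD] := ltP r%:E (diam [set: T]).
  have /andP[_ h] := HC x r r0 rD; apply: le_trans h _.
  by rewrite lee_fin ler_pM2r ?powR_gt0// lerDl divr_ge0 ?ltW.
apply: (@le_trans _ _ K%:E).
  rewrite -KE; apply: le_outer_measure => y _; rewrite ballEmdist /=.
  have := le_diamT x0 y; rewrite DE lee_fin; lra.
rewrite lee_fin mulrDl; apply: (@le_trans _ _ (K / D `^ s * r `^ s)).
  rewrite mulrAC ler_pdivlMr// ler_pM2l//.
  have Dr : D <= r by rewrite -lee_fin -DE.
  by apply: ge0_ler_powR; rewrite ?nnegrE//; exact: ltW.
by rewrite lerDr mulr_ge0 ?powR_ge0 ?ltW.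
Qed.

Lemma ball_fin_num (x : T) r : 0 < r -> nu (ball x r) \is a fin_num.
Proof. by move=> r0; have /andP[a b] := nuA.1.2 x r r0; rewrite ge0_fin_numE// ltW. Qed.

Lemma ball_gt0 (x : T) r : 0 < r -> (0 < nu (ball x r))%E.
Proof. by move=> r0; have /andP[] := nuA.1.2 x r r0. Qed.

(** The levels where lower regularity applies to quarter balls. These are disjoint around the points
    of a net; at the other levels the net is a single point. *)
Definition fine_level n := ((rr n / 4)%:E < diam [set: T])%E.

Lemma coarse_mdist n : ~ fine_level n -> forall x y : T, mdist x y <= rr n / 4.
Proof. exact: diamT_le. Qed.

Lemma fine_level_le m n : m <= n -> fine_level m -> fine_level n.
Proof.
move=> mn; apply: le_lt_trans; rewrite lee_fin ler_pM2r ?invr_gt0//.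
exact: ler_rr.
Qed.

Lemma exists_fine_level : exists n, fine_level n.
Proof.
have [x [y xy]] := T2; have dxy : 0 < mdist x y by rewrite mdist_gt0; apply/eqP.
have [n /andP[rn _]] := exists_level dxy.
exists n; apply: lt_le_trans (le_diamT x y); rewrite lte_fin.
by have := @rr_gt0 R n; lra.
Qed.

Lemma fine_ball_lower : exists2 c : R, 0 < c &
  forall n x, fine_level n -> ((c * rr n `^ s)%:E <= nu (ball x (rr n / 4)))%E.
Proof.
have [_ [C C0 HC]] := nuA.
exists (C^-1 * 4^-1 `^ s); first by rewrite mulr_gt0 ?invr_gt0 ?powR_gt0.
move=> n x fn; have r0 : 0 < rr n / 4 :> R by rewrite divr_gt0.
have /andP[+ _] := HC x _ r0 fn; apply: le_trans.
by rewrite lee_fin powRM// mulrAC mulrA.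
Qed.

Variable X : hyperbolic_filling T.

(** Volume packing: disjoint quarter balls, each of measure at least c rr^s, all lie in one ball of
    radius (|A| + 1) rr, whose measure is at most a constant times rr^s. *)
Lemma ahlfors_net_count : net_count X.
Proof.
have [C C0 HC] := ahlfors_upper; have [c c0 Hc] := fine_ball_lower.
move=> A; exists (maxn 1 (Num.bound (C * (`|A| + 1) `^ s / c))) => n D DX DA.
have [fn|cn] := pselect (fine_level n); last first.
  apply: (@at_mostW _ 1); first exact: leq_maxl.
  apply: at_most_subsingle => x y /DX nx /DX ny.
  apply: (net_sep nx ny); have := coarse_mdist cn x y.
  by have := @rr_gt0 R n; lra.
move=> [//|y t] us sD; set t' := y :: t in us sD *.
have rn := @rr_gt0 R n.
have A1 : 0 < `|A| + 1 by rewrite ltr_wpDl.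
have H : ((size t')%:R%:E * (c * rr n `^ s)%:E <= nu (ball y ((`|A| + 1) * rr n)))%E.
  apply: (packing nuA.1.1 (B := fun x => ball x (rr n / 4))) => //.
  - by rewrite lee_fin mulr_ge0 ?powR_ge0 ?ltW.
  - by move=> i _; exact: open_mball.
  - move=> i j it jt /eqP ij; apply/seteqP; split=> // z [].
    rewrite !ballEmdist/= => iz jz; apply: ij.
    apply: (net_sep (DX _ (sD _ it)) (DX _ (sD _ jt))).
    by have := metric_triangle i z j; rewrite (metric_sym z j); lra.
  - move=> i it z; rewrite !ballEmdist/= => iz.
    have := metric_triangle y i z.
    have := DA _ _ (sD y (mem_head _ _)) (sD _ it).
    have : A * rr n <= `|A| * rr n by rewrite ler_wpM2r// ler_norm.
    lra.
  - by move=> i _; exact: Hc.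
have {H} := le_trans H (HC _ _ (mulr_gt0 A1 rn)).
rewrite -EFinM lee_fin (powRM _ (ltW A1) (ltW rn)) !mulrA ler_pM2r ?powR_gt0//.
rewrite -ler_pdivlMr//.
move=> h; rewrite -(@ler_nat R); apply: le_trans h _.
apply: (@le_trans _ _ (Num.bound (C * (`|A| + 1) `^ s / c))%:R); last first.
  by rewrite ler_nat leq_maxr.
by apply/ltW/archi_boundP; rewrite divr_ge0 ?mulr_ge0 ?powR_ge0//; exact: ltW.
Qed.

End ahlfors.

Section countable_filling.
Context {R : realType} {T : pmetricType R} (X : hyperbolic_filling T).
Hypothesis cX : net_count X.

Lemma countable_net n : countable (net X n).
Proof.
pose B (k : nat) := net X n `&` ball point (k%:R * rr n).
have -> : net X n = \bigcup_k B k.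
  apply/seteqP; split=> [x nx|x [k _ []]//].
  exists (Num.bound (mdist point x / rr n)) => //; split=> //.
  rewrite ballEmdist /= -ltr_pdivrMr//.
  by apply: archi_boundP; rewrite divr_ge0 ?mdist_ge0.
apply: bigcup_countable => // k _; apply: finite_set_countable.
have [M HM] := cX (k%:R * 2).
apply: (@at_most_finite _ M); apply: (HM n) => [x []//|x y [_ Bx] [_]].
move: Bx; rewrite !ballEmdist/= => Bx By.
by have := metric_triangle x point y; rewrite (metric_sym x point); lra.
Qed.

Definition vertex : set (int * T) := [set v | net X v.1 v.2].

Lemma countable_vertex : countable vertex.
Proof.
have -> : vertex = \bigcup_(n in [set: int]) ((fun x => (n, x)) @` net X n).
  apply/seteqP; split=> [[n x] nx|_ [n _ [x nx <-]]//].
  by exists n => //; exists x.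
apply: bigcup_countable => // n _.
by apply: card_le_trans (card_image_le _ _) _; exact: countable_net.
Qed.

Lemma countable_edge : countable (edge X).
Proof.
apply: (@sub_countable _ _ _ (vertex `*` vertex)); last first.
  by apply: countableX; exact: countable_vertex.
apply: subset_card_le => e /edgeP[n1 n2 _ _ _].
by split.
Qed.

End countable_filling.

Section cells.
Context {R : realType} {T : pmetricType R} (nu : {outer_measure set T -> \bar R}).
Variable X : hyperbolic_filling T.
Hypothesis nur : borel_regular nu.
Hypothesis cX : net_count X.

Let netrank_ex n : exists f : T -> nat, {in net X n &, injective f}.
Proof. exact/countable_injP/countable_net. Qed.

Let netrank n := projT1 (cid (netrank_ex n)).

Let netrank_inj n : {in net X n &, injective (netrank n)} :=
  projT2 (cid (netrank_ex n)).

(** The candidates for owning [x]. The owner [nearest n x] is the candidate of least rank, not the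
    closest one, so that a cell is a ball minus a union of balls and hence measurable. *)
Let near_net n x := [set xi | net X n xi /\ mdist x xi < rr n / 2].

(* Cells partition the space at each level, so that sums over the vertices of
   a level become integrals without overlap. *)
Definition nearest n (x : T) : T := get [set xi | near_net n x xi /\
  forall eta, near_net n x eta -> (netrank n xi <= netrank n eta)%N].

Let nearestP n x : near_net n x (nearest n x) /\
  forall eta, near_net n x eta -> (netrank n (nearest n x) <= netrank n eta)%N.
Proof.
apply: (@getPex _ [set xi | near_net n x xi /\
  forall eta, near_net n x eta -> (netrank n xi <= netrank n eta)%N]).
have ex : exists k, `[< exists xi, near_net n x xi /\ netrank n xi = k >].
  by have [xi nxi xxi] := net_cover X n x; exists (netrank n xi); apply/asboolP; exists xi.
case: (ex_minnP ex) => k /asboolP[xi [nxi xik]] kmin; exists xi; split=> // eta neta.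
by rewrite xik; apply: kmin; apply/asboolP; exists eta.
Qed.

Lemma net_nearest n x : net X n (nearest n x).
Proof. by have [[]] := nearestP n x. Qed.

Lemma mdist_nearest n x : mdist x (nearest n x) < rr n / 2.
Proof. by have [[]] := nearestP n x. Qed.

Definition cell (v : int * T) := [set x | nearest v.1 x = v.2].

Lemma cell_vball v : cell v `<=` vball v.
Proof.
case: v => n xi x; rewrite /cell /vball/= ballEmdist /= metric_sym => <-.
apply: lt_le_trans (mdist_nearest _ _) _.
by rewrite -/(rr _) ler_pdivrMr// ler_peMr// ler1n.
Qed.

Lemma measurable_cell v : vertex X v -> measurable (cell v : set (caratheodory_type nu)).
Proof.
case: v => n xi /= nxi; rewrite /vertex /= in nxi.
pose A := [set eta | net X n eta /\ (netrank n eta < netrank n xi)%N].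
have -> : cell (n, xi) = ball xi (rr n / 2) `\` \bigcup_(eta in A) ball eta (rr n / 2).
  apply/seteqP; split=> x; rewrite /cell/=.
    move=> E; have [[nx dx] xmin] := nearestP n x; rewrite E in nx dx xmin.
    rewrite ballEmdist/= metric_sym dx; split=> // -[eta [neta eltx]].
    rewrite ballEmdist/= metric_sym => deta.
    by have := xmin eta (conj neta deta); rewrite leqNgt eltx.
  rewrite ballEmdist/= metric_sym => -[dxi nA].
  have [[nx dx] xmin] := nearestP n x.
  have le1 := xmin xi (conj nxi dxi).
  have le2 : (netrank n xi <= netrank n (nearest n x))%N.
    rewrite leqNgt; apply/negP => lt; apply: nA; exists (nearest n x) => //.
    by rewrite ballEmdist/= metric_sym.
  by apply: (@netrank_inj n); rewrite ?inE//; apply/eqP; rewrite eqn_leq le1.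
apply: measurableD; first exact: measurable_mball.
by apply: open_measurable_cara => //; apply: bigcup_open => eta _; exact: open_mball.
Qed.

(** An arbitrary [h] is allowed: the composite is constant on each of countably many measurable
    cells. *)
Lemma measurable_nearest_comp d (U : measurableType d) n (h : T -> U) :
  measurable_fun [set: caratheodory_type nu] (fun x => h (nearest n x)).
Proof.
move=> _ B mB; rewrite setTI.
have -> : (fun x => h (nearest n x)) @^-1` B =
    \bigcup_(xi in [set xi | net X n xi /\ B (h xi)]) cell (n, xi).
  apply/seteqP; split=> [x Bx|x [xi [_ Bxi] /= E]].
    by exists (nearest n x) => //; split=> //; exact: net_nearest.
  by rewrite /preimage/= E.
apply: countable_bigcup_measurable => [|xi [nxi _]]; last exact: measurable_cell.
apply: sub_countable (countable_net cX n).
by apply: subset_card_le => xi [].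
Qed.

Lemma nu_cell_disjoint n x y xi : cell (n, xi) x -> cell (n, y) x -> xi = y.
Proof. by rewrite /cell/= => -> ->. Qed.

End cells.

(** * Besov norms and edge energies *)

Lemma edge_near_eball {R : realType} {T : pmetricType R} (X : hyperbolic_filling T)
    (e : (int * T) * (int * T)) (x : T) :
  edge X e -> eball e x -> mdist e.1.2 x < 3 * rr e.1.1.
Proof.
case: e => [[n xi] [k eta]] ee.
have /= [_ _ kn _ d] := edgeP ee; have rn := @rr_gt0 R n.
rewrite /eball /vball /= => -[]; rewrite ballEmdist /= -/(rr _) => h; first lra.
have kr : rr k <= rr n :> R by apply: ler_rr; lia.
by have := metric_triangle xi eta x; lra.
Qed.

Lemma esum_indic {R : realType} {T : Type} (I : choiceType) (D : set I) (A : I -> set T)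
    (a : I -> R) x :
  \esum_(i in D) (a i * \1_(A i) x)%:E = \esum_(i in [set i | D i /\ A i x]) (a i)%:E.
Proof.
rewrite (esum_mkcondr D (fun i => A i x)); apply: eq_esum => i _.
rewrite indicE; case: (boolP (x \in A i)); rewrite ?inE ?notin_setE => h.
  by rewrite mulr1 mem_set.
by rewrite mulr0 memNset.
Qed.

Section edge_energy.
Context {R : realType} {T : pmetricType R}.
Variables (nu : {outer_measure set T -> \bar R}) (s : R).
Hypothesis s0 : 0 < s.
Hypothesis nuA : ahlfors_regular s nu.
Hypothesis T2 : exists x y : T, x <> y.
Variable X : hyperbolic_filling T.
Variable p : R.
Hypothesis p0 : 0 < p.
Implicit Types (e : (int * T) * (int * T)) (u : int * T -> R[i]).

(** In the comparison with the Besov norm a = s - sigma p: the measure of an edge ball, about rr^s,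
    times the weight rr^(- sigma p). *)
Definition energy a u : \bar R :=
  \esum_(e in edge X) (rr e.1.1 `^ a * normc (edge_diff u e) `^ p)%:E.

Let cX : net_count X. Proof. exact: ahlfors_net_count s0 nuA T2 X. Qed.

Let pn0 : p != 0. Proof. by rewrite gt_eqF. Qed.

Lemma edge_eball_count : exists M : nat, forall n x,
  at_most M [set e | (edge X e /\ elevel e = n) /\ eball e x].
Proof.
(* Both coarser ends lie within 3 radii of [x], hence 6. *)
have [M HM] := edge_count cX 6%:R; exists M => n x; apply: (HM n).
- by move=> e [[]].
- by move=> e [[ee <-] _]; have [_ _ _ -> _] := edgeP ee.
- move=> e e' [[ee le] /(edge_near_eball ee) h] [[ee' le'] /(edge_near_eball ee') h'].
  have [_ _ _ E _] := edgeP ee; have [_ _ _ E' _] := edgeP ee'.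
  rewrite -E le in h; rewrite -E' le' in h'.
  by have := metric_triangle e.1.2 x e'.1.2; rewrite (metric_sym x); lra.
Qed.

(** At a coarse level both vertex balls are the whole space, so both averages are the same
    integral. *)
Lemma coarse_edge_diff f e : edge X e -> ~ fine_level (T := T) e.1.1 ->
  edge_diff (vaverage nu f) e = 0.
Proof.
case: e => [[n xi] [k eta]] ee /= cn; have /= [_ _ kn _ _] := edgeP ee.
have far := coarse_mdist cn; have rn := @rr_gt0 R n.
have BT (j : int) (y : T) : j = n \/ j = n + 1 -> vball (j, y) = setT.
  move=> jn; apply/seteqP; split=> // z _; rewrite /vball ballEmdist /= -/(rr j).
  have jr : rr (n + 1) <= rr j :> R by apply: ler_rr; lia.
  by have := far y z; rewrite rrS in jr; lra.
by rewrite /edge_diff /vaverage !BT ?subrr//; left.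
Qed.

Lemma measurable_eball e : measurable (eball e : set (caratheodory_type nu)).
Proof. by apply: measurableU; apply: measurable_mball; exact: nuA.1.1. Qed.

Section level.
Variable f : T -> R[i].
Variable k : int.
Let d e := normc (edge_diff (vaverage nu f) e).
Let Ek := [set e | edge X e /\ elevel e = k].
Let I := (\int[measure_of nu]_x (besov_level nu X f k x `^ p))%E.
Let S := \esum_(e in Ek) ((d e `^ p)%:E * nu (eball e))%E.

Let cEk : countable Ek.
Proof.
apply: sub_countable (countable_edge cX).
by apply: subset_card_le => e [].
Qed.

Let intE : (\int[measure_of nu]_x (\esum_(e in Ek) (d e `^ p * \1_(eball e) x)%:E) = S)%E.
Proof.
rewrite integral_esum//.
- apply: eq_esum => e _; under eq_integral do rewrite EFinM.
  rewrite ge0_integralZl_EFin ?powR_ge0// ?integral_indic ?setIT//.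
  + exact: measurable_eball.
  + by apply/measurable_EFinP; apply: measurable_indic; exact: measurable_eball.
- by move=> e x; rewrite lee_fin mulr_ge0 ?powR_ge0.
- move=> e _; apply/measurable_EFinP; apply: measurable_funM => //.
  by apply: measurable_indic; exact: measurable_eball.
Qed.

Lemma measurable_besov_level :
  measurable_fun [set: caratheodory_type nu] (besov_level nu X f k).
Proof.
apply: emeasurable_esum => //.
- by move=> e x; rewrite lee_fin mulr_ge0 ?normc_ge0.
- move=> e _; apply/measurable_EFinP; apply: measurable_funM => //.
  by apply: measurable_indic; exact: measurable_eball.
Qed.

Lemma besov_level_ge0 x : (0 <= besov_level nu X f k x)%E.
Proof. by apply: esum_ge0 => e _; rewrite lee_fin mulr_ge0 ?normc_ge0. Qed.

Let mpow : measurable_fun [set: caratheodory_type nu]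
  (fun x => (besov_level nu X f k x `^ p)%E).
Proof.
by apply: (measurableT_comp (measurable_poweR _)) => //; exact: measurable_besov_level.
Qed.

Let mS : measurable_fun [set: caratheodory_type nu]
  (fun x => \esum_(e in Ek) (d e `^ p * \1_(eball e) x)%:E).
Proof.
apply: emeasurable_esum => //.
- by move=> e x; rewrite lee_fin mulr_ge0 ?powR_ge0.
- move=> e _; apply/measurable_EFinP; apply: measurable_funM => //.
  by apply: measurable_indic; exact: measurable_eball.
Qed.

(** At most [M] edge balls of one level overlap at a point, so the p-th power of the sum and the sum
    of p-th powers are comparable pointwise; the same holds for the converse bound below. *)
Lemma level_upper (M : nat) :
  (forall x, at_most M [set e | (edge X e /\ elevel e = k) /\ eball e x]) ->
  (I <= (M%:R `^ p)%:E * S)%E.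
Proof.
move=> HM; rewrite -intE -ge0_integralZl_EFin ?powR_ge0//; last first.
  by move=> x _; apply: esum_ge0 => e _; rewrite lee_fin mulr_ge0 ?powR_ge0.
apply: ge0_le_integral => //.
- by move=> x _; exact: poweR_ge0.
- by apply: measurable_funeM.
- move=> x _; rewrite /besov_level esum_indic.
  rewrite esum_indic.
  apply: le_trans (esum_poweR_card p0 (HM x) _) _.
    by move=> e; rewrite lee_fin normc_ge0.
  by under eq_esum do rewrite poweR_EFin.
Qed.

Lemma level_lower (M : nat) :
  (forall x, at_most M [set e | (edge X e /\ elevel e = k) /\ eball e x]) ->
  (S <= M%:R%:E * I)%E.
Proof.
move=> HM; rewrite -intE -ge0_integralZl_EFin//; last first.
  by move=> x _; exact: poweR_ge0.
apply: ge0_le_integral => //.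
- by move=> x _; apply: esum_ge0 => e _; rewrite lee_fin mulr_ge0 ?powR_ge0.
- by apply: measurable_funeM.
- move=> x _; rewrite esum_indic.
  apply: at_most_esum; [exact: HM|exact: poweR_ge0|].
  move=> e he; rewrite -poweR_EFin; apply: le_poweR2; rewrite ?lee_fin ?normc_ge0//.
    exact: ltW.
  rewrite /besov_level esum_indic.
  by apply: (esum_term (a := fun e => (d e)%:E)) => //; rewrite lee_fin normc_ge0.
Qed.

End level.

Lemma poweR_besov_norm sigma f :
  (besov_norm nu X sigma p p f `^ p = \esum_(k in [set: int])
    ((rr k `^ (- (sigma * p)))%:E *
      \int[measure_of nu]_x (besov_level nu X f k x `^ p)))%E.
Proof.
rewrite /besov_norm poweRVK//; last first.
  by apply: esum_ge0 => k _; rewrite mule_ge0 ?lee_fin ?powR_ge0 ?poweR_ge0.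
apply: eq_esum => k _; rewrite -mulrA powR_rr powR_Lnorm//.
by congr (_ * _)%E; apply: eq_integral => x _; rewrite gee0_abs ?besov_level_ge0.
Qed.

Let energy_fibre a u : energy a u = \esum_(k in [set: int])
  ((rr k `^ a)%:E * \esum_(e in [set e | edge X e /\ elevel e = k])
     (normc (edge_diff u e) `^ p)%:E)%E.
Proof.
rewrite /energy (esum_fibre (fun e => elevel e)); last first.
  by move=> e _; rewrite lee_fin mulr_ge0 ?powR_ge0.
apply: eq_esum => k _; rewrite -esumZl ?powR_ge0//; last first.
  by move=> e; rewrite lee_fin powR_ge0.
by apply: eq_esum => e [ee <-]; have [_ _ _ -> _] := edgeP ee; rewrite EFinM.
Qed.

Lemma besov_le_energy sigma : exists2 C : R, 0 <= C & forall f,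
  (besov_norm nu X sigma p p f `^ p <=
   C%:E * energy (s - sigma * p) (vaverage nu f))%E.
Proof.
have [C C0 HC] := ahlfors_upper s0 nuA T2.
have [M HM] := edge_eball_count.
(* [M] bounds the overlap; an edge ball fits in a ball of 4 radii, which accounts for the factor
   4^s. *)
exists (M%:R `^ p * (C * 4 `^ s)).
  by rewrite !mulr_ge0 ?powR_ge0// ltW.
move=> f; rewrite poweR_besov_norm energy_fibre.
rewrite -esumZl ?mulr_ge0 ?powR_ge0 ?(ltW C0)//; last first.
  move=> k; rewrite mule_ge0 ?lee_fin ?powR_ge0// esum_ge0// => e _.
  by rewrite lee_fin powR_ge0.
apply: le_esum => k _.
apply: (@le_trans _ _ ((rr k `^ (- (sigma * p)))%:E * ((M%:R `^ p)%:E *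
  \esum_(e in [set e | edge X e /\ elevel e = k])
   ((normc (edge_diff (vaverage nu f) e) `^ p)%:E * nu (eball e))))%E).
  by rewrite lee_wpmul2l ?lee_fin ?powR_ge0//; apply: level_upper.
set S := \esum_(e in _) _.
have SS : (S <= (C * 4 `^ s * rr k `^ s)%:E *
    \esum_(e in [set e | edge X e /\ elevel e = k])
     (normc (edge_diff (vaverage nu f) e) `^ p)%:E)%E.
  rewrite -esumZl ?mulr_ge0 ?powR_ge0 ?(ltW C0)//; last first.
    by move=> e; rewrite lee_fin powR_ge0.
  apply: le_esum => e [ee le]; rewrite muleC lee_wpmul2r ?lee_fin ?powR_ge0//.
  have [_ _ _ E _] := edgeP ee; have rk := @rr_gt0 R k.
  have r4 : 0 < 4 * rr k :> R by rewrite mulr_gt0.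
  rewrite -mulrA -(powRM _ (ler0n _ 4) (ltW rk)).
  apply: le_trans (HC e.1.2 _ r4).
  apply: le_outer_measure => x /(edge_near_eball ee); rewrite ballEmdist /=.
  by rewrite -E le => h; lra.
rewrite powRD ?(gt_eqF (rr_gt0 _)) ?implybT// muleA -EFinM muleA -EFinM.
apply: (@le_trans _ _ ((rr k `^ (- (sigma * p)) * M%:R `^ p)%:E * _)%E).
  by apply: lee_wpmul2l SS; rewrite lee_fin mulr_ge0 ?powR_ge0.
rewrite muleA -EFinM le_eqVlt; apply/orP; left; apply/eqP.
congr (_%:E * _)%E; ring.
Qed.

(** Dividing by the measure of an edge ball is possible at fine levels; at coarse levels the terms
    vanish because [u] consists of averages. *)
Lemma energy_le_besov sigma : exists2 C : R, 0 <= C & forall f,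
  (energy (s - sigma * p) (vaverage nu f) <=
   C%:E * besov_norm nu X sigma p p f `^ p)%E.
Proof.
have [c c0 Hc] := fine_ball_lower nuA.
have [M HM] := edge_eball_count.
exists (c^-1 * M%:R); first by rewrite mulr_ge0 ?invr_ge0// ltW.
move=> f; rewrite poweR_besov_norm energy_fibre.
rewrite -esumZl ?mulr_ge0 ?invr_ge0 ?(ltW c0)//; last first.
  move=> k; rewrite mule_ge0 ?lee_fin ?powR_ge0// integral_ge0// => e _.
  exact: poweR_ge0.
apply: le_esum => k _.
set S := \esum_(e in _) _.
set I := (\int[_]_ _ _)%E.
pose S' := \esum_(e in [set e | edge X e /\ elevel e = k])
   ((normc (edge_diff (vaverage nu f) e) `^ p)%:E * nu (eball e))%E.
have S'I : (S' <= M%:R%:E * I)%E by apply: level_lower.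
have SS : ((c * rr k `^ s)%:E * S <= S')%E.
  rewrite -esumZl ?mulr_ge0 ?powR_ge0 ?(ltW c0)//; last first.
    by move=> e; rewrite lee_fin powR_ge0.
  apply: le_esum => e [ee le]; rewrite muleC.
  have [_ _ _ E _] := edgeP ee; have rk := @rr_gt0 R k.
  have [fk|ck] := pselect (fine_level (T := T) e.1.1); last first.
    by rewrite coarse_edge_diff// normc0 powR0// !mul0e.
  rewrite lee_wpmul2l ?lee_fin ?powR_ge0//.
  rewrite -E le in fk; apply: le_trans (Hc k e.1.2 fk) _.
  apply: le_outer_measure => x; rewrite ballEmdist /= => h; left.
  by rewrite /vball ballEmdist /= -/(rr _) -E le; lra.
have -> : ((rr k `^ (s - sigma * p))%:E * S = (rr k `^ (- (sigma * p)) * c^-1)%:E *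
    ((c * rr k `^ s)%:E * S))%E.
  rewrite muleA -EFinM powRD ?(gt_eqF (rr_gt0 _)) ?implybT//.
  by congr (_%:E * _)%E; field; rewrite gt_eqF.
have -> : ((c^-1 * M%:R)%:E * ((rr k `^ (- (sigma * p)))%:E * I) =
    (rr k `^ (- (sigma * p)) * c^-1)%:E * (M%:R%:E * I))%E.
  by rewrite !muleA -!EFinM; congr (_%:E * _)%E; ring.
rewrite lee_wpmul2l ?lee_fin ?mulr_ge0 ?powR_ge0 ?invr_ge0 ?(ltW c0)//.
exact: le_trans S'I.
Qed.

End edge_energy.

(** * Extension by a Whitney partition *)

Section measurability_lemmas.
Context {R : realType} {T : pmetricType R} (mu : {outer_measure set T -> \bar R}).
Hypothesis mur : borel_regular mu.

Lemma lsc_measurable (f : T -> \bar R) : (forall t : R, open [set x | (t%:E < f x)%E]) ->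
  measurable_fun [set: caratheodory_type mu] f.
Proof.
move=> fo; move=> _ B mB.
apply: (measurability _ (ErealGenOInfty.measurableE R)) => // _ [_ [t ->] <-].
rewrite setTI (_ : _ @^-1` _ = [set x | (t%:E < f x)%E]).
  exact: open_measurable_cara.
by apply/seteqP; split => x; rewrite /= in_itv/= andbT.
Qed.

Lemma lipschitz_measurable (f : T -> R) (K : R) : 0 <= K ->
  (forall x y, f x <= f y + K * mdist x y) ->
  measurable_fun [set: caratheodory_type mu] f.
Proof.
move=> K0 fK; apply/measurable_EFinP; apply: lsc_measurable => t.
rewrite openE => x /=; rewrite lte_fin => tx.
have K1 : 0 < K + 1 by lra.
rewrite /interior -nbhs_ballE; exists ((f x - t) / (K + 1)) => /=.
  by rewrite divr_gt0 ?subr_gt0.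
move=> y; rewrite ballEmdist/= lte_fin ltr_pdivlMr// => xy.
have := fK x y; have := mdist_ge0 x y; nra.
Qed.

End measurability_lemmas.

Section extension.
Context {R : realType} {Z T : pmetricType R} (i : T -> Z).
Hypothesis iso : forall x y, mdist (i x) (i y) = mdist x y.
Hypothesis clF : closed (range i).
Variable X : hyperbolic_filling T.
Hypothesis cX : net_count X.
Implicit Types (y z : Z) (v w : int * T) (c : int * T -> R).

Let dset y := [set mdist y (i x) | x in [set: T]].

Definition dist_to y : R := inf (dset y).

Let dset_inf y : has_inf (dset y).
Proof.
split; first by exists (mdist y (i point)); exists point.
by exists 0 => _ [x _ <-]; exact: mdist_ge0.
Qed.

Lemma dist_to_le y x : dist_to y <= mdist y (i x).
Proof. by apply: ge_inf; [exact: (dset_inf y).2|exists x]. Qed.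

Lemma dist_to_ge y r : (forall x, r <= mdist y (i x)) -> r <= dist_to y.
Proof.
move=> H; apply: lb_le_inf; first exact: (dset_inf y).1.
by move=> _ [x _ <-].
Qed.

Lemma dist_to_lip y z : dist_to y <= dist_to z + mdist y z.
Proof.
rewrite -lerBlDr; apply: dist_to_ge => x; rewrite lerBlDr.
by apply: le_trans (dist_to_le y x) _; rewrite addrC metric_triangle.
Qed.

Lemma dist_to_near y e : 0 < e -> exists x, mdist y (i x) < dist_to y + e.
Proof.
move=> e0; have [_ [x _ <-] ?] := inf_adherent e0 (dset_inf y).
by exists x.
Qed.

Lemma dist_to_gt0 y : ~ range i y -> 0 < dist_to y.
Proof.
move=> yF; have : (~` range i) y by [].
have := closed_openC clF; rewrite openE => /(_ y) /[apply].
rewrite /interior -nbhs_ballE => -[r /= r0 yr].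
apply: lt_le_trans r0 _; apply: dist_to_ge => x; rewrite leNgt; apply/negP => h.
by apply: (yr (i x)); [rewrite ballEmdist|exists x].
Qed.

Lemma dist_to_eq0 x : dist_to (i x) = 0.
Proof.
apply/eqP; rewrite eq_le dist_to_ge ?andbT; last by move=> ?; exact: mdist_ge0.
by have := dist_to_le (i x) x; rewrite mdistxx.
Qed.

(** A piecewise linear bump, Lipschitz with constant 1 / rr. It is positive when the distance from
    [y] to the range lies between 1/2 and 5/2 radii and [y] is within 5 radii of the vertex. The
    window exceeds the dyadic range [1, 2] by 1/2 on both sides, which makes some bump at least
    1/2. *)
Definition whitney v y : R := Num.max 0 (Num.min
  (Num.min (dist_to y / rr v.1 - 1 / 2) (5 / 2 - dist_to y / rr v.1))
  (5 - mdist y (i v.2) / rr v.1)).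

Lemma whitney_ge0 v y : 0 <= whitney v y. Proof. by rewrite /whitney le_max lexx. Qed.

Lemma whitney_le5 v y : whitney v y <= 5.
Proof.
rewrite /whitney ge_max ler0n/= ge_min; apply/orP; right.
by rewrite gerBl divr_ge0 ?mdist_ge0.
Qed.

Lemma whitney_lip v y z : whitney v y <= whitney v z + (rr v.1)^-1 * mdist y z.
Proof.
have r0 := @rr_gt0 R v.1; set t := _ * mdist y z.
have t0 : 0 <= t by rewrite mulr_ge0 ?invr_ge0 ?mdist_ge0.
have d1 : dist_to y / rr v.1 <= dist_to z / rr v.1 + t.
  by rewrite /t [_^-1 * mdist _ _]mulrC -mulrDl ler_pM2r ?invr_gt0// dist_to_lip.
have d2 : dist_to z / rr v.1 <= dist_to y / rr v.1 + t.
  by rewrite /t metric_sym [_^-1 * mdist _ _]mulrC -mulrDl ler_pM2r ?invr_gt0// dist_to_lip.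
have d3 : mdist z (i v.2) / rr v.1 <= mdist y (i v.2) / rr v.1 + t.
  rewrite /t [_^-1 * mdist _ _]mulrC -mulrDl ler_pM2r ?invr_gt0//.
  by have := metric_triangle z y (i v.2); rewrite (metric_sym z y); lra.
rewrite /whitney.
set m1 := Num.min (Num.min _ _) _; set m2 := Num.min (Num.min _ _) _.
have m12 : m1 <= m2 + t.
  rewrite -lerBlDr /m1 /m2 !le_min !lerBlDr.
  have h1 : Num.min (Num.min (dist_to y / rr v.1 - 1 / 2) (5 / 2 - dist_to y / rr v.1))
     (5 - mdist y (i v.2) / rr v.1) <= dist_to y / rr v.1 - 1 / 2.
    by rewrite !ge_min lexx.
  have h2 : Num.min (Num.min (dist_to y / rr v.1 - 1 / 2) (5 / 2 - dist_to y / rr v.1))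
     (5 - mdist y (i v.2) / rr v.1) <= 5 / 2 - dist_to y / rr v.1.
    by rewrite !ge_min lexx orbT.
  have h3 : Num.min (Num.min (dist_to y / rr v.1 - 1 / 2) (5 / 2 - dist_to y / rr v.1))
     (5 - mdist y (i v.2) / rr v.1) <= 5 - mdist y (i v.2) / rr v.1.
    by rewrite !ge_min lexx orbT.
  by apply/andP; split; [apply/andP; split|]; lra.
rewrite ge_max addr_ge0 ?le_max ?lexx//=.
by apply: le_trans m12 _; rewrite lerD2r le_max lexx orbT.
Qed.

Lemma whitney_lip_abs v y z : `|whitney v y - whitney v z| <= (rr v.1)^-1 * mdist y z.
Proof.
have := whitney_lip v y z; have := whitney_lip v z y.
by rewrite (metric_sym z y) ler_norml => h1 h2; apply/andP; split; lra.
Qed.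

Definition active v y := vertex X v /\ 0 < whitney v y.

Lemma activeP v y : active v y -> [/\ rr v.1 < 2 * dist_to y,
  2 * dist_to y < 5 * rr v.1 & mdist y (i v.2) < 5 * rr v.1].
Proof.
have r0 := @rr_gt0 R v.1.
move=> [_]; rewrite /whitney lt_max ltxx/= !lt_min => /andP[/andP[h1 h2] h3].
have e1 : dist_to y = dist_to y / rr v.1 * rr v.1 by rewrite mulfVK// gt_eqF.
have e2 : mdist y (i v.2) = mdist y (i v.2) / rr v.1 * rr v.1 by rewrite mulfVK// gt_eqF.
split; [rewrite e1|rewrite e1|rewrite e2]; nra.
Qed.

(** Take the level whose radius is comparable to the distance, an almost nearest point of the range,
    and a net point near it; the latter is within 2 + 1 + 1/2 radii of [y]. *)
Lemma exists_bump y : ~ range i y -> exists2 v, vertex X v & 2^-1 <= whitney v y.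
Proof.
move=> /dist_to_gt0 d0; have [n /andP[n1 n2]] := exists_level d0.
have r0 := @rr_gt0 R n.
have [x xy] := dist_to_near y r0.
have [xi nxi xxi] := net_cover X n x.
exists (n, xi) => //=; rewrite /whitney le_max; apply/orP; right => /=.
have tri := metric_triangle y (i x) (i xi); rewrite iso in tri.
rewrite !le_min; apply/andP; split; [apply/andP; split|].
- have : 1 <= dist_to y / rr n by rewrite ler_pdivlMr// mul1r.
  lra.
- have : dist_to y / rr n < 2 by rewrite ltr_pdivrMr.
  lra.
- have : mdist y (i xi) / rr n < 4 by rewrite ltr_pdivrMr//; lra.
  lra.
Qed.

Lemma whitney_range v x : whitney v (i x) = 0.
Proof.
apply/eqP; rewrite eq_le whitney_ge0 andbT /whitney ge_max lexx/= !ge_min.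
by rewrite dist_to_eq0 mul0r; apply/orP; left; apply/orP; left; lra.
Qed.

Lemma active_count : exists M : nat, forall y, at_most M [set v | active v y].
Proof.
(* Active vertices occur at three consecutive levels only, and those of one level lie within 5 + 5
   radii of each other. *)
have [M HM] := cX 10%:R; exists (3 * M)%N => y.
have [[x _ <-]|yF] := pselect (range i y).
  apply: (@at_most_sub _ _ _ set0) => [v [_]|s _ H]; first by rewrite whitney_range ltxx.
  by case: s H => // v s /(_ v); rewrite mem_head => /(_ isT).
have d0 := dist_to_gt0 yF; have [n0 /andP[n1 n2]] := exists_level d0.
apply: (at_most_bind (f := fst) (A := [set n | n \in [:: n0 - 1; n0; n0 + 1]])).
- move=> [n xi] av /=; have /= [a1 a2 _] := activeP av.
  have h1 : n0 - 1 <= n.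
    rewrite leNgt; apply/negP => h.
    have : rr (n0 - 1 - 1) <= rr n :> R by apply: ler_rr; lia.
    have := @rrS R (n0 - 1); have := @rrS R (n0 - 1 - 1); rewrite !subrK; lra.
  have h2 : n <= n0 + 1.
    rewrite leNgt; apply/negP => h.
    have : rr n <= rr (n0 + 1 + 1) :> R by apply: ler_rr; lia.
    rewrite !rrS; lra.
  rewrite !inE; have : n = n0 - 1 \/ (n = n0 \/ n = n0 + 1) by lia.
  by case=> [->|[->|->]]; rewrite eqxx ?orbT.
- by move=> s us sA; apply: (@uniq_leq_size _ s [:: n0 - 1; n0; n0 + 1]).
- move=> n _; rewrite -[M]muln1.
  pose A := [set xi | net X n xi /\ mdist y (i xi) < 5 * rr n].
  apply: (at_most_bind (f := snd) (A := A)).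
  + move=> [k xi] [av /= kn]; have /= [_ _ h] := activeP av.
    by rewrite /A/= -kn; split=> //; exact: av.1.
  + apply: (HM n) => [x []//|x x' [_ h] [_ h']].
    by rewrite -iso; have := metric_triangle (i x) y (i x'); rewrite (metric_sym (i x) y); lra.
  + move=> x _; apply: at_most_subsingle => -[k1 x1] [k2 x2].
    by move=> [[/= _ ->] ->] [[/= _ ->] ->].
Qed.

Let rank_ex : exists f : int * T -> nat, {in vertex X &, injective f}.
Proof. exact/countable_injP/countable_vertex. Qed.

Let rank := projT1 (cid rank_ex).
Let rank_inj : {in vertex X &, injective rank} := projT2 (cid rank_ex).

Let is_rank k := `[< exists2 v, vertex X v & rank v = k >].
Let ver k : int * T := xget (0, point) [set v | vertex X v /\ rank v = k].

Let verP k : is_rank k -> vertex X (ver k) /\ rank (ver k) = k.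
Proof.
move=> /asboolP[v Vv rv].
by apply: (@xgetPex _ (0, point) [set v | vertex X v /\ rank v = k]); exists v.
Qed.

Let verK v : vertex X v -> ver (rank v) = v.
Proof.
move=> Vv; have [|h1 h2] := @verP (rank v); first by apply/asboolP; exists v.
by apply: rank_inj; rewrite ?inE.
Qed.

Let wk k y : R := if is_rank k then whitney (ver k) y else 0.

Let wk_ge0 k y : 0 <= wk k y.
Proof. by rewrite /wk; case: ifP => // _; exact: whitney_ge0. Qed.

Let wk_active k y : wk k y != 0 -> is_rank k /\ active (ver k) y.
Proof.
rewrite /wk; case: ifP => [rk h|]; last by rewrite eqxx.
by split=> //; split; [exact: (verP rk).1|rewrite lt_neqAle eq_sym h whitney_ge0].
Qed.

Let cutoff_ex y : exists N : nat, forall k, (N <= k)%N -> wk k y = 0.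
Proof.
have [M HM] := active_count; have fA := at_most_finite (HM y).
exists (\max_(v <- fset_set [set v | active v y]) rank v).+1 => k Nk.
apply/eqP; apply: contraT => /wk_active[rk av].
have : (rank (ver k) < (\max_(v <- fset_set [set v | active v y]) rank v).+1)%N.
  by rewrite ltnS; apply: leq_bigmax_seq => //; rewrite in_fset_set// inE.
by rewrite (verP rk).2 ltnNge Nk.
Qed.

Let cutoff y := projT1 (cid (cutoff_ex y)).
Let cutoffP y k : (cutoff y <= k)%N -> wk k y = 0.
Proof. exact: (projT2 (cid (cutoff_ex y))). Qed.

Let num c N y := \sum_(0 <= k < N) wk k y * c (ver k).
Let den N y := \sum_(0 <= k < N) wk k y.

(** On the range of [i] all bumps vanish and the quotient takes the default value 0; that set will
    be null. *)
Definition extend c y : R := num c (cutoff y) y / den (cutoff y) y.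

Let num_stable c N y : (cutoff y <= N)%N -> num c N y = num c (cutoff y) y.
Proof.
move=> yN; rewrite /num (big_cat_nat _ yN)//= [X in _ + X]big1_seq ?addr0//.
by move=> k /andP[_]; rewrite mem_index_iota => /andP[h _]; rewrite cutoffP ?mul0r.
Qed.

Let den_stable N y : (cutoff y <= N)%N -> den N y = den (cutoff y) y.
Proof.
move=> yN; rewrite /den (big_cat_nat _ yN)//= [X in _ + X]big1_seq ?addr0//.
by move=> k /andP[_]; rewrite mem_index_iota => /andP[h _]; rewrite cutoffP.
Qed.

Let den_ge y : ~ range i y -> 2^-1 <= den (cutoff y) y.
Proof.
move=> /exists_bump[v Vv hv]; pose N := maxn (cutoff y) (rank v).+1.
rewrite -(@den_stable N) ?leq_maxl//.
have rN : (rank v < N)%N by rewrite leq_maxr.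
rewrite /den big_mkord (bigD1 (Ordinal rN))//=.
rewrite /wk ifT; last by apply/asboolP; exists v.
by rewrite verK// (le_trans hv)// lerDl sumr_ge0// => k _; exact: wk_ge0.
Qed.

Let sum_active (a : nat -> R) (B : R) (P : set (int * T)) (M N : nat) : 0 <= B ->
  at_most M P -> (forall k, a k <= B) ->
  (forall k, a k != 0 -> is_rank k /\ P (ver k)) ->
  \sum_(0 <= k < N) a k <= M%:R * B.
Proof.
move=> B0 PM aB aP.
apply: (@le_trans _ _ (\sum_(0 <= k < N | a k != 0) B)).
  rewrite [leRHS]big_mkcond; apply: ler_sum => k _.
  by case: eqVneq => [->|].
rewrite big_const_seq iter_addr_0 -[B *+ _]mulr_natl ler_wpM2r// ler_nat.
rewrite -size_filter -(size_map ver); apply: PM.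
  rewrite map_inj_in_uniq ?filter_uniq ?iota_uniq// => j k.
  rewrite !mem_filter => /andP[/aP[rj _] _] /andP[/aP[rk _] _] jk.
  by rewrite -(verP rj).2 -(verP rk).2 jk.
by move=> v /mapP[k]; rewrite mem_filter => /andP[/aP[_ Pk] _] ->.
Qed.

Lemma extendD (a b : R) c c' y :
  extend (fun v => a * c v + b * c' v) y = a * extend c y + b * extend c' y.
Proof.
rewrite /extend !mulrA -mulrDl; congr (_ / _).
rewrite /num !mulr_sumr -big_split; apply: eq_bigr => k _ /=; ring.
Qed.

Lemma extend_cst (a : R) y : ~ range i y -> extend (fun=> a) y = a.
Proof.
move=> yF; have dy := den_ge yF.
rewrite /extend /num -mulr_suml mulrAC -/(den _ _) mulfV ?mul1r// gt_eqF//; lra.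
Qed.

(** Off the range, [extend c y] is a convex combination of the values of [c] at the active
    vertices. *)
Lemma extend_dev c (a B : R) y : ~ range i y ->
  (forall v, active v y -> `|c v - a| <= B) -> `|extend c y - a| <= B.
Proof.
move=> yF cB; have dy := den_ge yF.
have d0 : 0 < den (cutoff y) y by lra.
have -> : extend c y - a = (\sum_(0 <= k < cutoff y) wk k y * (c (ver k) - a)) / den (cutoff y) y.
  rewrite /extend -{1}(@mulfK _ (den (cutoff y) y) _ a) ?gt_eqF// -mulrBl; congr (_ / _).
  rewrite /num /den mulr_sumr -sumrB; apply: eq_bigr => k _; ring.
rewrite normrM normfV (gtr0_norm d0) ler_pdivrMr//.
apply: le_trans (ler_norm_sum _ _ _) _.
rewrite /den mulr_sumr; apply: ler_sum => k _.
rewrite normrM (ger0_norm (wk_ge0 _ _)) mulrC.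
have [->|/wk_active[_ ak]] := eqVneq (wk k y) 0; first by rewrite !mulr0.
by rewrite ler_wpM2r ?wk_ge0// cB.
Qed.

Definition active_bound : nat := projT1 (cid active_count).
Let active_boundP y : at_most active_bound [set v | active v y].
Proof. exact: (projT2 (cid active_count)). Qed.

(* Subtracting the constant [extend c z] makes the weights at [z] cancel, which
   leaves differences of weights times oscillations of [c]. *)
Lemma extend_lip c (tau Om : R) y z : 0 <= tau -> 0 <= Om ->
  ~ range i y -> ~ range i z ->
  (forall v, active v y \/ active v z -> `|whitney v y - whitney v z| <= tau) ->
  (forall v w, active v y \/ active v z -> active w z -> `|c v - c w| <= Om) ->
  `|extend c y - extend c z| <= 2 * ((2 * active_bound)%:R * (tau * Om)).
Proof.
move=> t0 O0 yF zF btau cOm; have dy := den_ge yF; have dz := den_ge zF.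
set a := extend c z; pose N := maxn (cutoff y) (cutoff z).
have yN : (cutoff y <= N)%N by rewrite leq_maxl.
have zN : (cutoff z <= N)%N by rewrite leq_maxr.
have d0 : 0 < den N y by rewrite den_stable//; lra.
have E : extend c y - a =
    (\sum_(0 <= k < N) (wk k y - wk k z) * (c (ver k) - a)) / den N y.
  have z0 : \sum_(0 <= k < N) wk k z * (c (ver k) - a) = 0.
    under eq_bigr do rewrite mulrBr.
    rewrite sumrB -mulr_suml -/(num c N z) -/(den N z) num_stable// den_stable//.
    by rewrite /a /extend mulrC mulfVK ?subrr// gt_eqF//; lra.
  under eq_bigr do rewrite mulrBl.
  rewrite sumrB z0 subr0.
  rewrite /extend -(num_stable c yN) -(den_stable yN).
  rewrite -{1}(@mulfK _ (den N y) _ a) ?gt_eqF// -mulrBl; congr (_ / _).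
  rewrite /num /den mulr_sumr -sumrB; apply: eq_bigr => k _; ring.
rewrite E normrM normfV (gtr0_norm d0) ler_pdivrMr//.
apply: le_trans (ler_norm_sum _ _ _) _.
(* The outer factor 2 bounds the inverse of [den]; the count is doubled because a vertex may be
   active at [y] or at [z]. *)
apply: (@le_trans _ _ ((2 * active_bound)%:R * (tau * Om))); last first.
  have : 0 <= (2 * active_bound)%:R * (tau * Om) by rewrite !mulr_ge0.
  have : 2^-1 <= den N y by rewrite den_stable.
  nra.
apply: (sum_active (P := [set v | active v y] `|` [set v | active v z])).
- by rewrite mulr_ge0.
- by rewrite mul2n -addnn; apply: at_mostU; exact: active_boundP.
- move=> k; rewrite normrM.
  have [[-> ->]|nz] : (wk k y = 0 /\ wk k z = 0) \/ (wk k y != 0 \/ wk k z != 0).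
  + have [|] := eqVneq (wk k y) 0; last by right; left.
    have [|] := eqVneq (wk k z) 0; last by right; right.
    by left.
  + by rewrite subrr normr0 mul0r mulr_ge0.
  + have [rk ak] : is_rank k /\ (active (ver k) y \/ active (ver k) z).
      by case: nz => /wk_active[rk ak]; split=> //; [left|right].
    apply: ler_pM => //.
      by rewrite /wk rk; exact: btau.
    rewrite distrC; apply: extend_dev => // w aw.
    by rewrite distrC; exact: cOm.
- move=> k; rewrite normr_eq0 mulf_eq0 negb_or => /andP[h _].
  have [yk|/wk_active[rk ak]] := eqVneq (wk k y) 0; last by split=> //; left.
  rewrite yk sub0r oppr_eq0 in h.
  by have [rk ak] := wk_active h; split=> //; right.
Qed.

Lemma measurable_extend (mu : {outer_measure set Z -> \bar R}) c :
  borel_regular mu -> measurable_fun [set: caratheodory_type mu] (extend c).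
Proof.
move=> mur.
have mw k : measurable_fun [set: caratheodory_type mu] (wk k).
  have -> : wk k = if is_rank k then whitney (ver k) else cst 0.
    by apply/funext => y; rewrite /wk; case: ifP.
  case: ifP => _; last exact: measurable_cst.
  apply: (@lipschitz_measurable _ _ _ mur _ (rr (ver k).1)^-1).
    by rewrite invr_ge0.
  exact: whitney_lip.
have mnum N : measurable_fun [set: caratheodory_type mu] (num c N).
  have := @measurable_sum _ (caratheodory_type mu) R setT _ (index_iota 0 N)
    (fun k y => wk k y * c (ver k)).
  by apply => k; apply: measurable_funM.
have mden N : measurable_fun [set: caratheodory_type mu] (den N).
  exact: (@measurable_sum _ (caratheodory_type mu) R setT _ (index_iota 0 N) wk).
apply/measurable_EFinP.
(* The cutoff varies with the point, so the quotient is seen as the limit of quotients with [N]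
   terms, eventually constant at each point. The power -1 is a measurable stand-in for the inverse
   and agrees with it on nonnegative reals. *)
apply: (@emeasurable_fun_cvg _ (caratheodory_type mu) R setT
    (fun N y => (num c N y * (den N y) `^ (-1))%:E) (EFin \o extend c)).
  move=> N; apply/measurable_EFinP; apply: measurable_funM => //.
  by apply: (measurableT_comp (measurable_powR _)).
move=> y _; apply: cvg_near_cst; exists (cutoff y) => // N /= yN.
rewrite num_stable// den_stable// powR_inv1// /den.
by apply: sumr_ge0 => k _; exact: wk_ge0.
Qed.

End extension.

(** * Maximal edge oscillation *)

Section maximal_edge_function.
Context {R : realType} {T S : pmetricType R} (j : T -> S).
Variables (X : hyperbolic_filling T) (p a A : R).
Hypotheses (p0 : 0 < p) (A0 : 0 < A).
Hypothesis cX : net_count X.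
Implicit Types (e : (int * T) * (int * T)) (u : int * T -> R[i]) (y : S).

(** A discrete maximal function: the largest Hoelder quotient of exponent [a] over edges within [A]
    radii. It serves twice, on [Z] with a = 1 as a gradient and on [T] itself with a = sigma to
    produce limits. Adjoining 0 keeps the supremum nonnegative when there are no such edges. *)
Definition emax u y : \bar R := ereal_sup ([set 0%E] `|`
  [set (rr e.1.1 `^ (- a) * normc (edge_diff u e))%:E | e in
    [set e | edge X e /\ mdist y (j e.1.2) < A * rr e.1.1]]).

Lemma emax_ge0 u y : (0 <= emax u y)%E.
Proof. by apply: ereal_sup_ubound; left. Qed.

Lemma emax_edge u y (B : R) e : edge X e -> mdist y (j e.1.2) < A * rr e.1.1 ->
  (emax u y <= B%:E)%E -> normc (edge_diff u e) <= rr e.1.1 `^ a * B.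
Proof.
move=> ee ye uB.
have : ((rr e.1.1 `^ (- a) * normc (edge_diff u e))%:E <= B%:E)%E.
  by apply: le_trans uB; apply: ereal_sup_ubound; right; exists e.
by rewrite lee_fin powRN mulrC ler_pdivrMr ?powR_gt0// mulrC.
Qed.

Variables (m : {outer_measure set S -> \bar R}).
Hypothesis mr : borel_regular m.

(** The function is lower semicontinuous: its superlevel sets at nonnegative heights are unions of
    balls. *)
Lemma measurable_emax u : measurable_fun [set: caratheodory_type m] (emax u).
Proof.
apply: lsc_measurable => // t.
have [t0|t0] := ltP t 0.
  rewrite (_ : [set _ | _] = setT); first exact: openT.
  by apply/seteqP; split=> // y _ /=; rewrite (lt_le_trans _ (emax_ge0 u y)).
rewrite (_ : [set _ | _] = \bigcup_(e in [set e | edge X e /\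
    t < rr e.1.1 `^ (- a) * normc (edge_diff u e)]) ball (j e.1.2) (A * rr e.1.1)).
  by apply: bigcup_open => e _; exact: open_mball.
apply/seteqP; split=> y /=.
  move=> /ereal_sup_gt[_ [->|[e [ee ye] <-]]]; rewrite lte_fin.
    by move=> t1; have := lt_le_trans t1 t0; rewrite ltxx.
  by move=> te; exists e => //; rewrite ballEmdist/= metric_sym.
move=> [e [ee te]]; rewrite ballEmdist/= metric_sym => ye.
have := lte_fin; move=> /(_ _ t (rr e.1.1 `^ (- a) * normc (edge_diff u e))) E.
rewrite -E in te; apply: lt_le_trans te _; apply: ereal_sup_ubound.
by right; exists e.
Qed.

Variables (D C : R).
Hypothesis C0 : 0 < C.
Hypothesis mC : forall y r, 0 < r -> (m (ball y r) <= (C * r `^ D)%:E)%E.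

(** The p-th power of the supremum is at most the sum of the p-th powers, and each edge contributes
    the measure of a ball of radius A rr. *)
Lemma integral_emax u : (\int[measure_of m]_y (emax u y `^ p) <=
  (C * A `^ D)%:E * energy X p (D - a * p) u)%E.
Proof.
have pn0 : p != 0 by rewrite gt_eqF.
pose b e := rr e.1.1 `^ (- (a * p)) * normc (edge_diff u e) `^ p.
have b0 e : 0 <= b e by rewrite mulr_ge0 ?powR_ge0.
pose Be e := ball (j e.1.2) (A * rr e.1.1).
have mBe e : measurable (Be e : set (caratheodory_type m)).
  exact: measurable_mball.
have mf e : measurable_fun [set: caratheodory_type m] (fun y => (b e * \1_(Be e) y)%:E).
  by apply/measurable_EFinP; apply: measurable_funM => //; exact: measurable_indic.
have f0 e y : (0 <= (b e * \1_(Be e) y)%:E)%E by rewrite lee_fin mulr_ge0.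
have cE := countable_edge cX.
have le1 y : (emax u y `^ p <= \esum_(e in edge X) (b e * \1_(Be e) y)%:E)%E.
  set E := \esum_(e in _) _.
  have E0 : (0 <= E)%E by exact: esum_ge0.
  rewrite -[leRHS](poweRVK pn0 E0); apply: le_poweR2 (emax_ge0 _ _) _; first exact: ltW.
  apply: ge_ereal_sup => _ [->|[e [ee ye] <-]]; first exact: poweR_ge0.
  apply: lee_poweRV => //.
    by rewrite lee_fin mulr_ge0 ?powR_ge0 ?normc_ge0.
  apply: le_trans (esum_term (a := fun e => (b e * \1_(Be e) y)%:E) ee (f0 _ _)).
  rewrite poweR_EFin lee_fin indicE mem_set ?mulr1; last first.
    by rewrite /Be ballEmdist/= metric_sym.
  by rewrite powRM ?powR_ge0 ?normc_ge0// -powRrM mulNr.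
apply: (@le_trans _ _ (\int[measure_of m]_y
    (\esum_(e in edge X) (b e * \1_(Be e) y)%:E))%E).
  apply: ge0_le_integral => //.
  - by move=> y _; exact: poweR_ge0.
  - by apply: (measurableT_comp (measurable_poweR _)); exact: measurable_emax.
  - by apply: emeasurable_esum.
rewrite integral_esum// /energy -esumZl; last 2 first.
- by rewrite mulr_ge0 ?powR_ge0// ltW.
- by move=> e; rewrite lee_fin mulr_ge0 ?powR_ge0.
apply: le_esum => e ee; under eq_integral do rewrite EFinM.
rewrite ge0_integralZl_EFin ?integral_indic ?setIT//; last first.
  by apply/measurable_EFinP; exact: measurable_indic.
apply: (@le_trans _ _ ((b e)%:E * (C * (A * rr e.1.1) `^ D)%:E)%E).
  by apply: lee_wpmul2l; rewrite ?lee_fin//; apply: mC; rewrite mulr_gt0.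
rewrite -!EFinM lee_fin /b powRM//; last exact: ltW.
rewrite [rr e.1.1 `^ (D - _)]powRD ?(gt_eqF (rr_gt0 _)) ?implybT//.
rewrite le_eqVlt; apply/orP; left; apply/eqP; ring.
Qed.

End maximal_edge_function.

Section gradient.
Context {R : realType} {Z T : pmetricType R} (i : T -> Z).
Hypothesis iso : forall x y, mdist (i x) (i y) = mdist x y.
Hypothesis clF : closed (range i).
Variable X : hyperbolic_filling T.
Hypothesis cX : net_count X.
Implicit Types (y z : Z) (v w : int * T) (u : int * T -> R[i]).

Let L : R := 2 * ladder_const 1 + 1.
(** 1680 = 20 * 84, where 84 comes from [active_osc] and 20 from the product of [tau] and [rho] in
    [extend_gradient]; the rest is the constant of [extend_lip], with a successor to keep it
    positive. *)
Definition gradient_const : R :=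
  2 * ((2 * active_bound iso clF cX).+1%:R * (1680 * L)).
Local Notation K := gradient_const.

Let L0 : 0 < L.
Proof. by have := @ladder_const_gt0 R 1 ltr01; rewrite /L; lra. Qed.

Lemma gradient_const_gt0 : 0 < K.
Proof.
have H (x y : R) : 0 < x -> 0 < y -> 0 < 2 * (x * (1680 * y)) by nra.
by apply: H; [exact: ltr0Sn|exact: L0].
Qed.

(** An active vertex is within 5 radii of [y], and the edges on its way up start within one more;
    hence the aperture 6. *)
Lemma active_edges u y (B : R) v m : (emax i X 1 6 u y <= B%:E)%E -> active i X v y ->
  edges_below X u 1 B m v.1 v.2.
Proof.
move=> uB av e ee /andP[_ ev] de; have [_ _ h] := activeP av.
apply: (emax_edge (j := i) (A := 6) ee) uB.
have : rr v.1 <= rr e.1.1 :> R by exact: ler_rr.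
by have := metric_triangle y (i v.2) (i e.1.2); rewrite iso; lra.
Qed.

Lemma active_osc u y z (B rho : R) v w : 0 <= B ->
  (emax i X 1 6 u y <= B%:E)%E -> (emax i X 1 6 u z <= B%:E)%E ->
  0 < rho -> mdist y z <= rho -> dist_to i y <= rho -> dist_to i z <= rho ->
  active i X v y -> active i X w z ->
  normc (u v - u w) <= 84 * L * rho * B.
Proof.
move=> B0 uy uz r0 yz dy dz av aw.
(* Both radii are below 2 [rho], so the vertices are within 10 + 1 + 10 = 21 [rho] of each other,
   and 84 [rho] < 2 [rr m] makes this at most [rr m / 2], as [ladder] asks. *)
have [m /andP[m1 m2]] : exists m, rr m <= 84 * rho < 2 * rr m.
  by apply: exists_level; rewrite mulr_gt0.
have [v1 v2 v3] := activeP av; have [w1 w2 w3] := activeP aw.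
have mle (k : int) : rr k <= 2 * rho :> R -> m <= k.
  move=> kr; rewrite leNgt; apply/negP => km.
  have : rr m <= rr k :> R by apply: ler_rr; exact: ltW.
  lra.
have := @ladder R T X u 1 B m ltr01 B0 v w av.1 aw.1.
have mv : m <= v.1 by apply: mle; lra.
have mw : m <= w.1 by apply: mle; lra.
move=> /(_ mv mw) H.
apply: le_trans (H _ _ _) _.
- have := metric_triangle (i v.2) y (i w.2); have := metric_triangle y z (i w.2).
  by rewrite iso (metric_sym (i v.2) y); lra.
- exact: active_edges uy av.
- exact: active_edges uz aw.
rewrite powRr1// -/L; have : rr m * B <= 84 * rho * B by rewrite ler_wpM2r.
by move=> h; have := ler_wpM2l (ltW L0) h; lra.
Qed.

Lemma extend_gradient u (c : int * T -> R) y z :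
  (forall v w, `|c v - c w| <= normc (u v - u w)) ->
  ~ range i y -> ~ range i z ->
  (`|extend iso clF cX c y - extend iso clF cX c z|%:E <=
  (mdist y z)%:E * (K%:E * emax i X 1 6 u y + K%:E * emax i X 1 6 u z))%E.
Proof.
move=> cu yF zF.
have [->|yz] := eqVneq y z.
  rewrite subrr normr0 mdistxx mul0e//.
have d0 : 0 < mdist y z by rewrite mdist_gt0.
have K0 := gradient_const_gt0.
have Ey := emax_ge0 i X 1 6 u y; have Ez := emax_ge0 i X 1 6 u z.
rewrite -ge0_muleDr//.
set E := (emax i X 1 6 u y + emax i X 1 6 u z)%E.
have E0 : (0 <= E)%E by rewrite adde_ge0.
have [Eoo|Efin] := eqVneq E +oo%E.
  by rewrite Eoo (gt0_muley (x := K%:E)) ?lte_fin// gt0_muley ?lte_fin// leey.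
have Ef : E \is a fin_num by rewrite ge0_fin_numE// ltey.
pose B := fine E; have EB : E = B%:E by rewrite fineK.
have B0 : 0 <= B by rewrite -lee_fin -EB.
have uy : (emax i X 1 6 u y <= B%:E)%E by rewrite -EB leeDl.
have uz : (emax i X 1 6 u z <= B%:E)%E by rewrite -EB leeDr.
rewrite EB -!EFinM lee_fin.
set d := mdist y z in d0 *.
have dy := dist_to_gt0 clF yF; have dz := dist_to_gt0 clF zF.
pose rho := Num.max d (Num.max (dist_to i y) (dist_to i z)).
have rd : d <= rho by rewrite /rho le_max lexx.
have ry : dist_to i y <= rho by rewrite /rho !le_max lexx orbT.
have rz : dist_to i z <= rho by rewrite /rho !le_max lexx !orbT.
have r0 : 0 < rho by exact: lt_le_trans rd.
(* If [y] and [z] are far apart relative to [rho], bumps differ by at most 5, their maximal height.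
   Otherwise active radii are at least [rho / 4] and the Lipschitz bound applies. Either way the
   product of [tau] and [rho] is at most 20 [d]. *)
pose tau := if rho <= 4 * d then 5 else 4 * d / rho.
have tr : tau * rho <= 20 * d.
  rewrite /tau; case: ifP => h; first lra.
  by rewrite mulfVK ?gt_eqF//; lra.
have t0 : 0 <= tau.
  by rewrite /tau; case: ifP => // _; rewrite divr_ge0 ?mulr_ge0 ?ltW.
have Om0 : 0 <= 84 * L * rho * B.
  by rewrite !mulr_ge0// ltW.
have tau_ok v : active i X v y \/ active i X v z -> `|whitney i v y - whitney i v z| <= tau.
  move=> av; rewrite /tau; case: ifPn => [_|].
    rewrite ler_norml; have := whitney_ge0 i v y; have := whitney_ge0 i v z.
    have := whitney_le5 i v y; have := whitney_le5 i v z.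
    by move=> *; apply/andP; split; lra.
  rewrite -ltNge => h; apply: le_trans (whitney_lip_abs i v y z) _.
  have l1 := dist_to_lip i y z; have l2 := dist_to_lip i z y.
  rewrite (metric_sym z y) in l2; rewrite -/d in l1 l2.
  have rv := @rr_gt0 R v.1.
  have hv : rho <= 4 * rr v.1.
    have hr : rho = dist_to i y \/ rho = dist_to i z.
      have [E1|E1] : rho = d \/ rho = Num.max (dist_to i y) (dist_to i z).
        by rewrite /rho; case: (leP d _) => _; [right|left].
        lra.
      by rewrite E1; case: (leP (dist_to i y) _) => _; [right|left].
    by case: av => /activeP[a1 a2 a3]; case: hr => hr; lra.
  rewrite -/d mulrC ler_pdivlMr// mulrAC ler_pdivrMr//.
  nra.
apply: le_trans (extend_lip iso clF cX t0 Om0 yF zF tau_ok _) _.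
  move=> v w av aw; apply: le_trans (cu v w) _.
  case: av => av.
    exact: (@active_osc u y z).
  apply: (@active_osc u z z) => //.
  by rewrite mdistxx ltW.
rewrite /K.
have -> : tau * (84 * L * rho * B) = tau * rho * (84 * L * B) by ring.
have LB : 0 <= 84 * L * B by rewrite !mulr_ge0// ltW.
have h1 : tau * rho * (84 * L * B) <= 20 * d * (84 * L * B) by rewrite ler_wpM2r.
have h2 : ((2 * active_bound iso clF cX)%:R : R) <= (2 * active_bound iso clF cX).+1%:R.
  by rewrite ler_nat.
have h3 : 0 <= 20 * d * (84 * L * B) by apply: mulr_ge0 LB; lra.
have n0 : 0 <= ((2 * active_bound iso clF cX)%:R : R) by [].
have := ler_wpM2l n0 h1; have := ler_wpM2r h3 h2; lra.
Qed.

End gradient.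

(** * Holes of a porous set *)

Lemma at_most_int (N : nat) (A : set int) :
  (forall m n, A m -> A n -> m - n < N%:Z) -> at_most (2 * N) A.
Proof.
move=> AN [//|x0 t] us sA; set s := x0 :: t in us sA *.
have Ax0 : A x0 by apply: sA; rewrite mem_head.
pose f (n : int) := absz (n - ((x0 : int) - N%:Z))%R.
have fP (n : int) : n \in s -> n = (f n)%:Z + ((x0 : int) - N%:Z) /\ (f n < 2 * N)%N.
  by move=> /sA An; have := AN _ _ An Ax0; have := AN _ _ Ax0 An; rewrite /f; lia.
rewrite -(size_map f) -[X in (_ <= X)%N](size_iota 0); apply: uniq_leq_size.
  rewrite map_inj_in_uniq// => m n /fP[mE _] /fP[nE _] mn.
  by rewrite mE nE mn.
by move=> _ /mapP[n /fP[_ h] ->]; rewrite mem_iota.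
Qed.

Lemma lee_nat_bounded {R : realType} (x B : \bar R) : (0 <= x)%E -> (B < +oo)%E ->
  (forall N : nat, (N%:R%:E * x <= B)%E) -> x = 0%E.
Proof.
move=> x0 Boo H; apply/eqP; rewrite eq_le x0 andbT leNgt; apply/negP => xp.
have := H 1; rewrite mul1e => xB.
have xf : x \is a fin_num by rewrite ge0_fin_numE// (le_lt_trans xB).
have Bf : B \is a fin_num by rewrite ge0_fin_numE// (le_trans x0).
have B0 : 0 <= fine B by rewrite fine_ge0// (le_trans x0).
move: xp H; rewrite -(fineK xf) -(fineK Bf) lte_fin => xp H.
have := H (Num.bound (fine B / fine x)); rewrite -EFinM lee_fin -ler_pdivlMr//.
apply/negP; rewrite -ltNge; apply: archi_boundP; rewrite divr_ge0// ltW//.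
Qed.

Section holes.
Context {R : realType} {Z T : pmetricType R} (i : T -> Z).
Hypothesis iso : forall x y, mdist (i x) (i y) = mdist x y.
Hypothesis T2 : exists x y : T, x <> y.
Variables (mu : {outer_measure set Z -> \bar R}) (Q : R).
Hypothesis Q0 : 0 < Q.
Hypothesis muA : ahlfors_regular Q mu.
Hypothesis por : porous (range i).
Variable X : hyperbolic_filling T.
Hypothesis cX : net_count X.
Implicit Types (v w : int * T) (y z : Z).

Let clF : closed (range i) := por.1.

Definition fvertex := [set v | vertex X v /\ fine_level (T := T) v.1].

Lemma le_diam_embed : (diam [set: T] <= diam [set: Z])%E.
Proof.
apply: ge_ereal_sup => _ [[x y] _ <-] /=; rewrite -iso.
exact: le_diamT.
Qed.

(** Porosity in a ball of radius rr / 8 yields a free ball of radius c rr / 8; keeping the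
    concentric ball of half that radius leaves a margin of the same size to the range. *)
Definition hole_ratio := projT1 (cid por.2) / 16.
Local Notation c0 := hole_ratio.

Lemma hole_ratio_gt0 : 0 < hole_ratio.
Proof. by have [? _ _] := projT2 (cid por.2); rewrite divr_gt0. Qed.

Lemma porous_hole v : fine_level (T := T) v.1 -> exists zeta,
  ball zeta (2 * c0 * rr v.1) `<=` ball (i v.2) (rr v.1 / 8) `\` range i.
Proof.
move=> fv; have [_ _ H] := projT2 (cid por.2).
have r0 := @rr_gt0 R v.1.
have [||| xi Hxi] := H (i v.2) (rr v.1 / 8).
- by rewrite divr_gt0.
- by apply: lt_le_trans le_diam_embed; apply: lt_trans fv; rewrite lte_fin; lra.
- by exists (i v.2); split; [rewrite ballEmdist/= mdistxx divr_gt0|exists v.2].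
exists xi; rewrite (_ : 2 * c0 * _ = projT1 (cid por.2) * (rr v.1 / 8))//.
by rewrite /c0; field.
Qed.

Definition hole v : set Z :=
  ball (xget point [set zeta | ball zeta (2 * c0 * rr v.1) `<=`
    ball (i v.2) (rr v.1 / 8) `\` range i]) (c0 * rr v.1).

Lemma hole_near v y : fine_level (T := T) v.1 -> hole v y ->
  mdist y (i v.2) < rr v.1 / 8.
Proof.
move=> fv; have h0 := hole_ratio_gt0; have r0 := @rr_gt0 R v.1.
rewrite /hole; set A := [set zeta | _]; rewrite ballEmdist/= => h.
have [zeta' Hz] := porous_hole fv.
have := @xgetPex _ point A (ex_intro _ zeta' Hz); set zeta := xget _ _ in h *.
move=> /(_ y) []; last by rewrite ballEmdist/= metric_sym.
rewrite ballEmdist/=; have : 0 < c0 * rr v.1 by rewrite mulr_gt0.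
lra.
Qed.

Lemma hole_far v y x : fine_level (T := T) v.1 -> hole v y ->
  hole_ratio * rr v.1 <= mdist y (i x).
Proof.
move=> fv; rewrite /hole; set A := [set zeta | _]; rewrite ballEmdist/= => h.
have [zeta' Hz] := porous_hole fv.
have := @xgetPex _ point A (ex_intro _ zeta' Hz); set zeta := xget _ _ in h *.
move=> H; have far : 2 * c0 * rr v.1 <= mdist zeta (i x).
  rewrite leNgt; apply/negP => hx; have [] := H (i x); first by rewrite ballEmdist.
  by move=> _; apply; exists x.
by have := metric_triangle zeta y (i x); lra.
Qed.

Lemma measurable_hole v : measurable (hole v : set (caratheodory_type mu)).
Proof. by apply: measurable_mball; exact: muA.1.1. Qed.

Lemma hole_fin_num v : mu (hole v) \is a fin_num.
Proof. by apply: (ball_fin_num muA); rewrite mulr_gt0 ?hole_ratio_gt0. Qed.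

Lemma hole_lower : exists2 c : R, 0 < c & forall v, fine_level (T := T) v.1 ->
  ((c * rr v.1 `^ Q)%:E <= mu (hole v))%E.
Proof.
have [_ [C C0 HC]] := muA; have [_ c1 _] := projT2 (cid por.2).
have h0 := hole_ratio_gt0.
exists (C^-1 * c0 `^ Q); first by rewrite mulr_gt0 ?invr_gt0 ?powR_gt0.
move=> v fv; have r0 := @rr_gt0 R v.1.
rewrite /hole; set zeta := xget _ _.
have cr : 0 < c0 * rr v.1 by rewrite mulr_gt0.
have crd : ((c0 * rr v.1)%:E < diam [set: Z])%E.
  apply: lt_le_trans le_diam_embed; apply: le_lt_trans fv; rewrite lee_fin.
  have : c0 <= 4^-1 by rewrite /c0; lra.
  nra.
have /andP[+ _] := HC zeta _ cr crd.
by apply: le_trans; rewrite lee_fin powRM ?(ltW h0)// mulrA.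
Qed.

(** A point in a hole of level n has distance to the range between [hole_ratio] rr and rr / 8, so
    boundedly many levels are possible; at one level the vertex is determined, being within rr / 8
    of the point. *)
Lemma hole_overlap : exists M : nat, forall y, at_most M [set v | fvertex v /\ hole v y].
Proof.
have h0 := hole_ratio_gt0; have h8 : 0 < 8 * hole_ratio by rewrite mulr_gt0.
pose N := Num.bound (8 * hole_ratio)^-1; exists (2 * N * 1)%N => y.
apply: (at_most_bind (f := fst)
  (A := [set n : int | hole_ratio * rr n <= dist_to i y /\ dist_to i y <= rr n / 8])).
- move=> [n xi] [[Vv fv] hv] /=; split.
    by apply: dist_to_ge => x; apply: hole_far hv.
  by apply: le_trans (dist_to_le i y xi) _; apply/ltW; exact: hole_near hv.
- apply: at_most_int => m n [m1 m2] [n1 n2]; rewrite ltNge; apply/negP => mn.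
  have rm := @rr_gt0 R m; have rn := @rr_gt0 R n.
  have E : rr m <= rr n * rr N%:Z :> R by rewrite -rrD; apply: ler_rr; lia.
  have NB : (8 * hole_ratio)^-1 < N%:R :> R.
    by apply: archi_boundP; rewrite invr_ge0 ltW.
  have N0 : 0 < N%:R :> R by rewrite (lt_trans _ NB)// invr_gt0.
  have N2 : rr N%:Z * N%:R < 1 :> R.
    rewrite rr_nat exprVn mulrC ltr_pdivrMr ?exprn_gt0// mul1r -natrX ltr_nat.
    exact: ltn_expl.
  have E2 : hole_ratio * rr n * 8 <= rr m by lra.
  have E3 : 1 < N%:R * (8 * hole_ratio) by rewrite -ltr_pdivrMr// div1r.
  have E4 : rr n < N%:R * (8 * hole_ratio) * rr n by rewrite ltr_pMl.
  have E5 : N%:R * (8 * hole_ratio) * rr n <= N%:R * rr m.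
    by rewrite -mulrA ler_pM2l//; lra.
  have E6 : N%:R * rr m <= N%:R * (rr n * rr N%:Z) :> R.
    by apply: ler_wpM2l E; exact: ltW.
  have E7 : rr n * (rr N%:Z * N%:R) < rr n :> R by rewrite gtr_pMr.
  lra.
- move=> n _; apply: at_most_subsingle => -[k1 x1] [k2 x2].
  move=> [[[V1 f1] h1] /= e1] [[[V2 f2] h2] /= e2].
  have /= d1 := hole_near f1 h1; have /= d2 := hole_near f2 h2.
  rewrite /vertex/= e1 in V1 d1; rewrite /vertex/= e2 in V2 d2.
  rewrite e1 e2; congr (_, _); apply: (net_sep V1 V2); rewrite -iso.
  have := metric_triangle (i x1) y (i x2); rewrite (metric_sym (i x1) y).
  by have := @rr_gt0 R n; lra.
Qed.

Lemma countable_fvertex : countable fvertex.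
Proof.
by apply: sub_countable (countable_vertex cX); apply: subset_card_le => v [].
Qed.

Lemma hole_integral : exists2 M : R, 0 <= M & forall h : Z -> \bar R,
  (forall y, 0 <= h y)%E -> measurable_fun [set: caratheodory_type mu] h ->
  (\esum_(v in fvertex) \int[measure_of mu]_(y in hole v) h y <=
   M%:E * \int[measure_of mu]_y h y)%E.
Proof.
have cfv := countable_fvertex.
have [M HM] := hole_overlap; exists M%:R => // h h0 mh.
have p0 v y : (0 <= (h \_ (hole v)) y)%E by rewrite patchE; case: ifP.
have mp v : measurable_fun [set: caratheodory_type mu] (h \_ (hole v)).
  by apply/(measurable_restrictT _ (measurable_hole v)); exact: measurable_funS mh.
under eq_esum do rewrite integral_mkcond.
rewrite -integral_esum// -ge0_integralZl_EFin//.
apply: ge0_le_integral => //.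
- by move=> y _; exact: esum_ge0.
- exact: emeasurable_esum.
- exact: measurable_funeM.
- move=> y _; rewrite (_ : \esum_(v in _) _ =
    \esum_(v in [set v | fvertex v /\ hole v y]) h y).
    exact: (at_most_esum (HM y)).
  rewrite (esum_mkcondr _ (fun v => hole v y)).
  apply: eq_esum => v _; rewrite patchE.
  by have [hv|hv] := pselect (hole v y); [rewrite !mem_set|rewrite !memNset].
Qed.

(** At each fine level a bounded piece of the range is covered by balls of measure comparable to
    their holes, so its measure is at most K times the total hole mass of that level. By bounded
    overlap the hole masses of all levels have a finite sum; a number that is below every term of
    such a sum, up to K, is 0. *)
Lemma porous_measure0 : mu (range i) = 0%E.
Proof.
have cfv := countable_fvertex.
have mF : measurable (range i : set (caratheodory_type mu)).
  by apply: closed_measurable_cara; first exact: muA.1.1.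
have [C C0 HC] : exists2 C : R, 0 < C & forall z r, 0 < r -> (mu (ball z r) <= (C * r `^ Q)%:E)%E.
  apply: ahlfors_upper Q0 muA _; have [x [y xy]] := T2; exists (i x), (i y) => ixy.
  by apply: xy; apply: mdist_positivity; rewrite -iso ixy mdistxx.
have [cW cW0 HW] := hole_lower; have [M M0 HM] := hole_integral.
have [n1 fn1] := exists_fine_level T2.
have [n2 /andP[n2r _]] := @exists_level R 1 ltr01.
pose n0 := Num.max n1 n2.
have fine_n n : n0 <= n -> fine_level (T := T) n /\ rr n <= 1 :> R.
  rewrite /n0 ge_max => /andP[h1 h2]; split; first exact: fine_level_le fn1.
  by apply: le_trans n2r; exact: ler_rr.
pose K := C / cW; have K0 : 0 <= K by rewrite divr_ge0 ?ltW.
have mB z r : measurable (ball z r : set (caratheodory_type mu)).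
  by apply: measurable_mball; exact: muA.1.1.
have mB1 z r : measurable_fun [set: caratheodory_type mu] (fun y => (\1_(ball z r) y : R)%:E).
  by apply/measurable_EFinP; exact: measurable_indic.
have muB z r : mu (ball z r) = (\int[measure_of mu]_y (\1_(ball z r) y)%:E)%E.
  by rewrite integral_indic// setIT.
have ball0 (r : nat) : mu (range i `&` ball (i point) r%:R) = 0%E.
  set A := range i `&` _.
  have mA : measurable (A : set (caratheodory_type mu)) by exact: measurableI.
  pose P v := mdist point v.2 < r%:R + 1.
  pose B' := ball (i point) (r%:R + 2).
  pose W := [set v | fvertex v /\ n0 <= v.1 /\ P v].
  pose s n := \esum_(v in [set v | W v /\ v.1 = n]) mu (hole v).
  have s0 n : (0 <= s n)%E by apply: esum_ge0 => v _; exact: outer_measure_ge0.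
  have sum_s : (\esum_(n in [set: int]) s n <= M%:E * mu B')%E.
    rewrite -(esum_fibre (D := W) (a := fun v => mu (hole v)) fst)//.
    rewrite [mu B']muB; apply: le_trans (HM _ _ (mB1 _ _)); last by move=> y; rewrite lee_fin.
    apply: le_esum_sub => [v []//|v [[Vv fv] [nv Pv]]|v _]; last first.
      by apply: integral_ge0 => y _; rewrite lee_fin.
    rewrite integral_indic//; last exact: measurable_hole.
    apply: le_outer_measure => y hy; split=> //.
    rewrite ballEmdist/=; have := hole_near fv hy.
    have := metric_triangle (i point) (i v.2) y; rewrite iso (metric_sym (i v.2) y).
    by have [_ ?] := fine_n _ nv; rewrite /P in Pv; lra.
  have As n : n0 <= n -> (mu A <= K%:E * s n)%E.
    move=> nn; have [fn r1] := fine_n _ nn.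
    pose V := [set v | W v /\ v.1 = n].
    have cV : countable V.
      by apply: sub_countable cfv; apply: subset_card_le => v [[]].
    pose Bv v := ball (i v.2) (rr v.1).
    apply: (@le_trans _ _ (\esum_(v in V) mu (Bv v))).
      rewrite /Bv; under eq_esum do rewrite muB.
      rewrite -integral_esum//.
      have <- : (\int[measure_of mu]_y (\1_A y)%:E)%E = mu A.
        by rewrite integral_indic// setIT.
      apply: ge0_le_integral => //.
      - by apply/measurable_EFinP; exact: measurable_indic.
      - by apply: emeasurable_esum => // v y; rewrite lee_fin.
      - move=> y _; rewrite indicE; have [/set_mem Ay|_] := boolP (y \in A); last first.
          by apply: esum_ge0 => v _; rewrite lee_fin.
        case: Ay => -[x _ <-]; rewrite ballEmdist/= iso => dx.
        have [xi nxi xxi] := net_cover X n x; have rn := @rr_gt0 R n.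
        apply: le_trans (esum_term (x := (n, xi))
          (a := fun v => (\1_(ball (i v.2) (rr v.1)) (i x))%:E) _ _); rewrite ?lee_fin//.
          by rewrite indicE mem_set//= ballEmdist/= iso metric_sym; lra.
        split=> //; split=> //; split=> //.
        by rewrite /P/=; have := metric_triangle point x xi; lra.
    rewrite -esumZl//.
    apply: le_esum => v [[[Vv fv] _] vn].
    apply: le_trans (HC _ _ (rr_gt0 _)) _.
    apply: le_trans (lee_wpmul2l _ (HW v fv)); last by rewrite lee_fin.
    by rewrite -EFinM lee_fin /K mulrA mulfVK ?gt_eqF.
  have r2 : 0 < r%:R + 2 :> R by rewrite ltr_wpDl.
  apply: (@lee_nat_bounded _ _ (K%:E * (M%:E * mu B'))%E).
  - exact: outer_measure_ge0.
  - by rewrite -(fineK (ball_fin_num muA (i point) r2)) -!EFinM ltry.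
  move=> N; apply: (@le_trans _ _ (K%:E * \esum_(n in [set: int]) s n)%E); last first.
    by apply: lee_wpmul2l => //; rewrite lee_fin.
  rewrite -esumZl//; apply: esum_ge; exists [set n0 + k%:Z | k in `I_N].
    by split=> //; apply: finite_image; exact: finite_II.
  rewrite (reindex_fsbig (fun k : nat => n0 + k%:Z) `I_N)/=; last first.
    split; [by move=> k kN; exists k|by move=> k l _ _ /addrI[]|by move=> _ [k kN <-]; exists k].
  apply: (@le_trans _ _ (\sum_(k \in `I_N) mu A)%E); last first.
    by apply: lee_fsum => [|k _]; [exact: finite_II|apply: As; rewrite lerDl].
  rewrite -fsbig_ord big_const_ord; elim: N => [|N IH]; first by rewrite mul0e.
  by rewrite iterS -add1n natrD EFinD ge0_muleDl ?lee_fin// mul1e leeD2l.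
apply/eqP; rewrite eq_le outer_measure_ge0 andbT.
have <- : mu (\bigcup_(r : nat) (range i `&` ball (i point) r%:R)) = mu (range i).
  congr (mu _); apply/seteqP; split=> [y [r _ []]//|y Fy].
  exists (Num.bound (mdist (i point) y)) => //; split=> //.
  by rewrite ballEmdist/=; apply: archi_boundP; exact: mdist_ge0.
apply: le_trans (outer_measure_sigma_subadditive mu _) _.
by rewrite eseries0// => r _ _; exact: ball0.
Qed.

End holes.

(** * Traces as limits over holes *)

Section markov.
Context d {T : measurableType d} {R : realType} (m : {measure set T -> \bar R}).

(** The strict inequality keeps the bound valid for B = 0: then the integral vanishes and [h] is
    positive only on a null set. *)
Lemma markov_strict (W : set T) (h : T -> \bar R) (B t : R) : measurable W ->
  (m W < +oo)%E -> (forall y, (0 <= h y)%E) -> measurable_fun W h -> 0 <= B -> 0 < t ->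
  (\int[m]_(y in W) h y <= B%:E * m W)%E ->
  (m (W `&` [set y | ((t * B)%:E < h y)%E]) <= t^-1%:E * m W)%E.
Proof.
move=> mW Woo h0 mh B0 t0 hB.
have mE : measurable (W `&` [set y | ((t * B)%:E < h y)%E]).
  exact: emeasurable_fun_o_infty.
have [Bp|B00] := ltP 0 B.
  have tB : 0 < t * B by rewrite mulr_gt0.
  rewrite -(@lee_pmul2l _ (t * B)%:E) ?lte_fin//.
  have -> : ((t * B)%:E * (t^-1%:E * m W) = B%:E * m W)%E.
    by rewrite muleA -EFinM; congr (_%:E * _)%E; field; rewrite gt_eqF.
  apply: le_trans hB; rewrite -integral_cst//.
  apply: (@le_trans _ _ (\int[m]_(y in W `&` [set y | ((t * B)%:E < h y)%E]) h y)%E); last first.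
    by apply: ge0_subset_integral => //; exact: subIsetl.
  apply: ge0_le_integral => //.
  - by move=> y _; rewrite lee_fin ltW.
  - by apply: measurable_funS mh => //; exact: subIsetl.
  - by move=> y [_ /ltW].
have B_0 : B = 0 by apply/eqP; rewrite eq_le B00.
have i0 : (\int[m]_(y in W) `|h y| = 0)%E.
  under eq_integral do rewrite gee0_abs//.
  apply/eqP; rewrite eq_le integral_ge0// andbT.
  by apply: le_trans hB _; rewrite B_0 mul0e.
have [N [mN N0 HN]] := (ae_eq_integral_abs m mW mh).1 i0.
apply: (@le_trans _ _ 0%E); last by rewrite mule_ge0// lee_fin invr_ge0 ltW.
rewrite -N0; apply: le_measure; rewrite ?inE//.
move=> y [Wy]; rewrite /= B_0 mulr0 => hy; apply: HN => /= /(_ Wy) h00.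
by rewrite h00 ltxx in hy.
Qed.

End markov.

Section trace.
Context {R : realType} {Z T : pmetricType R} (i : T -> Z).
Hypothesis iso : forall x y, mdist (i x) (i y) = mdist x y.
Hypothesis T2 : exists x y : T, x <> y.
Variables (mu : {outer_measure set Z -> \bar R}) (Q : R).
Hypothesis Q0 : 0 < Q.
Hypothesis muA : ahlfors_regular Q mu.
Hypothesis por : porous (range i).
Variable X : hyperbolic_filling T.
Hypothesis cX : net_count X.
Implicit Types (v w : int * T) (y z : Z) (f g : Z -> R[i]) (x : T).

Let near_hole n x := hole por (n, nearest cX n x).

(* The trace is a limit in measure along holes of the porous set; no
   integrability of [f] is needed, which matters when [p < 1]. *)
Definition trace_lim f x (l : R[i]) := forall e : R, 0 < e -> exists N : int,
  forall n, N <= n ->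
  (mu (near_hole n x `&` [set y | (e < normc (f y - l))%R]) <= e%:E * mu (near_hole n x))%E.

Definition trace f x : R[i] := xget 0 [set l | trace_lim f x l].

Let fine_from : exists N : int, forall n, N <= n -> fine_level (T := T) n.
Proof.
by have [N fN] := exists_fine_level T2; exists N => n Nn; exact: fine_level_le fN.
Qed.

Let hole_pos n x : 0 < fine (mu (near_hole n x)).
Proof.
rewrite fine_gt0//; apply/andP; split.
  by apply: (ball_gt0 muA); rewrite mulr_gt0 ?hole_ratio_gt0.
by rewrite -ge0_fin_numE ?outer_measure_ge0// (hole_fin_num muA).
Qed.

Let mu_near n x : mu (near_hole n x) = (fine (mu (near_hole n x)))%:E.
Proof. by rewrite fineK// (hole_fin_num muA). Qed.

Lemma trace_lim_unique f x l l' : trace_lim f x l -> trace_lim f x l' -> l = l'.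
Proof.
move=> fl fl'; apply: contrapT => /eqP ll'.
have n0 : 0 < normc (l - l').
  rewrite lt_neqAle normc_ge0 andbT eq_sym; apply: contra ll' => /eqP.
  by move=> /eq0_normc /eqP; rewrite subr_eq0.
(* Each exceptional set fills at most a third of the hole, so some point of the hole has a value
   close to both limits. *)
pose e := Num.min (1 / 3) (normc (l - l') / 3).
have e0 : 0 < e by rewrite lt_min; apply/andP; split; lra.
have [N HN] := fl e e0; have [N' HN'] := fl' e e0.
pose n := Num.max N N'.
have := HN n; rewrite le_max lexx => /(_ isT) h1.
have := HN' n; rewrite le_max lexx orbT => /(_ isT) h2.
have : (mu (near_hole n x) <= e%:E * mu (near_hole n x) + e%:E * mu (near_hole n x))%E.
  apply: le_trans (leeD h1 h2); apply: le_trans (outer_measureU2 mu _ _).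
  apply: le_outer_measure => y hy.
  have [|h] := ltP e (normc (f y - l)); first by left.
  right; split=> //=; rewrite ltNge; apply/negP => h'.
  have := normc_triangle (f y) l l'; rewrite (normc_sub l (f y)).
  have : e <= normc (l - l') / 3 by rewrite ge_min lexx orbT.
  have : e <= 1 / 3 by rewrite ge_min lexx.
  lra.
rewrite mu_near -EFinM -EFinD lee_fin; have := hole_pos n x.
have : e <= 1 / 3 by rewrite ge_min lexx.
nra.
Qed.

Lemma traceE f x l : trace_lim f x l -> trace f x = l.
Proof.
move=> fl; apply: trace_lim_unique (fl).
exact: (@xgetPex _ 0 [set l | trace_lim f x l] (ex_intro _ l fl)).
Qed.

Lemma trace_lim_lin (a : R[i]) f g x l l' : trace_lim f x l -> trace_lim g x l' ->
  trace_lim (fun y => a * f y + g y) x (a * l + l').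
Proof.
(* The first bound splits [e] between the two exceptional sets and leaves half of it for [g]; the
   second makes |a| e' at most e / 2. *)
move=> fl gl e e0; pose e' := Num.min (e / 2) (e / (2 * (normc a + 1))).
have a0 := normc_ge0 a.
have e'0 : 0 < e'.
  by rewrite lt_min !divr_gt0// mulr_gt0//; lra.
have [N HN] := fl e' e'0; have [N' HN'] := gl e' e'0.
exists (Num.max N N') => n; rewrite ge_max => /andP[nN nN'].
have e'2 : e' <= e / 2 by rewrite ge_min lexx.
apply: (@le_trans _ _ (e'%:E * mu (near_hole n x) + e'%:E * mu (near_hole n x))%E); last first.
  by rewrite mu_near -!EFinM -EFinD lee_fin; have := hole_pos n x; nra.
apply: le_trans (leeD (HN _ nN) (HN' _ nN')).
apply: le_trans (outer_measureU2 mu _ _); apply: le_outer_measure => y [hy] /= ey.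
have [|h] := ltP e' (normc (f y - l)); first by left.
right; split=> //=; rewrite ltNge; apply/negP => h'.
have := ler_normcD (a * (f y - l)) (g y - l'); rewrite normcM.
have -> : a * (f y - l) + (g y - l') = a * f y + g y - (a * l + l') by ring.
have : normc a * normc (f y - l) <= normc a * (e / (2 * (normc a + 1))).
  by rewrite ler_wpM2l// (le_trans h)// ge_min lexx orbT.
have : normc a * (e / (2 * (normc a + 1))) <= e / 2.
  have -> : normc a * (e / (2 * (normc a + 1))) = e / 2 * (normc a / (normc a + 1)).
    by field; rewrite gt_eqF//; lra.
  rewrite ler_piMr//; first by lra.
  by rewrite ler_pdivrMr; lra.
lra.
Qed.

(** The exceptional sets change by null sets only, so the trace depends on the class of the function
    even though the range itself is null. *)
Lemma trace_lim_ae f g x l (c : R[i]) : ae_equal mu (fun y => g y - f y) (fun=> c) ->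
  trace_lim f x l -> trace_lim g x (l + c).
Proof.
move=> [N [mN N0 HN]] fl e e0; have [M HM] := fl e e0; exists M => n Mn.
apply: le_trans (HM n Mn); rewrite -[leRHS]adde0 -[X in (_ + X)%E]N0.
apply: le_trans (outer_measureU2 mu _ _); apply: le_outer_measure => y [hy] /= ey.
have [Ny|nNy] := pselect (N y); first by right.
left; split=> //=; have gfc : g y - f y = c.
  by apply: contrapT => h; apply: nNy; apply: HN.
have -> // : f y - l = g y - (l + c) by rewrite -gfc; ring.
Qed.

Lemma trace_lim_continuous f x : continuous (f : Z -> R[i]^o) -> trace_lim f x (f (i x)).
Proof.
move=> cf e e0.
have eC : 0 < e%:C%C :> R[i] by rewrite ltcR.
have := cf (i x); move=> /cvgr_distC_lt /(_ _ eC).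
rewrite nearE /= -nbhs_ballE => -[r /= r0 Hr].
have [n0 /andP[n0r _]] := exists_level r0.
have [N fN] := fine_from.
exists (Num.max N n0) => n; rewrite ge_max => /andP[nN n0n].
apply: (@le_trans _ _ 0%E); last first.
  by apply: mule_ge0 (outer_measure_ge0 _ _); rewrite lee_fin ltW.
rewrite -(outer_measure0 mu); apply: le_outer_measure => y [hy] /=.
have := Hr y; rewrite ballEmdist /=.
have -> : mdist (i x) y < r.
  have /= := hole_near (v := (n, nearest cX n x)) iso (fN _ nN) hy.
  have := metric_triangle (i x) (i (nearest cX n x)) y; rewrite iso.
  rewrite (metric_sym (i (nearest cX n x)) y).
  have := mdist_nearest cX n x; have := @rr_gt0 R n.
  have : rr n <= rr n0 :> R by exact: ler_rr.
  lra.
move=> /(_ isT); rewrite normc_def ltcR => h1 h2.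
by move: h1; rewrite ltNge; apply/negP; rewrite negbK; move: (f y - _) h2 => -[a b] /= /ltW.
Qed.

End trace.

Lemma int_ge_nat (k n : int) : k <= n -> exists j : nat, n = k + j%:Z.
Proof. by move=> kn; exists (absz (n - k)%R); lia. Qed.

Section complex_telescope.
Context {R : realType}.

Lemma telescope_cvg (r d : nat -> R) (D : R) : (forall j, `|r j.+1 - r j| <= d j) ->
  (forall N, \sum_(j < N) d j <= D) -> cvgn r.
Proof.
move=> rd dD; have d0 j : 0 <= d j by apply: le_trans (rd j).
have cd : cvgn (series d).
  apply: nondecreasing_is_cvgn.
    by apply/nondecreasing_seqP => n; rewrite /series/= big_nat_recr//= lerDl.
  by exists D => _ [n _ <-]; rewrite /series/= big_mkord.
have ct : cvgn (series (telescope r)).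
  apply: normed_cvg; apply: (series_le_cvg _ d0 rd cd) => n.
  exact: normr_ge0.
rewrite telescopeK in ct.
have -> : r = (fun n => (r n - r 0%N) + r 0%N) by apply/funext => n; rewrite subrK.
by apply: is_cvgD => //; exact: is_cvg_cst.
Qed.

Lemma complex_telescope (a : nat -> R[i]) (d : nat -> R) (D : R) :
  (forall j, normc (a j.+1 - a j) <= d j) -> (forall N, \sum_(j < N) d j <= D) ->
  exists l, (forall e, 0 < e -> exists N : nat, forall n, (N <= n)%N -> normc (a n - l) < e) /\
    normc (l - a 0%N) <= D.
Proof.
move=> ad dD.
have cRe : cvgn (fun n => complex.Re (a n)).
  by apply: telescope_cvg dD => j; rewrite -ReB; apply: le_trans (ad j); exact: normc_Re.
have cIm : cvgn (fun n => complex.Im (a n)).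
  by apply: telescope_cvg dD => j; rewrite -ImB; apply: le_trans (ad j); exact: normc_Im.
pose l := Complex (limn (fun n => complex.Re (a n))) (limn (fun n => complex.Im (a n))).
have al e : 0 < e -> exists N : nat, forall n, (N <= n)%N -> normc (a n - l) < e.
  move=> e0; have e2 : 0 < e / 2 by rewrite divr_gt0.
  move: cRe => /cvgrPdistC_lt /(_ _ e2) [N1 _ H1].
  move: cIm => /cvgrPdistC_lt /(_ _ e2) [N2 _ H2].
  exists (maxn N1 N2) => n; rewrite geq_max => /andP[n1 n2].
  apply: le_lt_trans (normc_ReIm _) _; rewrite ReB ImB /=.
  by have /= := H1 n n1; have /= := H2 n n2; lra.
exists l; split=> //.
have aD N : normc (a N - a 0%N) <= D.
  apply: le_trans (dD N); elim: N => [|N IH]; first by rewrite subrr normc0 big_ord0.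
  rewrite big_ord_recr/= addrC; apply: le_trans (normc_triangle (a N) _ _) _.
  exact: lerD.
apply/ler_addgt0Pl => e e0; have [N HN] := al e e0.
have := normc_triangle (a N) l (a 0%N); rewrite (normc_sub l (a N)).
by have := HN N (leqnn _); have := aD N; lra.
Qed.

End complex_telescope.

(** * Pointwise estimates for the trace *)

Section trace_estimates.
Context {R : realType} {Z T : pmetricType R} (i : T -> Z).
Hypothesis iso : forall x y, mdist (i x) (i y) = mdist x y.
Hypothesis T2 : exists x y : T, x <> y.
Variables (mu : {outer_measure set Z -> \bar R}) (Q p : R).
Hypothesis Q0 : 0 < Q.
Hypothesis p0 : 0 < p.
Hypothesis muA : ahlfors_regular Q mu.
Hypothesis por : porous (range i).
Variable X : hyperbolic_filling T.
Hypothesis cX : net_count X.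
Variable cW : R.
Hypothesis cW0 : 0 < cW.
Hypothesis HW : forall v : int * T, fine_level (T := T) v.1 ->
  ((cW * rr v.1 `^ Q)%:E <= mu (hole por v))%E.
Variables (f : Z -> R[i]) (g : Z -> \bar R).
Hypothesis g0 : forall y, (0 <= g y)%E.
Hypothesis mg : measurable_fun [set: caratheodory_type mu] g.
Hypothesis Ioo : (\int[measure_of mu]_y (g y `^ p) < +oo)%E.
Hypothesis fg : forall y z, ((normc (f y - f z))%:E <= (mdist y z)%:E * (g y + g z))%E.
Implicit Types (v w : int * T) (y z : Z) (x : T).

Let pn0 : p != 0. Proof. by rewrite gt_eqF. Qed.
Let h y := (g y `^ p)%E.

Let h0 y : (0 <= h y)%E. Proof. exact: poweR_ge0. Qed.

Let mh : measurable_fun [set: caratheodory_type mu] h.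
Proof. exact: (measurableT_comp (measurable_poweR _)). Qed.

Let mhole v : measurable (hole por v : set (caratheodory_type mu)).
Proof. exact: (measurable_hole muA). Qed.

Definition hole_mass v := fine (\int[measure_of mu]_(y in hole por v) (g y `^ p))%E.

Lemma hole_massE v :
  (\int[measure_of mu]_(y in hole por v) (g y `^ p) = (hole_mass v)%:E)%E.
Proof.
rewrite fineK// ge0_fin_numE; last by apply: integral_ge0 => y _; exact: h0.
by apply: le_lt_trans Ioo; apply: ge0_subset_integral => // y _; exact: h0.
Qed.

Lemma hole_mass_ge0 v : 0 <= hole_mass v.
Proof. by rewrite -lee_fin -hole_massE; apply: integral_ge0 => y _; exact: h0. Qed.

(** An upper bound for the mean of g^p over the hole, with the measure of the hole replaced by its
    lower bound. *)
Let G v := cW^-1 * hole_mass v / rr v.1 `^ Q.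

Let G0 v : 0 <= G v.
Proof. by rewrite !mulr_ge0 ?invr_ge0 ?hole_mass_ge0 ?powR_ge0// ltW. Qed.

Let hole_avg v : fine_level (T := T) v.1 ->
  (\int[measure_of mu]_(y in hole por v) h y <= (G v)%:E * mu (hole por v))%E.
Proof.
move=> fv; rewrite hole_massE; apply: (@le_trans _ _ ((G v)%:E * (cW * rr v.1 `^ Q)%:E)%E).
  rewrite -EFinM lee_fin /G le_eqVlt; apply/orP; left; apply/eqP.
  by field; rewrite !gt_eqF ?powR_gt0.
by apply: lee_wpmul2l (HW fv); rewrite lee_fin.
Qed.

(** The typical oscillation of [f] on the hole: radius times the p-mean of the gradient. *)
Definition osc v := rr v.1 * G v `^ p^-1.

Lemma osc_ge0 v : 0 <= osc v.
Proof. by rewrite mulr_ge0 ?powR_ge0. Qed.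

Lemma osc_powR v : osc v `^ p = cW^-1 * (rr v.1 `^ (p - Q) * hole_mass v).
Proof.
rewrite /osc powRM ?powR_ge0// -powRrM mulVf// powRr1//.
rewrite powRD ?(gt_eqF (rr_gt0 _)) ?implybT// powRN /G; ring.
Qed.

Lemma hole_bad v t : fine_level (T := T) v.1 -> 0 < t ->
  (mu (hole por v `&` [set y | ((t * G v)%:E < h y)%E]) <= t^-1%:E * mu (hole por v))%E.
Proof.
move=> fv t0; apply: (@markov_strict _ _ _ (measure_of mu)) => //.
- by rewrite -ge0_fin_numE ?outer_measure_ge0// (hole_fin_num muA).
- exact: measurable_funS mh.
- exact: hole_avg.
Qed.

Let g_le v y t : 0 <= t -> (h y <= (t * G v)%:E)%E ->
  (g y <= (t `^ p^-1 * (osc v / rr v.1))%:E)%E.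
Proof.
move=> t0 hy.
have -> : osc v / rr v.1 = G v `^ p^-1.
  by rewrite /osc mulrAC mulfV ?mul1r// gt_eqF.
rewrite -powRM// -poweR_EFin; apply: lee_poweRV => //.
by rewrite lee_fin mulr_ge0.
Qed.

#[local] Opaque osc hole_mass.

Let goodset v := [set y | hole por v y /\ (h y <= (2 * G v)%:E)%E].

(** A point of the hole where g^p is at most twice its mean; it exists because the other points fill
    at most half of the hole. The value of [f] there replaces an average of [f], which need not
    exist for p < 1. *)
Definition good v : Z := xget point (goodset v).

Let goodP v : fine_level (T := T) v.1 -> goodset v (good v).
Proof.
move=> fv; apply: xgetPex; apply: contrapT => H.
have := hole_bad fv (ltr0Sn _ 1).
rewrite (_ : _ `&` _ = hole por v); last first.
  apply/seteqP; split=> [y []//|y hy]; split=> //=; rewrite ltNge; apply/negP => hh.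
  by apply: H; exists y.
have hf := hole_fin_num muA por v.
have : (0 < mu (hole por v))%E by apply: (ball_gt0 muA); rewrite mulr_gt0 ?hole_ratio_gt0.
rewrite -(fineK hf) -EFinM lte_fin lee_fin; lra.
Qed.

Local Notation kap := ((2 : R) `^ p^-1).
Let kap0 : 0 < kap. Proof. by rewrite powR_gt0. Qed.

Let good_g v : fine_level (T := T) v.1 -> (g (good v) <= (kap * (osc v / rr v.1))%:E)%E.
Proof. by move=> /goodP[_]; apply: g_le. Qed.

Lemma good_near v : fine_level (T := T) v.1 -> mdist (good v) (i v.2) < rr v.1 / 8.
Proof. by move=> fv; apply: hole_near => //; exact: (goodP fv).1. Qed.

Let f_diff y z (a b : R) : (g y <= a%:E)%E -> (g z <= b%:E)%E ->
  normc (f y - f z) <= mdist y z * (a + b).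
Proof.
move=> ga gb; rewrite -lee_fin; apply: le_trans (fg y z) _.
by rewrite EFinM; apply: lee_wpmul2l; rewrite ?lee_fin ?mdist_ge0// EFinD leeD.
Qed.

Let good_dist v w : fine_level (T := T) v.1 -> fine_level (T := T) w.1 ->
  mdist (good v) (good w) <= rr v.1 / 8 + mdist v.2 w.2 + rr w.1 / 8.
Proof.
move=> /good_near dv /good_near dw; rewrite -iso.
have t1 := metric_triangle (good v) (i v.2) (good w).
have := metric_triangle (i v.2) (i w.2) (good w).
rewrite (metric_sym (i w.2) (good w)) => t2.
apply: le_trans t1 _; rewrite -addrA; apply: lerD; first exact: ltW.
by apply: le_trans t2 _; apply: lerD => //; exact: ltW.
Qed.

Definition sample v := f (good v).

Lemma sample_diff v w : fine_level (T := T) v.1 -> v.1 <= w.1 -> w.1 <= v.1 + 1 ->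
  mdist (good v) (good w) <= 6 * rr v.1 ->
  normc (sample v - sample w) <= 12 * kap * (osc v + osc w).
Proof.
move=> fv vw wv d; have fw := fine_level_le vw fv.
have gv := good_g fv; have gw := good_g fw.
move: (kap) kap0 gv gw => k k0 gv gw.
apply: le_trans (f_diff gv gw) _.
have rv := @rr_gt0 R v.1; have rw := @rr_gt0 R w.1.
have r2 : rr v.1 <= 2 * rr w.1 :> R.
  have : rr (v.1 + 1) <= rr w.1 :> R by exact: ler_rr.
  rewrite rrS; lra.
have ov := osc_ge0 v; have ow := osc_ge0 w.
apply: (@le_trans _ _ (6 * rr v.1 * (k * (osc v / rr v.1) + k * (osc w / rr w.1)))).
  have A1 := mulr_ge0 (ltW k0) (divr_ge0 ov (ltW rv)).
  have A2 := mulr_ge0 (ltW k0) (divr_ge0 ow (ltW rw)).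
  exact: (ler_wpM2r (addr_ge0 A1 A2) d).
have E : rr v.1 * (osc w / rr w.1) <= 2 * osc w.
  rewrite mulrCA -[leRHS]mulrC ler_wpM2l// ler_pdivrMr//.
move: (osc v) (osc w) (rr v.1) (rr w.1) ov ow rv rw r2 E => a b r r' a0 b0 r0 r'0 _ E.
have -> : 6 * r * (k * (a / r) + k * (b / r')) = 6 * k * (a + r * (b / r')).
  by field; rewrite !gt_eqF.
have : 6 * k * (a + r * (b / r')) <= 6 * k * (a + 2 * b).
  by rewrite ler_wpM2l ?lerD2l// mulr_ge0// ltW.
have := mulr_ge0 (ltW k0) a0; have := mulr_ge0 (ltW k0) b0; lra.
Qed.

Let vn n x := (n, nearest cX n x).

(** Cells of one level are disjoint, so this is the sum of [osc] over the vertices that own [x] at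
    the fine levels from [k] on. *)
Definition osc_tail (k : int) x : \bar R :=
  \esum_(w in [set w | fvertex X w /\ k <= w.1]) (osc w * \1_(cell cX w) x)%:E.

Lemma osc_tail_sum k x N : fine_level (T := T) k ->
  ((\sum_(j < N) osc (vn (k + j%:Z) x))%:E <= osc_tail k x)%E.
Proof.
move=> fk; apply: esum_ge.
exists [set vn (k + j%:Z) x | j in `I_N].
  split; first by apply: finite_image; exact: finite_II.
  move=> _ [j _ <-]; split; last by rewrite /= lerDl.
  split; first exact: net_nearest.
  by apply: fine_level_le fk; rewrite lerDl.
rewrite (reindex_fsbig (fun j : nat => vn (k + j%:Z) x) `I_N)/=; last first.
  split; [by move=> j jN; exists j|by move=> j l _ _ [/addrI[]]|by move=> _ [j jN <-]; exists j].
rewrite -sumEFin -fsbig_ord; apply: lee_sum => j _.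
by rewrite lee_fin indicE mem_set// mulr1.
Qed.

(** Successive samples differ by a multiple of the two values of [osc], which are summable, so they
    converge; each value is used twice, hence 24 = 2 * 12. Within one hole, off a small fraction,
    [f] differs from the sample by a multiple of [osc], which tends to 0 as the term of a convergent
    series. *)
Lemma trace_lim_tail k x (B : R) : fine_level (T := T) k -> (osc_tail k x <= B%:E)%E ->
  exists l, [/\ trace_lim mu por cX f x l, normc (l - sample (vn k x)) <= 24 * kap * B &
    forall e, 0 < e -> exists N : nat, forall j, (N <= j)%N ->
      normc (sample (vn (k + j%:Z) x) - l) < e].
Proof.
move=> fk HB; pose b j := osc (vn (k + j%:Z) x).
move: (kap) kap0 good_g sample_diff => K K0 good_gK sample_diffK.
have b0 j : 0 <= b j by exact: osc_ge0.
have bB N : \sum_(j < N) b j <= B by rewrite -lee_fin; apply: le_trans HB; exact: osc_tail_sum.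
have fj (j : nat) : fine_level (T := T) (k + j%:Z).
  by apply: fine_level_le fk; rewrite lerDl.
have [||l [al lD]] := @complex_telescope R (fun j => sample (vn (k + j%:Z) x))
    (fun j => 12 * K * (b j + b j.+1)) (24 * K * B).
- move=> j; rewrite normc_sub.
  have E : k + j.+1%:Z = k + j%:Z + 1 by rewrite -addn1 PoszD addrA.
  apply: (sample_diffK (vn (k + j%:Z) x) (vn (k + j.+1%:Z) x) (fj j)) => /=.
  + by rewrite E lerDl.
  + by rewrite E.
  + have := @good_dist (vn (k + j%:Z) x) (vn (k + j.+1%:Z) x) (fj j) (fj j.+1).
    move=> /le_trans; apply; rewrite /= E rrS.
    have d3 := mdist_nearest cX (k + j%:Z) x; have d4 := mdist_nearest cX (k + j%:Z + 1) x.
    have := metric_triangle (nearest cX (k + j%:Z) x) x (nearest cX (k + j%:Z + 1) x).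
    rewrite (metric_sym (nearest cX (k + j%:Z) x) x).
    have := @rr_gt0 R (k + j%:Z); rewrite rrS in d4.
    move: (rr _) (mdist _ _) (mdist _ _) (mdist _ _) d3 d4 => r a1 a2 a3; lra.
- move=> N; rewrite -mulr_sumr big_split/=.
  have s1 := bB N; have s2 := bB N.+1; rewrite big_ord_recl in s2.
  have s2' : \sum_(j < N) b j.+1 <= B.
    by apply: le_trans s2; rewrite lerDr.
  have -> : 24 * K * B = 12 * K * (B + B) by ring.
  exact: (ler_wpM2l (mulr_ge0 (ler0n _ _) (ltW K0)) (lerD s1 s2')).
rewrite addr0 in lD; exists l; split=> // e e0.
(* By [hole_bad] with threshold 1/e, off a fraction [e] of the hole the gradient is at most kap'
   times [osc] divided by the radius. *)
pose kap' := e^-1 `^ p^-1; have kap'0 : 0 <= kap' by exact: powR_ge0.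
have [N1 HN1] := al (e / 2) (divr_gt0 e0 (ltr0Sn _ 1)).
have [N2 HN2] : exists N : nat, forall j, (N <= j)%N -> (kap' + K) * b j < e.
  have cb : cvgn (series b).
    apply: nondecreasing_is_cvgn.
      by apply/nondecreasing_seqP => n; rewrite /series/= big_nat_recr//= lerDl.
    by exists B => _ [n _ <-]; rewrite /series/= big_mkord.
  have k0 : 0 < kap' + K by rewrite ltr_wpDl.
  have /cvgrPdist_lt /(_ _ (divr_gt0 e0 k0))[N _ HN] := cvg_series_cvg_0 cb.
  exists N => j Nj; have /= := HN j Nj; rewrite sub0r normrN ger0_norm// => bj.
  by rewrite mulrC -ltr_pdivlMr.
exists (k + (maxn N1 N2)%:Z) => n kn.
have [j nE] : exists j : nat, n = k + j%:Z by apply: int_ge_nat; apply: le_trans kn; rewrite lerDl.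
have [j1 j2] : (N1 <= j)%N /\ (N2 <= j)%N.
  by move: kn; rewrite nE lerD2l lez_nat geq_max => /andP[].
have fn := fj j; rewrite -nE in fn.
have := hole_bad (fn : fine_level (T := T) (vn n x).1) (_ : 0 < e^-1).
rewrite invr_gt0 => /(_ e0); rewrite invrK; apply: le_trans.
apply: le_outer_measure => y [hy /=] ey; split=> //=.
rewrite ltNge; apply/negP => hh; move: ey; apply/negP; rewrite -leNgt.
have gy := g_le (_ : 0 <= e^-1) hh; rewrite invr_ge0 in gy.
have {}gy := gy (ltW e0).
have d := f_diff gy (good_gK (vn n x) fn).
have hn := hole_near (v := vn n x) iso fn hy.
have gn := good_near (fn : fine_level (T := T) (vn n x).1).
have tri := metric_triangle y (i (vn n x).2) (good (vn n x)).
rewrite (metric_sym (i (vn n x).2) (good _)) in tri.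
have rn := @rr_gt0 R n; have rE : (vn n x).1 = n by [].
have dy : mdist y (good (vn n x)) <= rr n / 4 by rewrite rE in hn gn; lra.
have S0 : 0 <= kap' * (osc (vn n x) / rr n) + K * (osc (vn n x) / rr n).
  by rewrite addr_ge0// mulr_ge0 ?divr_ge0 ?osc_ge0// ltW.
have d1 : normc (f y - sample (vn n x)) <= (kap' + K) * osc (vn n x) / 4.
  apply: le_trans d _.
  apply: le_trans (ler_wpM2r S0 dy) _.
  by rewrite le_eqVlt; apply/orP; left; apply/eqP; field; rewrite gt_eqF.
have := HN2 j j2; rewrite /b -nE => d2.
have := HN1 j j1; rewrite -nE => d3.
apply: le_trans (normc_triangle (sample (vn n x)) (f y) l) _.
apply: le_trans (lerD d1 (ltW d3)) _.
by move: ((kap' + K) * osc (vn n x)) d2 e0 => a; lra.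
Qed.

Let arith1 (r a : R) : 0 < r -> a <= 3 * r + r / 2 -> r / 8 + a + r / 8 <= 6 * r.
Proof. lra. Qed.

Let arith2 (K a b B : R) : 0 < K -> 0 <= a -> b <= B -> 0 <= B ->
  24 * K * B + 12 * K * (a + b) <= 36 * K * (B + a).
Proof.
move=> K0 a0 bB B0; have := mulr_ge0 (ltW K0) B0; have := mulr_ge0 (ltW K0) a0.
have := ler_wpM2l (ltW K0) bB; lra.
Qed.

(** The vertex [e.1] need not own [x]. One further comparison of samples at the same level costs 12,
    which gives 36 = 24 + 12 and the extra term [osc e.1]. *)
Lemma trace_edge e x (B : R) : edge X e -> fine_level (T := T) e.1.1 -> eball e x ->
  (osc_tail e.1.1 x <= B%:E)%E ->
  normc (trace mu por cX f x - sample e.1) <= 36 * kap * (B + osc e.1).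
Proof.
case: e => [[k xi] e2] ee /= fk ex HB.
have := trace_lim_tail fk HB.
move: (kap) kap0 sample_diff => K K0 sample_diffK [l [fl lB _]].
rewrite (traceE muA fl).
have /= dx := edge_near_eball ee ex.
have d3 := mdist_nearest cX k x.
have k1 : k <= k + 1 by rewrite lerDl.
have := sample_diffK (k, xi) (vn k x) fk (lexx k) k1 => /= H.
have D : mdist (good (k, xi)) (good (vn k x)) <= 6 * rr k.
  apply: le_trans (good_dist (v := (k, xi)) (w := vn k x) fk fk) _ => /=.
  exact: arith1 (@rr_gt0 R k)
    (le_trans (metric_triangle xi x (nearest cX k x)) (lerD (ltW dx) (ltW d3))).
have {}H := H D.
have oB : osc (vn k x) <= B.
  have := osc_tail_sum x 1 fk; rewrite big_ord1 addr0 => h1.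
  by rewrite -lee_fin; apply: le_trans h1 HB.
have B0 : 0 <= B by apply: le_trans oB; exact: osc_ge0.
apply: le_trans (normc_triangle (sample (vn k x)) _ _) _.
rewrite normc_sub in H; apply: le_trans (lerD lB H) _.
exact: arith2 K0 (osc_ge0 (k, xi)) oB B0.
Qed.

End trace_estimates.

(** * Weighted sums over levels *)

Section geometric_levels.
Context {R : realType}.

Lemma rr_powRE (n : int) (a : R) : rr n `^ a = (2 `^ (- a)) ^ n.
Proof.
rewrite -[RHS]powR_intmul ?powR_ge0// -powRrM /rr -powR_intmul// -powRrM.
by congr (_ `^ _); rewrite mulrNz mulrC !mulrN mulNr.
Qed.

Lemma geometric_down (a : R) (j : int) : 0 < a ->
  (\esum_(k in [set k : int | (k <= j)%R]) (rr (j - k) `^ a)%:E <= (ladder_const a)%:E)%E.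
Proof.
move=> a0; under eq_esum do rewrite rr_powRE.
by apply: esum_geometric_le; rewrite powR_ge0 two_powRN_lt1.
Qed.

Lemma geometric_up (a : R) (k : int) : 0 < a ->
  (\esum_(j in [set j : int | (k <= j)%R]) (rr (j - k) `^ a)%:E <= (ladder_const a)%:E)%E.
Proof.
move=> a0; rewrite (reindex_esum [set l : int | (l <= - k)%R] _ (fun l => - l)); last first.
  split.
  - by move=> l /=; rewrite lerNr.
  - by move=> l l' _ _ /oppr_inj.
  - by move=> j /= kj; exists (- j); rewrite ?opprK//= lerN2.
apply: le_trans (geometric_down (- k) a0).
by apply: le_esum => l _; rewrite addrC.
Qed.

End geometric_levels.

Section weighted_sum.
Context {R : realType} (p s Q : R).
Hypothesis p0 : 0 < p.
Hypothesis s0 : 0 < s.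
Hypothesis psQ : Q < s * p + p.
Hypothesis pQs : Q - s < p.

(** The decay exponent that makes the sums over levels converge. For p <= 1 it is the full slack in
    [psQ]. For p > 1 it is half of the slack in [pQs]; the other half is [eps] times p, spent on
    Young's inequality. *)
Definition gain : R := if p <= 1 then s * p + p - Q else (s + p - Q) / 2.

Lemma gain_gt0 : 0 < gain.
Proof.
rewrite /gain; case: ifP => _; first by move: psQ; rewrite -subr_gt0 => h; lra.
by rewrite divr_gt0//; move: pQs; lra.
Qed.

Let eps : R := (s + p - Q) / (2 * p).
Let eps0 : 0 < eps. Proof. rewrite divr_gt0 ?mulr_gt0//; move: pQs; lra. Qed.

Definition weight_const : R := if p <= 1 then 1 else (ladder_const eps + 1) `^ p.

Variables (I : choiceType) (D : set I) (a m : I -> R) (lev : I -> int) (k : int) (V : R).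
Hypothesis a0 : forall i, 0 <= a i.
Hypothesis m0 : forall i, 0 <= m i.
Hypothesis V0 : 0 < V.
Hypothesis kD : forall i, D i -> k <= lev i.
Hypothesis mV : forall i, D i -> m i <= V * rr (lev i - k) `^ s.
Hypothesis levV : forall j, (\esum_(i in [set i | D i /\ lev i = j]) (m i)%:E <= V%:E)%E.

Let q i : R := rr (lev i - k).
Let q0 i : 0 < q i. Proof. exact: rr_gt0. Qed.
Let q1 i : D i -> q i <= 1.
Proof.
move=> /kD kl; have -> : (1 : R) = rr 0 by rewrite /rr oppr0.
by apply: ler_rr; rewrite subr_ge0.
Qed.

(** Subadditivity of the p-th power reduces to single terms, where the bound [mV] on masses gives
    exactly the exponent s p = [gain] + Q - p. *)
Let sum_small : p <= 1 -> ((\esum_(i in D) (a i * m i)%:E) `^ p <=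
  (V `^ p)%:E * \esum_(i in D) (q i `^ (gain + Q - p) * a i `^ p)%:E)%E.
Proof.
move=> p1; have pp : 0 < p <= 1 by rewrite p0.
have am0 i : (0 <= (a i * m i)%:E)%E by rewrite lee_fin mulr_ge0.
apply: le_trans (esum_poweR_le1 D pp am0) _.
rewrite -esumZl ?powR_ge0//; last by move=> i; rewrite lee_fin mulr_ge0 ?powR_ge0.
apply: le_esum => i Di; rewrite poweR_EFin -EFinM lee_fin powRM//.
have -> : gain + Q - p = s * p by rewrite /gain p1; ring.
rewrite mulrA [leRHS]mulrC ler_wpM2l ?powR_ge0// powRrM -powRM ?powR_ge0 ?(ltW V0)//.
by apply: ge0_ler_powR; rewrite ?nnegrE ?(ltW p0)// ?mulr_ge0 ?powR_ge0 ?(ltW V0)//; exact: mV.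
Qed.

Let young (t b : R) : 1 < p -> 0 < t -> 0 <= b -> b <= t + t `^ (1 - p) * b `^ p.
Proof.
move=> p1 t0 b0; have [bt|tb] := leP b t.
  by apply: le_trans bt _; rewrite lerDl mulr_ge0 ?powR_ge0.
have b1 : 0 < b by exact: lt_trans tb.
apply: (@le_trans _ _ (t `^ (1 - p) * b `^ p)); last by rewrite lerDr ltW.
rewrite -[X in X <= _]powRr1// -{1}(subrK p 1) powRD ?(gt_eqF b1) ?implybT//.
rewrite ler_wpM2r ?powR_ge0// -[1 - p]opprB !powRN lef_pV2 ?posrE ?powR_gt0//.
by apply: ge0_ler_powR; rewrite ?nnegrE ?ltW// subr_gt0.
Qed.

(** Young's inequality at the threshold t q^eps splits each term. The first parts are summed with
    the total mass per level and a geometric series, the second with the bound [mV] on single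
    masses. With t^p equal to the sum on the right, both parts are multiples of V t. *)
Let sum_large : 1 < p -> ((\esum_(i in D) (a i * m i)%:E) `^ p <=
  ((ladder_const eps + 1) `^ p * V `^ p)%:E *
  \esum_(i in D) (q i `^ (gain + Q - p) * a i `^ p)%:E)%E.
Proof.
move=> p1; have pn0 : p != 0 by rewrite gt_eqF.
set B := \esum_(i in D) (q i `^ _ * _)%:E.
have B0 : (0 <= B)%E by apply: esum_ge0 => i _; rewrite lee_fin mulr_ge0 ?powR_ge0.
have L0 : 0 < ladder_const eps by exact: ladder_const_gt0.
have C0 : 0 < (ladder_const eps + 1) `^ p * V `^ p.
  by rewrite mulr_gt0 ?powR_gt0//; lra.
have S0 : (0 <= \esum_(i in D) (a i * m i)%:E)%E.
  by apply: esum_ge0 => i _; rewrite lee_fin mulr_ge0.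
have [Boo|Bfin] := eqVneq B +oo%E; first by rewrite Boo gt0_muley ?lte_fin// leey.
have Bf : B \is a fin_num by rewrite ge0_fin_numE// ltey.
have gE : gain + Q - p = s - eps * p.
  by rewrite /gain /eps ifF; [field|apply/negbTE; rewrite -ltNge].
have term i : D i -> ((q i `^ (gain + Q - p) * a i `^ p)%:E <= B)%E.
  move=> Di; apply: (esum_term (a := fun i => (q i `^ (gain + Q - p) * a i `^ p)%:E) Di).
  by rewrite lee_fin mulr_ge0 ?powR_ge0.
have [B00|Bn0] := eqVneq B 0%E.
  rewrite esum1; first by rewrite poweR0r// B00 mule0.
  move=> i Di; have := term i Di; rewrite B00 lee_fin => h.
  have : q i `^ (gain + Q - p) * a i `^ p == 0.
    by rewrite eq_le h mulr_ge0 ?powR_ge0.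
  rewrite mulf_eq0 gt_eqF ?powR_gt0//= powR_eq0 => /andP[/eqP -> _].
  by rewrite mul0r.
pose b := fine B; have BE : B = b%:E by rewrite fineK.
have b0 : 0 < b by rewrite -lte_fin -BE lt_neqAle eq_sym Bn0.
pose t := b `^ p^-1; have t0 : 0 < t by rewrite powR_gt0.
have tp : t `^ p = b by rewrite /t -powRrM mulVf// powRr1// ltW.
suff : (\esum_(i in D) (a i * m i)%:E <= ((ladder_const eps + 1) * V * t)%:E)%E.
  move=> /(le_poweR2 (ltW p0) S0) /le_trans; apply.
  rewrite poweR_EFin BE -EFinM lee_fin.
  have L1 : 0 <= ladder_const eps + 1 by lra.
  by rewrite powRM ?(mulr_ge0 L1) ?(ltW V0) ?(ltW t0)// powRM ?(ltW V0)// tp.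
have ai i : D i -> a i * m i <=
    t * (q i `^ eps * m i) + t `^ (1 - p) * V * (q i `^ (gain + Q - p) * a i `^ p).
  move=> Di; have qi := q0 i; have qe : 0 < q i `^ eps by rewrite powR_gt0.
  have y := young p1 t0 (a0 i : 0 <= a i).
  have {}y := young p1 (mulr_gt0 t0 qe) (a0 i).
  apply: le_trans (ler_wpM2r (m0 i) y) _.
  rewrite mulrDl mulrA lerD2l powRM ?(ltW t0) ?(ltW qe)//.
  rewrite -!mulrA ler_wpM2l ?powR_ge0// gE.
  apply: (@le_trans _ _ (q i `^ (- (eps * p)) * (a i `^ p * m i))).
    rewrite -powRrM ler_wpM2r ?mulr_ge0 ?powR_ge0//.
    have -> : eps * (1 - p) = eps + - (eps * p) by ring.
    rewrite powRD ?(gt_eqF qi) ?implybT// ler_piMl ?powR_ge0//.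
    have -> : 1 = 1 `^ eps :> R by rewrite powR1.
    by apply: ge0_ler_powR; rewrite ?nnegrE ?(ltW qi) ?(ltW eps0)// q1.
  rewrite [q i `^ (s - eps * p)]powRD ?(gt_eqF qi) ?implybT//.
  have := mV Di; rewrite -/(q i) => h.
  have := ler_wpM2l (mulr_ge0 (powR_ge0 (q i) (- (eps * p))) (powR_ge0 (a i) p)) h.
  by rewrite -!mulrA => /le_trans; apply; rewrite le_eqVlt; apply/orP; left; apply/eqP; ring.
apply: (@le_trans _ _ (\esum_(i in D) (t%:E * (q i `^ eps * m i)%:E +
    (t `^ (1 - p) * V)%:E * (q i `^ (gain + Q - p) * a i `^ p)%:E)%E)).
  by apply: le_esum => i Di; rewrite -!EFinM -EFinD lee_fin; exact: ai.
rewrite esumD; last 2 first.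
- by move=> i _; rewrite -EFinM lee_fin !mulr_ge0 ?powR_ge0// ltW.
- by move=> i _; rewrite -EFinM lee_fin !mulr_ge0 ?powR_ge0// ltW.
rewrite esumZl ?(ltW t0)//; last by move=> i; rewrite lee_fin mulr_ge0 ?powR_ge0.
rewrite esumZl ?mulr_ge0 ?powR_ge0 ?(ltW V0)//; last first.
  by move=> i; rewrite lee_fin mulr_ge0 ?powR_ge0.
rewrite -/B BE.
have W : (\esum_(i in D) (q i `^ eps * m i)%:E <= (V * ladder_const eps)%:E)%E.
  rewrite (esum_fibre lev); last by move=> i _; rewrite lee_fin mulr_ge0 ?powR_ge0.
  rewrite EFinM; apply: le_trans (lee_wpmul2l _ (geometric_up k eps0)); last first.
    by rewrite lee_fin ltW.
  rewrite -esumZl ?(ltW V0)//; last by move=> j; rewrite lee_fin powR_ge0.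
  rewrite [leRHS]esum_mkcond; apply: le_esum => j _.
  case: ifPn; rewrite ?inE ?notin_setE /= => kj; last first.
    by rewrite esum1// => i [Di lj]; case: kj; rewrite -lj; exact: kD.
  rewrite muleC; apply: le_trans (lee_wpmul2l _ (levV j)); last by rewrite lee_fin powR_ge0.
  rewrite -esumZl ?powR_ge0//.
  by apply: le_esum => i [Di <-]; rewrite EFinM.
apply: (@le_trans _ _ (t%:E * (V * ladder_const eps)%:E + (t `^ (1 - p) * V)%:E * b%:E)%E).
  by rewrite leeD2r// lee_wpmul2l// lee_fin ltW.
rewrite -!EFinM -EFinD lee_fin.
have -> : t `^ (1 - p) * V * b = V * t.
  rewrite -{1}tp mulrAC -powRD ?(gt_eqF t0) ?implybT// subrK powRr1 ?ltW//.
  by rewrite mulrC.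
by rewrite le_eqVlt; apply/orP; left; apply/eqP; ring.
Qed.

Lemma weighted_sum : ((\esum_(i in D) (a i * m i)%:E) `^ p <=
  (weight_const * V `^ p)%:E *
  \esum_(i in D) (rr (lev i - k) `^ (gain + Q - p) * a i `^ p)%:E)%E.
Proof.
rewrite /weight_const; case: ifPn => [p1|]; first by rewrite mul1r; exact: sum_small.
by rewrite -ltNge => p1; exact: sum_large.
Qed.

End weighted_sum.

(** * Energy of the trace *)

Section averages.
Context {R : realType} {T : pmetricType R}.
Variables (nu : {outer_measure set T -> \bar R}) (s : R).
Hypothesis nuA : ahlfors_regular s nu.
Implicit Types (v : int * T).

Lemma measurable_vball v : measurable (vball v : set (caratheodory_type nu)).
Proof. by apply: measurable_mball; exact: nuA.1.1. Qed.

Lemma vball_fin_num v : nu (vball v) \is a fin_num.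
Proof. by apply: ball_fin_num nuA _ _ _; exact: exprz_gt0. Qed.

Lemma fine_vball_gt0 v : 0 < fine (nu (vball v)).
Proof.
rewrite fine_gt0// (ball_gt0 nuA) ?exprz_gt0//=.
by have := vball_fin_num v; rewrite ge0_fin_numE.
Qed.

Lemma vaverage_Re f v : complex.Re (vaverage nu f v) =
  (fine (nu (vball v)))^-1 * \int[measure_of nu]_(x in vball v) complex.Re (f x).
Proof. by rewrite /vaverage /cintegral -fmorphV /= mul0r subr0. Qed.

Lemma vaverage_Im f v : complex.Im (vaverage nu f v) =
  (fine (nu (vball v)))^-1 * \int[measure_of nu]_(x in vball v) complex.Im (f x).
Proof. by rewrite /vaverage /cintegral -fmorphV /= mul0r addr0. Qed.

Let integrable_vball_cst v (c : R) :
  (measure_of nu).-integrable (vball v) (EFin \o cst c).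
Proof.
apply/integrableP; split; first by apply/measurable_EFinP.
rewrite /= integral_cst; last exact: measurable_vball.
by rewrite -ge0_fin_numE ?mule_ge0// fin_numM//; exact: vball_fin_num.
Qed.

Lemma average_dev v (h : T -> R) (c : R) (H : T -> \bar R) :
  (measure_of nu).-integrable (vball v) (EFin \o h) ->
  measurable_fun [set: caratheodory_type nu] H ->
  (forall x, (0 <= H x)%E) ->
  (forall x, vball v x -> (`|h x - c|%:E <= H x)%E) ->
  (`|(fine (nu (vball v)))^-1 * \int[measure_of nu]_(x in vball v) h x - c|%:E <=
    (fine (nu (vball v)))^-1%:E * \int[measure_of nu]_(x in vball v) H x)%E.
Proof.
move=> ih mH H0 hH; have nv := fine_vball_gt0 v; have mv := measurable_vball v.
have ic := integrable_vball_cst v c.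
have -> : (fine (nu (vball v)))^-1 * \int[measure_of nu]_(x in vball v) h x - c =
    (fine (nu (vball v)))^-1 * \int[measure_of nu]_(x in vball v) (h x - c).
  rewrite (RintegralB mv ih ic) (Rintegral_cst _ mv) mulrBr; congr (_ - _).
  by rewrite mulrCA mulVf ?mulr1// gt_eqF.
rewrite normrM gtr0_norm ?invr_gt0// EFinM; apply: lee_wpmul2l.
  by rewrite lee_fin invr_ge0 ltW.
have ihc : (measure_of nu).-integrable (vball v) (EFin \o (fun x => h x - c)).
  exact: (integrableB mv ih ic).
rewrite (EFin_normr_Rintegral mv ihc).
apply: le_trans (le_abse_integral _ mv _) _; first by case/integrableP: ihc.
apply: ge0_le_integral => //.
  by apply: measurableT_comp => //; case/integrableP: ihc.
exact: measurable_funS mH.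
Qed.

(** Real and imaginary parts are averaged separately, at the cost of a factor 2. *)
Lemma vaverage_dev f v (c : R[i]) (H : T -> \bar R) : cintegrable nu (vball v) f ->
  measurable_fun [set: caratheodory_type nu] H -> (forall x, (0 <= H x)%E) ->
  (forall x, vball v x -> ((normc (f x - c))%:E <= H x)%E) ->
  ((normc (vaverage nu f v - c))%:E <=
    (2 * (fine (nu (vball v)))^-1)%:E * \int[measure_of nu]_(x in vball v) H x)%E.
Proof.
move=> [iRe iIm] mH H0 fH.
have dRe := average_dev (c := complex.Re c) iRe mH H0.
have dIm := average_dev (c := complex.Im c) iIm mH H0.
have J0 : (0 <= \int[measure_of nu]_(x in vball v) H x)%E by exact: integral_ge0.
apply: (@le_trans _ _ (`|complex.Re (vaverage nu f v) - complex.Re c|%:E +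
    `|complex.Im (vaverage nu f v) - complex.Im c|%:E)%E).
  by rewrite -EFinD lee_fin -ReB -ImB; exact: normc_ReIm.
rewrite mulrDl mul1r EFinD ge0_muleDl ?lee_fin ?invr_ge0 ?(ltW (fine_vball_gt0 v))//.
rewrite vaverage_Re vaverage_Im; apply: leeD.
  apply: dRe => x vx; apply: le_trans (fH x vx); rewrite lee_fin -ReB; exact: normc_Re.
apply: dIm => x vx; apply: le_trans (fH x vx); rewrite lee_fin -ImB; exact: normc_Im.
Qed.

End averages.

Section cell_sums.
Context {R : realType} {T : pmetricType R}.
Variables (nu : {outer_measure set T -> \bar R}) (s : R).
Hypothesis nuA : ahlfors_regular s nu.
Variable X : hyperbolic_filling T.
Hypothesis cX : net_count X.
Variables (p Q : R).
Hypothesis p0 : 0 < p.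
Hypothesis pQs : Q - s < p.
Implicit Types (v w : int * T) (x : T) (B : set T).

Definition cell_tail (a : int * T -> R) (k : int) x : \bar R :=
  \esum_(w in [set w | fvertex X w /\ k <= w.1]) (a w * \1_(cell cX w) x)%:E.

Let nur : borel_regular nu. Proof. exact: nuA.1.1. Qed.

Let countable_tail k : countable [set w | fvertex X w /\ k <= w.1].
Proof. by apply: sub_countable (countable_fvertex cX); apply: subset_card_le => w []. Qed.

Let mcell w : fvertex X w -> measurable (cell cX w : set (caratheodory_type nu)).
Proof. by move=> [vw _]; exact: measurable_cell. Qed.

Section tail.
Variable a : int * T -> R.
Hypothesis a0 : forall w, 0 <= a w.

Lemma cell_tail_ge0 k x : (0 <= cell_tail a k x)%E.
Proof. by apply: esum_ge0 => w _; rewrite lee_fin mulr_ge0. Qed.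

Let mterm w : fvertex X w ->
  measurable_fun [set: caratheodory_type nu] (fun x => (a w * \1_(cell cX w) x)%:E).
Proof.
move=> fw; apply/measurable_EFinP; apply: measurable_funM => //.
by apply: measurable_indic; exact: mcell.
Qed.

Lemma measurable_cell_tail k :
  measurable_fun [set: caratheodory_type nu] (cell_tail a k).
Proof.
apply: emeasurable_esum => //; first by move=> w x; rewrite lee_fin mulr_ge0.
by move=> w [fw _]; exact: mterm.
Qed.

Let m B w : R := fine (nu (B `&` cell cX w)).

Let mfin B w : nu (B `&` cell cX w) \is a fin_num.
Proof.
rewrite ge0_fin_numE//; apply: le_lt_trans (_ : (nu (vball w) < +oo)%E).
  by apply: le_outer_measure => x [_ /cell_vball].
by rewrite -ge0_fin_numE//; exact: (vball_fin_num nuA).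
Qed.

Let m0 B w : 0 <= m B w. Proof. exact: fine_ge0. Qed.

Lemma cell_tail_integral B k : measurable (B : set (caratheodory_type nu)) ->
  (\int[measure_of nu]_(x in B) cell_tail a k x =
   \esum_(w in [set w | fvertex X w /\ (k <= w.1)%R]) (a w * m B w)%:E)%E.
Proof.
move=> mB; rewrite integral_esum//.
- apply: eq_esum => w [fw _]; under eq_integral do rewrite EFinM.
  rewrite ge0_integralZl_EFin ?integral_indic//; last 2 first.
  + exact: mcell.
  + by apply/measurable_EFinP; apply: measurable_indic; exact: mcell.
  by rewrite setIC EFinM /m fineK.
- by move=> w x; rewrite lee_fin mulr_ge0.
- by move=> w [fw _]; exact: measurable_funS (mterm fw).
Qed.

Let level_mass B (D : set (int * T)) j : measurable (B : set (caratheodory_type nu)) ->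
  D `<=` fvertex X -> (\esum_(w in [set w | D w /\ w.1 = j]) (m B w)%:E <= nu B)%E.
Proof.
move=> mB DX; have cD : countable [set w | D w /\ w.1 = j].
  by apply: sub_countable (countable_fvertex cX); apply: subset_card_le => w [/DX].
have mI w : [set w | D w /\ w.1 = j] w -> measurable_fun (B : set (caratheodory_type nu))
    ((fun x => (\1_(cell cX w) x)%:E) : caratheodory_type nu -> \bar R).
  move=> [/DX fw _]; apply/measurable_EFinP.
  by apply: measurable_indic; exact: mcell.
apply: (@le_trans _ _ (\int[measure_of nu]_(x in B)
    (\esum_(w in [set w | D w /\ w.1 = j]) (\1_(cell cX w) x)%:E))%E).
  rewrite (integral_esum (measure_of nu) cD mB)//.
  apply: le_esum => w [/DX fw _]; rewrite integral_indic//; last exact: mcell.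
  by rewrite setIC /m fineK.
rewrite -[leRHS]mul1e -(integral_cst (measure_of nu) mB 1%E).
apply: ge0_le_integral => //.
- by move=> x _; apply: esum_ge0.
- exact: emeasurable_esum.
- move=> x _; under eq_esum do rewrite -[X in X%:E]mul1r.
  rewrite esum_indic.
  apply: (@le_trans _ _ (1%:R%:E * 1)%E); last by rewrite mul1e.
  apply: at_most_esum => //; apply: at_most_subsingle.
  by move=> [n xi] [n' xi'] /= [[_ ->] c] [[_ ->] c']; rewrite (nu_cell_disjoint c c').
Qed.

(** The integral over [B] is the sum of [a w] times the mass of [B] in the cell of [w]. Cells of one
    level are disjoint, so these masses total at most [V] on each level, as [weighted_sum] asks. *)
Lemma cell_tail_powR B k V :
  measurable (B : set (caratheodory_type nu)) -> (nu B <= V%:E)%E -> 0 < V ->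
  (forall w, fvertex X w -> k <= w.1 ->
    (nu (cell cX w) <= (V * rr (w.1 - k) `^ s)%:E)%E) ->
  ((\int[measure_of nu]_(x in B) cell_tail a k x) `^ p <=
   (weight_const p s Q * V `^ p)%:E *
   \esum_(w in [set w | [/\ fvertex X w, (k <= w.1)%R & B `&` cell cX w !=set0]])
     (rr (w.1 - k) `^ (gain p s Q + Q - p) * a w `^ p)%:E)%E.
Proof.
move=> mB BV V0 cV; rewrite cell_tail_integral//.
set D := [set w | [/\ fvertex X w, _ & _]].
have -> : \esum_(w in [set w | fvertex X w /\ (k <= w.1)%R]) (a w * m B w)%:E =
    \esum_(w in D) (a w * m B w)%:E.
  have -> : D = [set w | fvertex X w /\ (k <= w.1)%R] `&` [set w | B `&` cell cX w !=set0].
    by apply/seteqP; split=> w; [case|case=> [[]]].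
  rewrite [RHS]esum_mkcondr; apply: eq_esum => w _; case: ifPn => //.
  rewrite notin_setE /= => /set0P/negP/negPn/eqP e.
  by rewrite /m e outer_measure0 mulr0.
apply: weighted_sum => //.
- by move=> w [].
- move=> w [fw kw _]; rewrite -lee_fin /m fineK//.
  by apply: le_trans (cV w fw kw); apply: le_outer_measure => x [].
- by move=> j; apply: le_trans BV; apply: level_mass => // w [].
Qed.

End tail.
End cell_sums.

Lemma poweR_add_le {R : realType} (p : R) (x y : \bar R) : 0 <= p -> (0 <= x)%E -> (0 <= y)%E ->
  ((x + y) `^ p <= (2 `^ p)%:E * (x `^ p + y `^ p))%E.
Proof.
move=> p0; wlog xy : x y / (x <= y)%E => [hw x0 y0|x0 y0].
  have [xy|/ltW yx] := leP x y; first exact: hw.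
  by rewrite addeC [X in (_ * X)%E]addeC; exact: hw.
apply: (@le_trans _ _ ((2%:E * y) `^ p)%E).
  apply: le_poweR2 => //; first exact: adde_ge0.
  by rewrite -[2]/(1 + 1 : R) EFinD ge0_muleDl ?mul1e// leeD2r.
rewrite poweRM ?lee_fin// poweR_EFin; apply: lee_wpmul2l; first by rewrite lee_fin powR_ge0.
by rewrite leeDr ?poweR_ge0.
Qed.

(** * Energy and integrability of functions controlled by tails *)

Section trace_energy.
Context {R : realType} {T : pmetricType R}.
Variables (nu : {outer_measure set T -> \bar R}) (s : R).
Hypothesis s0 : 0 < s.
Hypothesis nuA : ahlfors_regular s nu.
Hypothesis T2 : exists x y : T, x <> y.
Variable X : hyperbolic_filling T.
Hypothesis cX : net_count X.
Variables (p Q : R).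
Hypothesis p0 : 0 < p.
Hypothesis pQs : Q - s < p.
Hypothesis psQ : Q < s * p + p.
Implicit Types (v w : int * T) (x : T) (e : (int * T) * (int * T)) (a : int * T -> R).

Local Notation gam := (gain p s Q).

Definition below e w := e.1.1 <= w.1 /\ mdist w.2 e.1.2 < 6 * rr e.1.1.

(** Up to constants, the mean of the tail over the edge ball, plus the value at the coarser end that
    [trace_edge] produces. *)
Definition tail_mean a e : \bar R :=
  ((rr e.1.1 `^ (- s))%:E * \int[measure_of nu]_(x in eball e) cell_tail cX a e.1.1 x
    + (a e.1)%:E)%E.

Lemma edge_tail : exists2 C : R, 0 <= C & forall a, (forall w, 0 <= a w) ->
  forall e, edge X e -> fine_level (T := T) e.1.1 ->
  (tail_mean a e `^ p <= C%:E * \esum_(w in [set w | fvertex X w /\ below e w])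
      (rr (w.1 - e.1.1) `^ (gam + Q - p) * a w `^ p)%:E)%E.
Proof.
have [C C0 HC] := ahlfors_upper s0 nuA T2.
pose D := C * 4 `^ s; have D0 : 0 < D by rewrite mulr_gt0 ?powR_gt0.
pose W := weight_const p s Q * D `^ p.
have W0 : 0 <= W.
  rewrite mulr_ge0 ?powR_ge0// /weight_const; case: ifP => // _; exact: powR_ge0.
exists (2 `^ p * (W + 1)); first by rewrite mulr_ge0 ?powR_ge0// addr_ge0.
move=> a a0 e ee fe; set S := \esum_(w in _) _.
have rk := @rr_gt0 R e.1.1.
have t0 : (0 <= \int[measure_of nu]_(x in eball e) cell_tail cX a e.1.1 x)%E.
  by apply: integral_ge0 => x _; exact: cell_tail_ge0.
have eb : (nu (eball e) <= (D * rr e.1.1 `^ s)%:E)%E.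
  have r4 : 0 < 4 * rr e.1.1 :> R by rewrite mulr_gt0.
  rewrite /D -mulrA -(powRM _ (ler0n _ 4) (ltW rk)).
  apply: le_trans (HC e.1.2 _ r4).
  apply: le_outer_measure => x /(edge_near_eball ee); rewrite ballEmdist /= => h; lra.
have cb w : fvertex X w -> e.1.1 <= w.1 ->
    (nu (cell cX w) <= ((D * rr e.1.1 `^ s) * rr (w.1 - e.1.1) `^ s)%:E)%E.
  move=> _ _; apply: (@le_trans _ _ (C * rr w.1 `^ s)%:E).
    apply: le_trans (HC w.2 _ (@rr_gt0 R w.1)).
    by apply: le_outer_measure; exact: cell_vball.
  rewrite lee_fin -mulrA -powRM ?rr_ge0// -rrD subrKC ler_wpM2r ?powR_ge0//.
  have h4 : 1 <= 4 `^ s :> R.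
    by rewrite -[leLHS](powRr0 4); apply: ler_powR; [rewrite ler1n|exact: ltW].
  by rewrite /D ler_peMr ?(ltW C0).
have pV : 0 < D * rr e.1.1 `^ s by rewrite mulr_gt0 ?powR_gt0.
have := cell_tail_powR nuA p0 pQs a0 (measurable_eball nuA e) eb pV cb.
set S' := \esum_(w in _) _ => H.
have SS : (S' <= S)%E.
  apply: le_esum_sub => [w [fw kw [x [ex cx]]]|//|w _]; last first.
    by rewrite lee_fin mulr_ge0 ?powR_ge0.
  split=> //; split=> //.
  have := edge_near_eball ee ex; have := cell_vball cx; rewrite /vball ballEmdist /= -/(rr _).
  have wr : rr w.1 <= rr e.1.1 :> R by exact: ler_rr.
  have := metric_triangle w.2 x e.1.2; rewrite (metric_sym x); lra.
have aS : ((a e.1)%:E `^ p <= S)%E.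
  rewrite poweR_EFin.
  have -> : a e.1 `^ p = rr (e.1.1 - e.1.1) `^ (gam + Q - p) * a e.1 `^ p.
    by rewrite subrr /rr oppr0 expr0z powR1 mul1r.
  apply: (esum_term (a := fun w => (rr (w.1 - e.1.1) `^ (gam + Q - p) * a w `^ p)%:E)).
    split; first by split=> //; have [] := edgeP ee.
    by split=> //; rewrite mdistxx mulr_gt0.
  by rewrite lee_fin mulr_ge0 ?powR_ge0.
have S0 : (0 <= S)%E by apply: le_trans aS; exact: poweR_ge0.
rewrite /tail_mean; apply: le_trans (poweR_add_le (ltW p0) _ _) _.
- by rewrite mule_ge0 ?lee_fin ?powR_ge0.
- by rewrite lee_fin.
rewrite EFinM -muleA; apply: lee_wpmul2l; first by rewrite lee_fin powR_ge0.
have -> : ((W + 1)%:E * S = W%:E * S + S)%E.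
  by rewrite EFinD ge0_muleDl ?lee_fin ?ler01 ?mul1e.
apply: leeD; last exact: aS.
set J := (\int[_]_(_ in _) _)%E in t0 H *.
rewrite poweRM; [|by rewrite lee_fin powR_ge0|exact: t0].
rewrite poweR_EFin.
apply: (@le_trans _ _ (((rr e.1.1 `^ (- s)) `^ p)%:E *
   ((weight_const p s Q * (D * rr e.1.1 `^ s) `^ p)%:E * S))%E).
  apply: lee_wpmul2l; first by rewrite lee_fin powR_ge0.
  apply: le_trans H _; apply: lee_wpmul2l; last exact: SS.
  rewrite lee_fin mulr_ge0 ?powR_ge0// /weight_const; case: ifP => // _; exact: powR_ge0.
rewrite muleA -EFinM le_eqVlt; apply/orP; left; apply/eqP; congr (_%:E * _)%E.
rewrite /W mulrCA; congr (_ * _); rewrite -powRM ?powR_ge0 ?mulr_ge0 ?powR_ge0 ?(ltW D0)//.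
- congr (_ `^ _); rewrite mulrCA powRN mulVf ?mulr1//.
  by rewrite gt_eqF ?powR_gt0.
- exact: ltW.
Qed.

(** After exchanging the sums, a fixed [w] sees boundedly many edges at each coarser level k, and
    the powers combine to rr(w.1)^(Q - p) times rr(w.1 - k)^gain. Positivity of [gain] makes the sum
    over k converge. *)
Lemma sum_below : exists2 C : R, 0 <= C & forall a, (forall w, 0 <= a w) ->
  (\esum_(e in [set e | edge X e /\ fine_level (T := T) e.1.1])
     \esum_(w in [set w | fvertex X w /\ below e w])
      (rr e.1.1 `^ (Q - p) * (rr (w.1 - e.1.1) `^ (gam + Q - p) * a w `^ p))%:E <=
   C%:E * \esum_(w in fvertex X) (rr w.1 `^ (Q - p) * a w `^ p)%:E)%E.
Proof.
have g0 : 0 < gam by exact: gain_gt0.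
(* Two edges below the same [w] start within 6 + 6 radii of each other. *)
have [M HM] := edge_count cX 12.
have L0 : 0 < ladder_const gam by exact: ladder_const_gt0.
exists (M%:R * ladder_const gam); first by rewrite mulr_ge0// ltW.
move=> a a0; rewrite exchange_esum; last by move=> e w; rewrite lee_fin !mulr_ge0 ?powR_ge0.
rewrite -esumZl ?mulr_ge0 ?(ltW L0)//; last by move=> w; rewrite lee_fin mulr_ge0 ?powR_ge0.
apply: le_esum => w fw.
have -> : \esum_(e in [set e | (edge X e /\ fine_level (T := T) e.1.1) /\ below e w])
    (rr e.1.1 `^ (Q - p) * (rr (w.1 - e.1.1) `^ (gam + Q - p) * a w `^ p))%:E =
  ((rr w.1 `^ (Q - p) * a w `^ p)%:E *
    \esum_(e in [set e | (edge X e /\ fine_level (T := T) e.1.1) /\ below e w])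
     (rr (w.1 - e.1.1) `^ gam)%:E)%E.
  rewrite -esumZl ?mulr_ge0 ?powR_ge0//; last by move=> e; rewrite lee_fin powR_ge0.
  apply: eq_esum => e _; rewrite -EFinM; congr EFin.
  have rE : rr w.1 = rr e.1.1 * rr (w.1 - e.1.1) :> R by rewrite -rrD subrKC.
  rewrite rE powRM ?rr_ge0//.
  have -> : gam + Q - p = gam + (Q - p) by ring.
  rewrite (@powRD _ (rr _) gam (Q - p)) ?(gt_eqF (rr_gt0 _)) ?implybT//; ring.
rewrite muleC; apply: lee_wpmul2r; first by rewrite lee_fin mulr_ge0 ?powR_ge0.
rewrite (esum_fibre (fun e => e.1.1)); last by move=> e _; rewrite lee_fin powR_ge0.
rewrite EFinM; apply: le_trans (lee_wpmul2l _ (geometric_down w.1 g0)); last by rewrite lee_fin.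
rewrite -esumZl//; last by move=> j; rewrite lee_fin powR_ge0.
rewrite [leRHS]esum_mkcond; apply: le_esum => k _; case: ifPn.
  rewrite inE /= => kw; apply: at_most_esum.
  - apply: (HM k) => [e [[[]]]//|e [_ <-]//|e e' [[_ [_ d]] ek] [[_ [_ d']] ek']].
    rewrite ek in d; rewrite ek' in d'.
    by have := metric_triangle e.1.2 w.2 e'.1.2; rewrite (metric_sym e.1.2 w.2); lra.
  - by rewrite lee_fin powR_ge0.
  - by move=> e [_ ->].
rewrite notin_setE /= => kw; rewrite esum1// => e [[_ [ew _]] ek].
by case: kw; rewrite -ek.
Qed.

Lemma vaverage_edge : exists2 C : R, 0 <= C &
  forall a (f : T -> R[i]) (c : R[i]) (K : R) e, (forall w, 0 <= a w) -> 0 <= K ->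
  (forall v, cintegrable nu (vball v) f) -> edge X e -> fine_level (T := T) e.1.1 ->
  (forall x, eball e x -> ((normc (f x - c))%:E <=
     K%:E * (cell_tail cX a e.1.1 x + (a e.1)%:E))%E) ->
  ((normc (edge_diff (vaverage nu f) e))%:E <= (C * K)%:E * tail_mean a e)%E.
Proof.
have [c0 c00 Hc] := fine_ball_lower nuA.
(* The first summand bounds rr^s over the measure of either vertex ball, the finer of which may have
   half the radius; the 1 absorbs the term [a e.1]. *)
pose D := c0^-1 * 2 `^ s + 1.
have D1 : 1 <= D by rewrite lerDr mulr_ge0 ?powR_ge0 ?invr_ge0 ?ltW.
exists (4 * D); first by rewrite mulr_ge0// (le_trans ler01).
move=> a f c K e a0 K0 intf ee fe fH.
have [_ _ lev _ _] := edgeP ee.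
have rk := @rr_gt0 R e.1.1.
set J := (\int[measure_of nu]_(x in eball e) cell_tail cX a e.1.1 x)%E.
have J0 : (0 <= J)%E by apply: integral_ge0 => x _; exact: cell_tail_ge0.
have mt := measurable_cell_tail nuA cX a0 e.1.1.
have dev v : vball v `<=` eball e -> v.1 = e.1.1 \/ v.1 = e.1.1 + 1 ->
    ((normc (vaverage nu f v - c))%:E <= (2 * D * K)%:E * tail_mean a e)%E.
  move=> ve lv.
  have mH : measurable_fun [set: caratheodory_type nu]
      (fun x => (K%:E * (cell_tail cX a e.1.1 x + (a e.1)%:E))%E).
    by apply: measurable_funeM; apply: emeasurable_funD.
  have H0 x : (0 <= K%:E * (cell_tail cX a e.1.1 x + (a e.1)%:E))%E.
    by rewrite mule_ge0 ?adde_ge0 ?cell_tail_ge0 ?lee_fin.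
  apply: le_trans (vaverage_dev nuA (intf v) mH H0 (fun x vx => fH x (ve x vx))) _.
  have mv := measurable_vball nuA v.
  have nv := fine_vball_gt0 nuA v.
  rewrite ge0_integralZl_EFin//; last 2 first.
  - by move=> x _; rewrite adde_ge0 ?cell_tail_ge0 ?lee_fin.
  - by apply: measurable_funS (emeasurable_funD mt (measurable_cst _)).
  rewrite ge0_integralD//; last 3 first.
  - by move=> x _; exact: cell_tail_ge0.
  - exact: measurable_funS mt.
  - by move=> x _; rewrite lee_fin.
  set n := fine _ in nv *.
  have nE : (measure_of nu (vball v) = n%:E)%E.
    exact: esym (fineK (vball_fin_num nuA v)).
  rewrite integral_cst// nE.
  have JJ : (\int[measure_of nu]_(x in vball v) cell_tail cX a e.1.1 x <= J)%E.
    apply: ge0_subset_integral => //; first exact: measurable_eball nuA e.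
      exact: measurable_funS mt.
    by move=> x _; exact: cell_tail_ge0.
  have ninv : n^-1 <= c0^-1 * 2 `^ s * rr e.1.1 `^ (- s).
    have fv : fine_level (T := T) v.1 by apply: fine_level_le fe; case: lv => ->; rewrite ?lerDl.
    have h : c0 * rr v.1 `^ s <= n.
      rewrite -lee_fin fineK ?(vball_fin_num nuA)//; apply: le_trans (Hc v.1 v.2 fv) _.
      apply: le_outer_measure => x; rewrite /vball !ballEmdist /= -/(rr _).
      by have := @rr_gt0 R v.1; lra.
    have h2 : (rr e.1.1 / 2) `^ s <= rr v.1 `^ s.
      apply: ge0_ler_powR; rewrite ?nnegrE ?rr_ge0 ?divr_ge0 ?rr_ge0 ?(ltW s0)//.
      by case: lv => ->; rewrite ?rrS//; lra.
    have -> : c0^-1 * 2 `^ s * rr e.1.1 `^ (- s) = (c0 * (rr e.1.1 / 2) `^ s)^-1.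
      have i2 : 0 <= (2^-1 : R) by rewrite invr_ge0.
      rewrite (powRM _ (rr_ge0 _) i2) -(@powR_inv1 R 2)// -powRrM mulN1r !powRN.
      have ra : rr e.1.1 `^ s != 0 :> R by rewrite gt_eqF ?powR_gt0.
      have tw : 2 `^ s != 0 :> R by rewrite gt_eqF ?powR_gt0.
      by field; rewrite ra tw gt_eqF.
    rewrite lef_pV2 ?posrE ?mulr_gt0 ?powR_gt0//.
      by apply: le_trans h; rewrite ler_wpM2l// ltW.
    by rewrite divr_gt0.
  apply: (@le_trans _ _ ((2 * n^-1)%:E * (K%:E * (J + (a e.1)%:E * n%:E)))%E).
    apply: lee_wpmul2l; first by rewrite lee_fin mulr_ge0 ?invr_ge0 ?(ltW nv).
    apply: lee_wpmul2l; first by rewrite lee_fin.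
    by apply: leeD; first exact: JJ.
  have na : (0 <= (a e.1)%:E * n%:E)%E by rewrite mule_ge0 ?lee_fin// ltW.
  have rJ : (0 <= (rr e.1.1 `^ (- s))%:E * J)%E by rewrite mule_ge0 ?lee_fin ?powR_ge0.
  have ae0 : (0 <= (a e.1)%:E)%E by rewrite lee_fin.
  rewrite muleA -EFinM (ge0_muleDr _ J0 na) /tail_mean (ge0_muleDr _ rJ ae0).
  apply: leeD.
    rewrite muleA -EFinM; apply: lee_wpmul2r => //; rewrite lee_fin.
    have : 2 * n^-1 * K <= 2 * (c0^-1 * 2 `^ s * rr e.1.1 `^ (- s)) * K.
      by rewrite ler_wpM2r// ler_wpM2l.
    move=> /le_trans; apply; rewrite /D.
    move: (c0^-1 * _) (rr _ `^ _) (powR_ge0 (rr e.1.1) (- s)) => x y y0.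
    by have := mulr_ge0 K0 y0; lra.
  rewrite -!EFinM lee_fin.
  have -> : 2 * n^-1 * K * (a e.1 * n) = 2 * 1 * K * a e.1 by field; rewrite gt_eqF.
  by rewrite ler_wpM2r// ler_wpM2r// ler_wpM2l.
have d1 := dev e.1 (@subsetUl _ _ _) (or_introl erefl).
have d2 := dev e.2 (@subsetUr _ _ _) lev.
have -> : 4 * D * K = 2 * D * K + 2 * D * K by ring.
have A0 : 0 <= 2 * D * K by rewrite !mulr_ge0// (le_trans ler01).
rewrite EFinD ge0_muleDl ?lee_fin//.
apply: le_trans (leeD d2 d1); rewrite -EFinD lee_fin.
by rewrite [X in _ + X]normc_sub; exact: normc_triangle.
Qed.

(** The values [c] at the vertices are free; for the trace they are the samples of [f] at good
    points of the holes. Both averages on an edge are compared with the same [c e.1]. *)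
Lemma energy_vaverage : exists2 C : R, 0 <= C &
  forall a (f : T -> R[i]) (c : int * T -> R[i]) (K : R), (forall w, 0 <= a w) -> 0 <= K ->
  (forall v, cintegrable nu (vball v) f) ->
  (forall e x, edge X e -> fine_level (T := T) e.1.1 -> eball e x ->
    ((normc (f x - c e.1))%:E <= K%:E * (cell_tail cX a e.1.1 x + (a e.1)%:E))%E) ->
  (energy X p (Q - p) (vaverage nu f) <=
    (C * K `^ p)%:E * \esum_(w in fvertex X) (rr w.1 `^ (Q - p) * a w `^ p)%:E)%E.
Proof.
have [C1 C10 H1] := vaverage_edge; have [C2 C20 H2] := edge_tail.
have [C3 C30 H3] := sum_below.
exists (C1 `^ p * C2 * C3); first by rewrite !mulr_ge0 ?powR_ge0.
move=> a f c K a0 K0 intf fH.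
pose W := (C1 * K) `^ p * C2; have W0 : 0 <= W by rewrite mulr_ge0 ?powR_ge0.
have -> : C1 `^ p * C2 * C3 * K `^ p = W * C3 by rewrite /W powRM//; ring.
rewrite EFinM -muleA; apply: le_trans (lee_wpmul2l _ (H3 a a0)); last by rewrite lee_fin.
rewrite -esumZl//; last by move=> e; apply: esum_ge0 => w _; rewrite lee_fin !mulr_ge0 ?powR_ge0.
rewrite /energy [leRHS](esum_mkcondr (edge X) (fun e => fine_level (T := T) e.1.1)).
apply: le_esum => e ee; case: ifPn; rewrite ?notin_setE ?inE => fe; last first.
  by rewrite (coarse_edge_diff nu s0 p0 f ee fe) normc0 powR0 ?mulr0// gt_eqF.
have du := H1 a f (c e.1) K e a0 K0 intf ee fe (fun x => fH e x ee fe).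
have tm0 : (0 <= tail_mean a e)%E.
  by rewrite adde_ge0 ?mule_ge0 ?integral_ge0 ?lee_fin ?powR_ge0// => x _; exact: cell_tail_ge0.
have dp : ((normc (edge_diff (vaverage nu f) e) `^ p)%:E <=
    W%:E * \esum_(w in [set w | fvertex X w /\ below e w])
      (rr (w.1 - e.1.1) `^ (gam + Q - p) * a w `^ p)%:E)%E.
  rewrite -poweR_EFin; apply: le_trans (le_poweR2 (ltW p0) _ du) _.
    by rewrite lee_fin normc_ge0.
  rewrite poweRM ?lee_fin ?mulr_ge0// poweR_EFin /W EFinM -muleA.
  by apply: lee_wpmul2l; [rewrite lee_fin powR_ge0|exact: H2].
rewrite EFinM; apply: le_trans (lee_wpmul2l _ dp) _; first by rewrite lee_fin powR_ge0.
rewrite muleCA; apply: lee_wpmul2l; first by rewrite lee_fin.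
rewrite -esumZl ?powR_ge0//; last by move=> w; rewrite lee_fin mulr_ge0 ?powR_ge0.
Qed.

Section locally_integrable.
Variables (a : int * T -> R) (f : T -> R[i]) (c : int * T -> R[i]) (K : R) (k : int).
Hypothesis a0 : forall w, 0 <= a w.
Hypothesis K0 : 0 <= K.
Hypothesis fine_k : fine_level (T := T) k.
Hypothesis c_f : forall x, (cell_tail cX a k x < +oo)%E -> forall t : R, 0 < t ->
  exists N : nat, forall j, (N <= j)%N -> normc (c (k + j%:Z, nearest cX (k + j%:Z) x) - f x) < t.
Hypothesis c_near : forall x,
  ((normc (f x - c (k, nearest cX k x)))%:E <= K%:E * cell_tail cX a k x)%E.
Hypothesis Soo : (\esum_(w in fvertex X) (rr w.1 `^ (Q - p) * a w `^ p)%:E < +oo)%E.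

Let mt := measurable_cell_tail nuA cX a0 k.

(** The weights in [cell_tail_powR] exceed those of the finite sum [Soo] by a fixed power of [rr k]
    and a factor rr(w.1 - k)^gain, at most 1. *)
Let tail_ball x r : 0 < r ->
  (\int[measure_of nu]_(y in ball x r) cell_tail cX a k y < +oo)%E.
Proof.
move=> r0; have [C C0 HC] := ahlfors_upper s0 nuA T2.
have rk := @rr_gt0 R k; have bf := ball_fin_num nuA x r0.
pose V := C * rr k `^ s + fine (nu (ball x r)).
have V0 : 0 < V by rewrite ltr_wpDr ?mulr_gt0 ?powR_gt0// fine_ge0.
have BV : (nu (ball x r) <= V%:E)%E.
  by rewrite -[leLHS]fineK// lee_fin lerDr mulr_ge0 ?powR_ge0// ltW.
have cV w : fvertex X w -> k <= w.1 ->
    (nu (cell cX w) <= (V * rr (w.1 - k) `^ s)%:E)%E.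
  move=> _ _; apply: (@le_trans _ _ (C * rr w.1 `^ s)%:E).
    apply: le_trans (HC w.2 _ (@rr_gt0 R w.1)).
    by apply: le_outer_measure; exact: cell_vball.
  rewrite lee_fin.
  have -> : rr w.1 = rr k * rr (w.1 - k) :> R by rewrite -rrD subrKC.
  rewrite powRM ?rr_ge0// mulrA; apply: ler_wpM2r; first exact: powR_ge0.
  by rewrite lerDl fine_ge0.
have mb : measurable (ball x r : set (caratheodory_type nu)).
  by apply: measurable_mball; exact: nuA.1.1.
have := cell_tail_powR nuA p0 pQs a0 mb BV V0 cV.
set J := (\int[_]_(_ in _) _)%E; set S' := \esum_(w in _) _ => JS.
have S'oo : (S' < +oo)%E.
  apply: (@le_lt_trans _ _ ((rr k `^ (p - Q))%:E *
     \esum_(w in fvertex X) (rr w.1 `^ (Q - p) * a w `^ p)%:E)%E); last first.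
    rewrite -ge0_fin_numE; last first.
      rewrite mule_ge0 ?lee_fin ?powR_ge0// esum_ge0// => w _.
      by rewrite lee_fin mulr_ge0 ?powR_ge0.
    rewrite fin_numM// ge0_fin_numE// esum_ge0// => w _.
    by rewrite lee_fin mulr_ge0 ?powR_ge0.
  rewrite -esumZl ?powR_ge0//; last by move=> w; rewrite lee_fin mulr_ge0 ?powR_ge0.
  apply: le_esum_sub => [w []//|w [_ kw _]|w _]; last first.
    by rewrite mule_ge0 ?lee_fin ?mulr_ge0 ?powR_ge0.
  rewrite -EFinM lee_fin mulrA ler_wpM2r ?powR_ge0//.
  have -> : rr w.1 `^ (Q - p) = rr k `^ (Q - p) * rr (w.1 - k) `^ (Q - p) :> R.
    by rewrite -powRM ?rr_ge0// -rrD subrKC.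
  rewrite mulrA -powRD ?(gt_eqF rk) ?implybT//.
  have -> : p - Q + (Q - p) = 0 by ring.
  have -> : gam + Q - p = gam + (Q - p) by ring.
  rewrite powRr0 mul1r (@powRD _ (rr _) gam (Q - p)) ?(gt_eqF (rr_gt0 _)) ?implybT//.
  apply: ler_piMl; first exact: powR_ge0.
  have -> : 1 = 1 `^ gam :> R by rewrite powR1.
  apply: ge0_ler_powR.
  - exact/ltW/gain_gt0.
  - by rewrite nnegrE rr_ge0.
  - by rewrite nnegrE.
  - have -> : 1 = rr 0 :> R by rewrite /rr oppr0.
    by apply: ler_rr; rewrite subr_ge0.
rewrite ltey; apply/negP => /eqP Joo; move: JS; rewrite Joo poweRyr ?(gt_eqF p0)//.
rewrite leye_eq => /eqP E; suff : ((weight_const p s Q * V `^ p)%:E * S' < +oo)%E by rewrite E.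
rewrite -ge0_fin_numE; last first.
  rewrite mule_ge0 ?lee_fin ?mulr_ge0 ?powR_ge0//.
    by rewrite /weight_const; case: ifP => // _; exact: powR_ge0.
  by apply: esum_ge0 => w _; rewrite lee_fin mulr_ge0 ?powR_ge0.
rewrite fin_numM// ge0_fin_numE// esum_ge0// => w _.
by rewrite lee_fin mulr_ge0 ?powR_ge0.
Qed.

Lemma cell_tail_ae : {ae measure_of nu, forall x, (cell_tail cX a k x < +oo)%E}.
Proof.
have : {ae measure_of nu, forall x, forall n : nat,
    ball point n.+1%:R x -> (cell_tail cX a k x < +oo)%E}.
  apply: ae_foralln => n.
  have it : (measure_of nu).-integrable (ball point n.+1%:R) (cell_tail cX a k).
    apply/integrableP; split; first exact: measurable_funS mt.
    under eq_integral do rewrite gee0_abs ?cell_tail_ge0//.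
    exact: tail_ball.
  have mb : measurable (ball (point : T) n.+1%:R : set (caratheodory_type nu)).
    by apply: measurable_mball; exact: nuA.1.1.
  apply: filterS (integrable_ae mb it) => x + bx => /(_ bx).
  by rewrite ge0_fin_numE// cell_tail_ge0.
move=> [N [mN N0 NP]]; exists N; split=> // x nx; apply: NP => h; apply: nx.
apply: (h (Num.bound (mdist point x))).
rewrite ballEmdist /=; apply: lt_trans (archi_boundP _) _; first exact: mdist_ge0.
by rewrite ltr_nat.
Qed.

(** Off a null set [f] is the limit of functions that are constant on cells; completeness of the
    Caratheodory measure passes measurability to [f]. Here [g] stands for the real or the imaginary
    part. *)
Let part_measurable (g : R[i] -> R) : (forall y z, `|g y - g z| <= normc (y - z)) ->
  measurable_fun [set: caratheodory_type nu] (fun x => g (f x)).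
Proof.
move=> g1; apply/measurable_EFinP.
have [N [mN N0 NP]] := cell_tail_ae.
pose h j x := g (c (k + j%:Z, nearest cX (k + j%:Z) x)).
pose I x : R := \1_(~` N) x.
have mI : measurable_fun [set: caratheodory_type nu] I.
  by apply: measurable_indic; exact: measurableC.
apply: (ae_measurable_fun (measure_is_complete_caratheodory (mu := nu))
    (f := EFin \o (fun x => g (f x) * I x))).
  exists N; split=> // x /= nx; apply: contrapT => Nx; apply: nx => _ /=.
  by rewrite /I indicE mem_set// mulr1.
apply/measurable_EFinP.
apply: (measurable_fun_cvg (h := fun j (x : caratheodory_type nu) => h j x * I x)).
  move=> j; apply: measurable_funM => //.
  exact: (measurable_nearest_comp nuA.1.1 cX (k + j%:Z) (fun xi => g (c (k + j%:Z, xi)))).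
move=> x _; rewrite /I indicE; have [Nx|Nx] := pselect (N x).
  rewrite memNset; last by move=> /(_ Nx).
  by rewrite mulr0; under eq_fun do rewrite mulr0; exact: cvg_cst.
rewrite mem_set// mulr1; under eq_fun do rewrite mulr1.
have tx : (cell_tail cX a k x < +oo)%E by apply: contrapT => h'; apply: Nx; exact: NP.
apply/cvgrPdistC_lt => e e0; have [M HM] := c_f tx e0.
by exists M => // j Mj; apply: le_lt_trans (g1 _ _) _; exact: HM.
Qed.

Lemma trace_L1loc : L1loc nu f.
Proof.
have gRe y z : `|complex.Re y - complex.Re z| <= @normc R (y - z).
  by rewrite -ReB; exact: normc_Re.
have gIm y z : `|complex.Im y - complex.Im z| <= @normc R (y - z).
  by rewrite -ImB; exact: normc_Im.
split; first by split; exact: part_measurable.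
move=> x r; have [r0|r0] := ltP 0 r; last first.
  have -> : ball x r = set0.
    by apply/seteqP; split=> // y; rewrite ballEmdist /=; have := mdist_ge0 x y; lra.
  by split; apply/integrableP; split; rewrite ?integral_set0//; exact: measurable_fun_set0.
have mb : measurable (ball x r : set (caratheodory_type nu)).
  by apply: measurable_mball; exact: nuA.1.1.
(* Finitely many vertices of level [k] own points of the ball, so the sum of the moduli of [c] over
   them is a bound. *)
have [A A0 HA] : exists2 A : R, 0 <= A & forall y, ball x r y ->
    normc (c (k, nearest cX k y)) <= A.
  pose D := [set xi | net X k xi /\ mdist x xi < r + rr k].
  have rk := @rr_gt0 R k.
  have [M HM] := cX (2 * (r + rr k) / rr k).
  have : finite_set D.
    apply: (at_most_finite (M := M)); apply: (HM k) => [xi []//|xi eta [_ h1] [_ h2]].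
    rewrite divfK ?gt_eqF//; have := metric_triangle xi x eta.
    by rewrite (metric_sym xi x); lra.
  move=> /finite_seqP[t Dt]; exists (\sum_(xi <- t) normc (c (k, xi))).
    by apply: sumr_ge0 => xi _; exact: normc_ge0.
  move=> y; rewrite ballEmdist /= => xy.
  have : D (nearest cX k y).
    split; first exact: net_nearest.
    have := mdist_nearest cX k y; have := metric_triangle x y (nearest cX k y); lra.
  rewrite Dt /= => yt; rewrite (big_rem _ yt) /= lerDl.
  by apply: sumr_ge0 => xi _; exact: normc_ge0.
have bound y : ball x r y -> ((normc (f y))%:E <= A%:E + K%:E * cell_tail cX a k y)%E.
  move=> xy; apply: (@le_trans _ _
      ((normc (c (k, nearest cX k y)))%:E + (normc (f y - c (k, nearest cX k y)))%:E)%E).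
    rewrite -EFinD lee_fin addrC.
    have := normc_triangle (c (k, nearest cX k y)) (f y) 0.
    by rewrite !subr0.
  by apply: leeD; [rewrite lee_fin; exact: HA|exact: c_near].
have mK : measurable_fun [set: caratheodory_type nu] (fun y => (K%:E * cell_tail cX a k y)%E).
  exact: measurable_funeM.
have K00 y : (0 <= K%:E * cell_tail cX a k y)%E.
  by rewrite mule_ge0 ?cell_tail_ge0 ?lee_fin.
have main (g : R[i] -> R) : (forall y z, `|g y - g z| <= normc (y - z)) -> g 0 = 0 ->
    (measure_of nu).-integrable (ball x r) (fun y => (g (f y))%:E).
  move=> g1 g00; have mg := part_measurable g1.
  have mg' : measurable_fun (ball x r : set (caratheodory_type nu)) (fun y => (g (f y))%:E).
    by apply/measurable_EFinP; exact: measurable_funS mg.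
  apply/integrableP; split=> //.
  apply: (@le_lt_trans _ _
      (\int[measure_of nu]_(y in ball x r) (A%:E + K%:E * cell_tail cX a k y))%E).
    apply: ge0_le_integral => //.
    - exact: measurableT_comp.
    - by apply: emeasurable_funD => //; exact: measurable_funS mK.
    - move=> y xy; apply: le_trans (bound y xy); rewrite lee_fin.
      by have := g1 (f y) 0; rewrite g00 !subr0.
  rewrite ge0_integralD//; last first.
    exact: measurable_funS mK.
  rewrite integral_cst// ge0_integralZl_EFin//; last 2 first.
  - by move=> y _; exact: cell_tail_ge0.
  - exact: measurable_funS mt.
  have tb := tail_ball x r0.
  have tf : (\int[measure_of nu]_(y in ball x r) cell_tail cX a k y)%E \is a fin_num.
    by rewrite ge0_fin_numE// integral_ge0// => y _; exact: cell_tail_ge0.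
  have bf : (measure_of nu (ball x r) \is a fin_num)%E.
    by have := ball_fin_num nuA x r0.
  rewrite -(fineK bf) -(fineK tf) -!EFinM -EFinD; exact: ltry.
by split; apply: main.
Qed.

End locally_integrable.

End trace_energy.

(** * Lebesgue points of vertex averages *)

Lemma cvge0_le {R : realType} (u : nat -> \bar R) (t : R) :
  (forall n, 0 <= u n)%E -> u @ \oo --> 0%E -> 0 < t -> exists n, (u n <= t%:E)%E.
Proof.
move=> u0 /fine_cvgP[[N1 _ f1] /cvgrPdist_lt cv] t0.
have [N2 _ H] := cv t t0; pose n := maxn N1 N2; exists n.
rewrite -(fineK (f1 n (leq_maxl _ _))) lee_fin ltW//.
have := H n (leq_maxr _ _) => /=; rewrite sub0r normrN ger0_norm//.
by rewrite fine_ge0.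
Qed.

Import HBSimple.

(** * Approximation of integrable functions by Lipschitz functions *)

Section lipschitz_approximation.
Context {R : realType} {T : pmetricType R}.
Variable nu : {outer_measure set T -> \bar R}.
Hypothesis nur : borel_regular nu.
Variable B : set T.
Hypothesis mB : measurable (B : set (caratheodory_type nu)).
Hypothesis fB : (nu B < +oo)%E.
Local Notation M := (caratheodory_type nu).
Implicit Types (g h phi : T -> R).

Definition lip_with (K : R) phi := 0 <= K /\ forall x y, phi x <= phi y + K * mdist x y.

Definition lip_approx g := forall t : R, 0 < t -> exists phi K, lip_with K phi /\
  (\int[measure_of nu]_(x in B) (`|g x - phi x|%:E) <= t%:E)%E.

Lemma lip_with_measurable K phi : lip_with K phi -> measurable_fun [set: M] phi.
Proof. by move=> [K0 Kp]; exact: lipschitz_measurable Kp. Qed.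

Let lip_abs K phi x y : lip_with K phi -> `|phi x - phi y| <= K * mdist x y.
Proof.
move=> [_ Kp]; rewrite ler_norml; have := Kp x y; have := Kp y x.
by rewrite (metric_sym y x); lra.
Qed.

Let mabs g h : measurable_fun [set: M] g -> measurable_fun [set: M] h ->
  measurable_fun (B : set M) (fun x => `|g x - h x|%:E).
Proof.
move=> mg mh; apply/measurable_EFinP; apply: measurableT_comp => //.
by apply: measurable_funB; [exact: measurable_funS mg|exact: measurable_funS mh].
Qed.

Lemma lip_approx_lip K phi : lip_with K phi -> lip_approx phi.
Proof.
move=> Kp t t0; exists phi, K; split=> //.
under eq_integral do rewrite subrr normr0.
by rewrite integral0 lee_fin ltW.
Qed.

Lemma lip_approx_lin a g h : measurable_fun [set: M] g -> measurable_fun [set: M] h ->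
  lip_approx g -> lip_approx h -> lip_approx (fun x => a * g x + h x).
Proof.
move=> mg mh ag ah t t0.
have a1 : 0 < 2 * (`|a| + 1) by rewrite mulr_gt0// ltr_wpDl.
have [phi [K [Kp Hp]]] := ag (t / (2 * (`|a| + 1))) (divr_gt0 t0 a1).
have [psi [L [Lp Hs]]] := ah (t / 2) (divr_gt0 t0 (ltr0Sn _ 1)).
exists (fun x => a * phi x + psi x), (`|a| * K + L); split.
  split; first by rewrite addr_ge0 ?mulr_ge0 ?(proj1 Kp) ?(proj1 Lp).
  move=> x y; have h1 := lip_abs x y Kp; have h2 := proj2 Lp x y.
  have h3 : a * (phi x - phi y) <= `|a| * (K * mdist x y).
    by apply: le_trans (ler_norm _) _; rewrite normrM ler_wpM2l.
  by move: h2 h3; rewrite mulrBr; lra.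
have mp := lip_with_measurable Kp; have ms := lip_with_measurable Lp.
have mgp := mabs mg mp; have mhs := mabs mh ms.
apply: (@le_trans _ _ (\int[measure_of nu]_(x in B)
   (`|a|%:E * `|g x - phi x|%:E + `|h x - psi x|%:E))%E).
  apply: ge0_le_integral => //.
  - apply: mabs; apply: measurable_funD => //; exact: measurable_funM.
  - by apply: emeasurable_funD => //; exact: measurable_funeM.
  - move=> x _; rewrite -EFinM -EFinD lee_fin -normrM.
    by apply: le_trans (ler_normD _ _); rewrite le_eqVlt; apply/orP; left; apply/eqP; congr `|_|; ring.
rewrite ge0_integralD//; last exact: measurable_funeM.
rewrite ge0_integralZl_EFin//.
have -> : t = (t / 2) + t / 2 by rewrite -splitr.
rewrite EFinD; apply: leeD => //.
apply: le_trans (lee_wpmul2l _ Hp) _; first by rewrite lee_fin.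
rewrite -EFinM lee_fin mulrCA ler_wpM2l ?(ltW t0)// invfM mulrCA ler_piMr ?invr_ge0//.
by rewrite ler_pdivrMr ?mul1r ?lerDl// ltr_wpDl.
Qed.

Lemma lip_approx_lim g : measurable_fun [set: M] g ->
  (forall t : R, 0 < t -> exists h, [/\ measurable_fun [set: M] h, lip_approx h &
    (\int[measure_of nu]_(x in B) (`|g x - h x|%:E) <= t%:E)%E]) -> lip_approx g.
Proof.
move=> mg gh t t0; have t2 : 0 < t / 2 by rewrite divr_gt0.
have [h [mh ah Hh]] := gh _ t2; have [phi [K [Kp Hp]]] := ah _ t2.
exists phi, K; split=> //; have mp := lip_with_measurable Kp.
have mgh := mabs mg mh; have mhp := mabs mh mp; have mgp := mabs mg mp.
apply: (@le_trans _ _ (\int[measure_of nu]_(x in B)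
   (`|g x - h x|%:E + `|h x - phi x|%:E))%E).
  apply: ge0_le_integral => //; first exact: emeasurable_funD.
  by move=> x _; rewrite -EFinD lee_fin; exact: ler_distD.
by rewrite ge0_integralD// [t]splitr EFinD; exact: leeD.
Qed.

Lemma lip_approx_cvg (h : nat -> T -> R) g : (forall n, measurable_fun [set: M] (h n)) ->
  measurable_fun [set: M] g -> (forall n x, `|h n x| <= 1) ->
  (forall x, exists N, forall n, (N <= n)%N -> h n x = g x) ->
  (forall n, lip_approx (h n)) -> lip_approx g.
Proof.
move=> mh mg h1 hg ah; apply: lip_approx_lim => // t t0.
have [|||||_ cv _] := @dominated_convergence _ M R (measure_of nu) B mB
  (fun n x => (h n x)%:E) (EFin \o g) (cst 1%E).
- by move=> n; apply/measurable_EFinP; exact: measurable_funS (mh n).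
- by apply/measurable_EFinP; exact: measurable_funS mg.
- apply: aeW => x _; have [N HN] := hg x; apply: (@cvg_near_cst).
  by exists N => // n Nn /=; rewrite HN.
- apply/integrableP; split=> //.
  rewrite (eq_integral (cst 1%E)); last by move=> x _; rewrite /= normr1.
  by rewrite integral_cst// mul1e.
- by apply: aeW => x n _; rewrite lee_fin.
have [n Hn] := cvge0_le (fun n => integral_ge0 _ (fun x _ => abse_ge0 _)) cv t0.
exists (h n); split=> //; apply: le_trans Hn.
rewrite le_eqVlt; apply/orP; left; apply/eqP; apply: eq_integral => x _.
by rewrite /= distrC.
Qed.

(** The Pasch-Hausdorff regularisation: the largest k-Lipschitz function below the indicator. *)
Definition inf_conv (A : set T) (k : nat) x : R :=
  inf [set \1_A y + k%:R * mdist x y | y in [set: T]].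

Let inf_conv_lb A k x : has_lbound ([set \1_A y + k%:R * mdist x y | y in [set: T]] : set R).
Proof. by exists 0 => _ [y _ <-]; rewrite addr_ge0 ?mulr_ge0 ?mdist_ge0// indicE. Qed.

Let inf_conv_le A k x y : inf_conv A k x <= \1_A y + k%:R * mdist x y.
Proof. by apply: ge_inf; [exact: inf_conv_lb|exists y]. Qed.

Let inf_conv_ge A k x c : (forall y, c <= \1_A y + k%:R * mdist x y) -> c <= inf_conv A k x.
Proof.
move=> H; apply: lb_le_inf; first by exists (\1_A x + k%:R * mdist x x), x.
by move=> _ [y _ <-].
Qed.

Let inf_conv_lip A k : lip_with k%:R (inf_conv A k).
Proof.
split=> // x z; rewrite -lerBlDr; apply: inf_conv_ge => y.
rewrite lerBlDr; apply: le_trans (inf_conv_le A k x y) _.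
rewrite -addrA lerD2l -mulrDr ler_wpM2l// addrC; exact: metric_triangle.
Qed.

(** At a point whose ball of radius d lies in [U], the regularisation equals 1 as soon as k >= 1/d;
    outside [U] it is 0. *)
Lemma lip_approx_open U : open U -> lip_approx (\1_U).
Proof.
move=> oU; apply: (@lip_approx_cvg (inf_conv U)).
- by move=> n; exact: lip_with_measurable (inf_conv_lip U n).
- by apply: measurable_indic; apply: open_measurable_cara.
- move=> n x; have i0 : 0 <= inf_conv U n x.
    by apply: inf_conv_ge => y; rewrite addr_ge0 ?mulr_ge0 ?mdist_ge0// indicE.
  rewrite ger0_norm//; apply: le_trans (inf_conv_le U n x x) _.
  by rewrite mdistxx mulr0 addr0 indicE; case: (_ \in _).
- move=> x; have up n : inf_conv U n x <= \1_U x.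
    by apply: le_trans (inf_conv_le U n x x) _; rewrite mdistxx mulr0 addr0.
  have [Ux|Ux] := pselect (U x); last first.
    exists 0%N => n _; apply/eqP; rewrite eq_le up; rewrite indicE memNset//.
    by apply: inf_conv_ge => y; rewrite addr_ge0 ?mulr_ge0 ?mdist_ge0// indicE.
  have /nbhs_ballP[d /= d0 dU] : nbhs x U by exact: open_nbhs_nbhs.
  exists (Num.bound d^-1) => n Nn; apply/eqP; rewrite eq_le up indicE mem_set//=.
  apply: inf_conv_ge => y; rewrite indicE; case: (boolP (y \in U)) => [_|].
    by rewrite lerDl mulr_ge0 ?mdist_ge0.
  rewrite notin_setE => nU; rewrite add0r.
  have dxy : d <= mdist x y.
    rewrite leNgt; apply/negP => h; apply: nU; apply: dU;
    rewrite ballEmdist /=; exact: h.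
  have dn : d^-1 <= n%:R.
    apply: ltW; apply: lt_le_trans (archi_boundP _) _; first by rewrite invr_ge0 ltW.
    by rewrite ler_nat.
  rewrite -[leLHS](mulVf (lt0r_neq0 d0)); apply: ler_pM; [|exact: ltW|exact: dn|exact: dxy].
  by rewrite invr_ge0 ltW.
- by move=> n; exact: lip_approx_lip (inf_conv_lip U n).
Qed.

Let borel_cara A : <<s open >> A -> measurable (A : set M).
Proof. exact: nur.1. Qed.

(** A Dynkin class argument: open sets are stable under intersection, complements follow by
    linearity, and disjoint unions by dominated convergence. *)
Lemma lip_approx_borel A : <<s open >> A -> lip_approx (\1_A).
Proof.
apply: (@dynkin_induction _ (g_sigma_algebraType (@open T)) open
  (fun A => lip_approx (\1_A))) => //.
- by move=> U V; exact: openI.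
- rewrite indicT; apply: (@lip_approx_lip 0); split=> // x y.
  by rewrite mul0r addr0.
- by move=> U; exact: lip_approx_open.
- move=> A' mA aA.
  have -> : \1_(~` A') = (fun x => -1 * \1_A' x + cst 1 x) :> (T -> R).
    apply/funext => x; rewrite !indicE in_setC /=; case: (_ \in _) => /=; lra.
  apply: lip_approx_lin => //; first by apply: measurable_indic; exact: borel_cara.
  by apply: (@lip_approx_lip 0); split=> // x y; rewrite mul0r addr0.
- move=> F mF tF aF.
  have mU n : measurable (\big[setU/set0]_(i < n) F i : set M).
    apply: bigsetU_measurable => i _; apply: borel_cara; exact: mF.
  apply: (@lip_approx_cvg (fun n => \1_(\big[setU/set0]_(i < n) F i))).
  + by move=> n; exact: measurable_indic.
  + by apply: measurable_indic; apply: bigcup_measurable => n _; apply: borel_cara; exact: mF.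
  + by move=> n x; rewrite indicE; case: (_ \in _); rewrite ?normr1 ?normr0.
  + move=> x; have [[n _ Fx]|nF] := pselect ((\bigcup_k F k) x).
      exists n.+1 => m nm; rewrite !indicE !mem_set//; first by exists n.
      by rewrite -bigcup_mkord; exists n.
    exists 0%N => m _; rewrite !indicE !memNset//.
    by rewrite -bigcup_mkord => -[j _ Fj]; apply: nF; exists j.
  + elim=> [|n IH].
      rewrite big_ord0 indic0; apply: (@lip_approx_lip 0); split=> // x y.
      by rewrite mul0r addr0.
    have -> : \1_(\big[setU/set0]_(i < n.+1) F i) =
        (fun x => 1 * \1_(\big[setU/set0]_(i < n) F i) x + \1_(F n) x) :> (T -> R).
      apply/funext => x; rewrite big_ord_recr/= mul1r !indicE in_setU.
      case: (boolP (x \in \big[setU/set0]_(i < n) F i)); rewrite ?add0r//= inE.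
      rewrite -bigcup_mkord => -[j /= jn Fj]; rewrite memNset ?addr0// => Fn.
      have jE := tF j n I I (ex_intro _ x (conj Fj Fn)).
      by move: jn; rewrite jE ltnn.
    apply: lip_approx_lin; [exact: measurable_indic| |exact: IH|exact: aF].
    apply: measurable_indic; apply: borel_cara; exact: mF.
Qed.

Lemma lip_approx_indic A : measurable (A : set M) -> lip_approx (\1_A).
Proof.
(* Borel regularity is applied inside [B], where measures are finite, so that the Borel hull exceeds
   the set by a null set. *)
move=> mA; have [E [bE AE nE]] := nur.2 (A `&` B).
have mE := borel_cara bE; have mAB : measurable (A `&` B : set M) by exact: measurableI.
apply: lip_approx_lim; first exact: measurable_indic.
move=> t t0; exists (\1_E); split; first exact: measurable_indic.
  exact: lip_approx_borel.
have mD : measurable (E `\` (A `&` B) : set M) by exact: measurableD.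
apply: (@le_trans _ _ (\int[measure_of nu]_(x in B) (\1_(E `\` (A `&` B)) x)%:E)%E).
  apply: ge0_le_integral => //.
  - by apply: mabs; exact: measurable_indic.
  - by apply/measurable_EFinP; exact: measurable_indic.
  - move=> x Bx; rewrite lee_fin !indicE in_setD in_setI (mem_set Bx) andbT.
    case: (boolP (x \in A)) => [|_]; last first.
      by rewrite sub0r normrN /= andbT; case: (_ \in _); rewrite ?normr1 ?normr0.
    by rewrite inE => Ax; rewrite mem_set ?subrr ?normr0//; apply: AE.
rewrite integral_indic//; apply: (@le_trans _ _ 0%E); last by rewrite lee_fin ltW.
apply: (@le_trans _ _ (measure_of nu (E `\` (A `&` B)))).
  exact: le_outer_measure (@subIsetl _ _ _).
have fin : (measure_of nu E < +oo)%E.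
  by rewrite [measure_of nu E]nE; apply: le_lt_trans fB; apply: le_outer_measure; exact: subIsetr.
rewrite measureD// (_ : E `&` (A `&` B) = A `&` B); last exact/setIidPr.
rewrite -[X in (X - _)%E]/(nu E) -[X in (_ - X)%E]/(nu (A `&` B)) nE subee//.
by rewrite ge0_fin_numE// -nE.
Qed.

Lemma lip_approx_integrable g : measurable_fun [set: M] g ->
  (measure_of nu).-integrable B (EFin \o g) -> lip_approx g.
Proof.
move=> mg ig; have [s [_ _ cv]] := approximation_sfun_integrable mB ig.
apply: lip_approx_lim => // t t0.
have : exists n, (\int[measure_of nu]_(z in B) `|(EFin \o g) z - (s n z)%:E| <= t%:E)%E.
  by apply: cvge0_le cv t0 => n; apply: integral_ge0 => x _; exact: abse_ge0.
move=> [n Hn]; exists (s n); split=> //.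
have -> : (s n : T -> R) = (fun x => \sum_(y <- fset_set (range (s n)))
    y * \1_(s n @^-1` [set y]) x).
  by apply/funext => x; rewrite fimfunE fsbig_finite.
elim: (fset_set _ : seq R) => [|y l IH].
  under eq_fun do rewrite big_nil.
  by apply: (@lip_approx_lip 0); split=> // x z; rewrite mul0r addr0.
under eq_fun do rewrite big_cons.
have ms z : measurable (s n @^-1` [set z] : set M) by exact: measurable_sfunP.
apply: (@lip_approx_lin y (\1_(s n @^-1` [set y]))
  (fun x => \sum_(z <- l) z * \1_(s n @^-1` [set z]) x)); [| | |exact: IH].
- exact: measurable_indic.
- apply: (@measurable_sum _ M R setT _ l (fun z x => z * \1_(s n @^-1` [set z]) x)) => z.
  by apply: measurable_funM => //; exact: measurable_indic.
- exact: lip_approx_indic.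
Qed.

End lipschitz_approximation.

(** * Limits of averages at the owning vertices *)

Section averages_limit.
Context {R : realType} {T : pmetricType R}.
Variables (nu : {outer_measure set T -> \bar R}) (s : R).
Hypothesis nuA : ahlfors_regular s nu.
Variable X : hyperbolic_filling T.
Hypothesis cX : net_count X.
Variable g : T -> R.
Hypothesis mg : measurable_fun [set: caratheodory_type nu] g.
Hypothesis ig : forall x r, (measure_of nu).-integrable (ball x r) (EFin \o g).
Local Notation M := (caratheodory_type nu).
Implicit Types (v w : int * T) (x : T) (j : nat).

Definition average v : R :=
  (fine (nu (vball v)))^-1 * \int[measure_of nu]_(y in vball v) g y.

Let dev j x : \bar R := `|average (j%:Z, nearest cX j%:Z x) - g x|%:E.

Let mdev j : measurable_fun [set: M] (dev j).
Proof.
apply/measurable_EFinP; apply: measurableT_comp => //; apply: measurable_funB => //.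
exact: (measurable_nearest_comp nuA.1.1 cX j%:Z (fun xi => average (j%:Z, xi))).
Qed.

Let mball x r : measurable (ball x r : set M).
Proof. by apply: measurable_mball; exact: nuA.1.1. Qed.

Let rr_le1 j : rr j%:Z <= 1 :> R.
Proof.
have -> : (1 : R) = rr 0 by rewrite /rr oppr0.
by apply: ler_rr.
Qed.

Section overlap.
Variables (h : T -> \bar R) (x0 : T) (r : R) (j N : nat).
Hypothesis h0 : forall x, (0 <= h x)%E.
Hypothesis mh : measurable_fun [set: M] h.
Hypothesis HN : forall y, at_most N [set w | [/\ vertex X w, w.1 = j%:Z & vball w y]].

Let b v : \bar R := ((fine (nu (vball v)))^-1%:E * \int[measure_of nu]_(y in vball v) h y)%E.

Let b0 v : (0 <= b v)%E.
Proof.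
rewrite mule_ge0 ?integral_ge0// lee_fin invr_ge0 ltW//.
exact: (fine_vball_gt0 nuA).
Qed.

Let D := [set w | [/\ vertex X w, w.1 = j%:Z & ball x0 r `&` cell cX w !=set0]].

Let cD : countable D.
Proof. by apply: sub_countable (countable_vertex cX); apply: subset_card_le => w []. Qed.

Let mcell w : D w -> measurable (cell cX w : set M).
Proof. by move=> [vw _ _]; apply: measurable_cell vw; exact: nuA.1.1. Qed.

Let D_sub w : D w -> vball w `<=` ball x0 (r + 2).
Proof.
case: w => n xi [_ /= -> [x [+ +]]] y.
rewrite /cell /vball !ballEmdist /= -/(rr j%:Z) => xr nx wy.
have nr := mdist_nearest cX j%:Z x; rewrite nx in nr.
have := rr_le1 j; have := metric_triangle x0 x y; have := metric_triangle x xi y; lra.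
Qed.

(** Averaging over the ball of the owning vertex is bounded on L^1 uniformly in the level: a cell
    has measure at most that of its ball, and the balls overlap at most [N] times. The radius grows
    by 2 since these balls have radius at most 1. *)
Lemma nearest_averages : (\int[measure_of nu]_(x in ball x0 r) b (j%:Z, nearest cX j%:Z x) <=
  N%:R%:E * \int[measure_of nu]_(x in ball x0 (r + 2)) h x)%E.
Proof.
have mt w : D w -> measurable_fun [set: M] (fun x => (b w * (\1_(cell cX w) x)%:E)%E).
  move=> Dw; apply: measurable_funeM; apply/measurable_EFinP.
  by apply: measurable_indic; exact: mcell.
apply: (@le_trans _ _ (\int[measure_of nu]_(x in ball x0 r)
    \esum_(w in D) (b w * (\1_(cell cX w) x)%:E))%E).
  apply: ge0_le_integral => //.
  - exact: measurable_funS (measurable_nearest_comp nuA.1.1 cX j%:Z (fun xi => b (j%:Z, xi))).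
  - apply: (emeasurable_esum cD) => [w x|w Dw].
      by apply: mule_ge0; [exact: b0|rewrite lee_fin indicE].
    exact: (measurable_funS measurableT (@subsetT _ _) (mt w Dw)).
  - move=> x Bx.
    have Dx : D (j%:Z, nearest cX j%:Z x) by split=> //; [exact: net_nearest|exists x].
    apply: le_trans (esum_term (a := fun w => (b w * (\1_(cell cX w) x)%:E)%E) Dx _).
      by rewrite indicE mem_set// mule1.
    by rewrite mule_ge0.
have bI0 w x : (0 <= b w * (\1_(cell cX w) x)%:E)%E.
  by apply: mule_ge0; [exact: b0|rewrite lee_fin indicE].
have mtB w : D w -> measurable_fun (ball x0 r : set M)
    (fun x => (b w * (\1_(cell cX w) x)%:E)%E).
  by move=> Dw; exact: (measurable_funS measurableT (@subsetT _ _) (mt w Dw)).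
rewrite (integral_esum (measure_of nu) cD (mball x0 r) bI0 mtB).
apply: (@le_trans _ _ (\esum_(w in D) \int[measure_of nu]_x (h \_ (vball w)) x)%E).
  apply: le_esum => w Dw; rewrite -integral_mkcond.
  rewrite ge0_integralZl//; last first.
    by apply/measurable_EFinP; apply: measurable_indic; exact: mcell.
  rewrite integral_indic//; last exact: mcell.
  have cw : (measure_of nu (cell cX w `&` ball x0 r) <= (fine (nu (vball w)))%:E)%E.
    rewrite fineK ?(vball_fin_num nuA)//; apply: le_outer_measure => x [cx _].
    exact: cell_vball cx.
  apply: le_trans (lee_wpmul2l (b0 w) cw) _.
  rewrite /b muleAC -EFinM mulVf ?mul1e// gt_eqF//.
  exact: (fine_vball_gt0 nuA).
have hm w : D w -> measurable_fun [set: M] (h \_ (vball w)).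
  move=> _; apply/(measurable_restrictT _ (measurable_vball nuA w)).
  exact: measurable_funS mh.
have hp w x : (0 <= (h \_ (vball w)) x)%E by rewrite patchE; case: ifP.
rewrite -integral_esum//.
rewrite -ge0_integralZl_EFin//; last exact: measurable_funS mh.
rewrite [leRHS]integral_mkcond; apply: ge0_le_integral => //.
- by move=> x _; apply: esum_ge0.
- exact: emeasurable_esum.
- apply/(measurable_restrictT _ (mball x0 (r + 2))).
  by apply: measurable_funeM; exact: measurable_funS mh.
- move=> x _; rewrite patchE; case: ifPn; rewrite ?inE ?notin_setE => Bx.
    have -> : \esum_(w in D) (h \_ (vball w)) x =
        \esum_(w in [set w | D w /\ vball w x]) h x.
      rewrite (esum_mkcondr D (fun w => vball w x)); apply: eq_esum => w _.
      rewrite patchE; case: (boolP (x \in vball w)); rewrite ?inE ?notin_setE => vx.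
        by rewrite mem_set.
      by rewrite memNset.
    apply: (at_most_esum (M := N)); [|exact: h0|by []].
    by apply: (at_most_sub _ (@HN x)) => w [[vw wj _] vx].
  rewrite esum1// => w Dw; rewrite patchE memNset// => vx.
  by apply: Bx; exact: D_sub Dw _ vx.
Qed.

End overlap.

Let overlap_bound : exists N : nat, forall j y,
  at_most N [set w | [/\ vertex X w, w.1 = j%:Z & vball w y]].
Proof.
have [N HN] := cX 2; exists N => j y.
rewrite -[N]muln1.
apply: (at_most_bind (f := snd) (A := [set xi | net X j%:Z xi /\ mdist xi y < rr j%:Z])).
- by move=> [n xi] /= [+ nj]; rewrite nj /vball ballEmdist /= -/(rr _).
- apply: (HN j%:Z) => [xi []//|xi eta [_ h1] [_ h2]].
  by have := metric_triangle xi y eta; rewrite (metric_sym y eta); lra.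
- move=> xi _; apply: at_most_subsingle => -[n x1] [n' x2] /= [[_ -> _] ->] [[_ -> _] ->] //.
Qed.

Lemma average_conv x0 r (t : R) : 0 < t -> exists N : nat, forall j, (N <= j)%N ->
  (\int[measure_of nu]_(x in ball x0 r) dev j x <= t%:E)%E.
Proof.
move=> t0; have [r0|r0] := ltP 0 r; last first.
  exists 0%N => j _; have -> : ball x0 r = set0.
    by apply/seteqP; split=> // y; rewrite ballEmdist /=; have := mdist_ge0 x0 y; lra.
  by rewrite integral_set0 lee_fin ltW.
have [N HN] := overlap_bound.
have N3 : 0 < N%:R + 2 :> R by rewrite ltr_wpDl.
(* The errors are N t' from averaging [g - phi], t' from [g - phi] itself, and t' from the variation
   of [phi] over small balls. *)
pose t' := t / (N%:R + 2); have t'0 : 0 < t' by rewrite divr_gt0.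
have r2 : 0 < r + 2 by rewrite addr_gt0.
have fB : (nu (ball x0 (r + 2)) < +oo)%E by have /andP[] := nuA.1.2 x0 _ r2.
have [phi [K [[K0 Kp] Hp]]] := lip_approx_integrable nuA.1.1 (mball x0 (r + 2)) fB mg
  (ig x0 (r + 2)) t'0.
have mp := lip_with_measurable nuA.1.1 (conj K0 Kp : lip_with K phi).
pose h x := `|g x - phi x|%:E.
have mh : measurable_fun [set: M] h.
  by apply/measurable_EFinP; apply: measurableT_comp => //; exact: measurable_funB.
have h0 x : (0 <= h x)%E by rewrite lee_fin.
pose m0 := fine (nu (ball x0 r)); have m00 : 0 <= m0 by exact: fine_ge0.
have Km : 0 < 2 * K * m0 + 1 by rewrite ltr_wpDl ?mulr_ge0.
have [n /andP[rn _]] := exists_level (divr_gt0 t'0 Km).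
exists `|n|%N => j nj.
have rj : 2 * K * rr j%:Z * m0 <= t'.
  have rjn : rr j%:Z <= rr n :> R.
    by apply: ler_rr; apply: le_trans (lez_abs n) _; rewrite lez_nat.
  have : rr j%:Z * (2 * K * m0 + 1) <= t'.
    by rewrite -ler_pdivlMr//; exact: le_trans rjn rn.
  have := @rr_gt0 R j%:Z; lra.
pose b v : \bar R := ((fine (nu (vball v)))^-1%:E * \int[measure_of nu]_(y in vball v) h y)%E.
have point_dev x : (dev j x <= b (j%:Z, nearest cX j%:Z x) + ((2 * K * rr j%:Z)%:E + h x))%E.
  set v := (j%:Z, nearest cX j%:Z x); have mv := measurable_vball nuA v.
  pose c := 2 * K * rr j%:Z + `|g x - phi x|.
  have c0 : 0 <= c by rewrite addr_ge0 ?mulr_ge0 ?rr_ge0.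
  have iv : (measure_of nu).-integrable (vball v) (EFin \o g) by exact: ig.
  have mH : measurable_fun [set: M] (fun y => h y + c%:E)%E by exact: emeasurable_funD.
  have H0 y : (0 <= h y + c%:E)%E by rewrite adde_ge0 ?lee_fin.
  have Hd y : vball v y -> (`|g y - g x|%:E <= h y + c%:E)%E.
    rewrite /vball ballEmdist /= -/(rr _) => vy.
    rewrite -EFinD lee_fin /c.
    have dxy : mdist x y <= 2 * rr j%:Z.
      have := mdist_nearest cX j%:Z x; have := metric_triangle x (nearest cX j%:Z x) y.
      have := @rr_gt0 R j%:Z; lra.
    have Kd := ler_wpM2l K0 dxy.
    have pd : `|phi y - phi x| <= K * mdist x y.
      by rewrite ler_norml; have := Kp x y; have := Kp y x; rewrite (metric_sym y x); lra.
    have d1 := ler_distD (phi y) (g y) (g x); have d2 := ler_distD (phi x) (phi y) (g x).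
    by rewrite (distrC (phi x)) in d2; lra.
  apply: le_trans (average_dev nuA iv mH H0 Hd) _.
  rewrite ge0_integralD//; last exact: measurable_funS mh.
  rewrite integral_cst//.
  have nv := fine_vball_gt0 nuA v; set a := fine _ in nv *.
  have nE : (measure_of nu (vball v) = a%:E)%E by exact: esym (fineK (vball_fin_num nuA v)).
  have i0 : (0 <= \int[measure_of nu]_(y in vball v) h y)%E by exact: integral_ge0.
  rewrite nE ge0_muleDr ?mule_ge0 ?lee_fin ?(ltW nv)//.
  apply: leeD; first exact: le_refl.
  rewrite -!EFinM /h -EFinD lee_fin mulrCA mulVf ?mulr1// gt_eqF//.
have mb : measurable_fun [set: M] (fun x => b (j%:Z, nearest cX j%:Z x)).
  exact: (measurable_nearest_comp nuA.1.1 cX j%:Z (fun xi => b (j%:Z, xi))).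
have b0 v : (0 <= b v)%E.
  rewrite mule_ge0 ?integral_ge0// lee_fin invr_ge0 ltW//.
  exact: (fine_vball_gt0 nuA).
have Kr : 0 <= 2 * K * rr j%:Z by rewrite !mulr_ge0 ?rr_ge0.
apply: (@le_trans _ _ (\int[measure_of nu]_(x in ball x0 r)
   (b (j%:Z, nearest cX j%:Z x) + ((2 * K * rr j%:Z)%:E + h x)))%E).
  apply: ge0_le_integral => //.
  - by move=> x _; rewrite lee_fin.
  - exact: measurable_funS (mdev j).
  - apply: emeasurable_funD; first exact: measurable_funS mb.
    by apply: emeasurable_funD => //; exact: measurable_funS mh.
rewrite ge0_integralD//; last 3 first.
- exact: measurable_funS mb.
- by move=> x _; rewrite adde_ge0 ?lee_fin.
- by apply: emeasurable_funD => //; exact: measurable_funS mh.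
rewrite ge0_integralD//; last exact: measurable_funS mh.
rewrite integral_cst//.
have mE : (measure_of nu (ball x0 r) = m0%:E)%E by exact: esym (fineK (ball_fin_num nuA x0 r0)).
rewrite mE.
have p1 := nearest_averages x0 r h0 mh (HN j).
have p2 : (\int[measure_of nu]_(x in ball x0 r) h x <= t'%:E)%E.
  apply: le_trans Hp; apply: ge0_subset_integral => //; first exact: measurable_funS mh.
  by move=> x; rewrite !ballEmdist /=; lra.
have p3 : (N%:R%:E * \int[measure_of nu]_(x in ball x0 (r + 2)) h x <= N%:R%:E * t'%:E)%E.
  by apply: lee_wpmul2l => //; rewrite lee_fin.
apply: (@le_trans _ _ (N%:R%:E * t'%:E + (t'%:E + t'%:E))%E).
  apply: leeD; first exact: le_trans p1 p3.
  by apply: leeD => //; rewrite -EFinM lee_fin.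
rewrite -EFinM -!EFinD lee_fin /t' le_eqVlt; apply/orP; left; apply/eqP.
by field; rewrite gt_eqF.
Qed.

(** The lemma identifies the limit where it exists; existence comes from [emax_limit]. By Fatou, the
    local L^1 convergence of [average_conv] forces the lower limit of the deviations to vanish
    almost everywhere. *)
Lemma averages_limit : {ae measure_of nu, forall x, forall l : R,
  (forall t : R, 0 < t -> exists N : nat, forall j, (N <= j)%N ->
     `|average (j%:Z, nearest cX j%:Z x) - l| < t) -> l = g x}.
Proof.
pose L x := limn_einf (fun j => dev j x).
have dev0 j x : (0 <= dev j x)%E by rewrite lee_fin.
have mL : measurable_fun [set: M] L.
  have -> : L = (fun x => - limn_esup (fun j => - dev j x))%E.
    by apply/funext => x; rewrite (limn_esupN (fun j => dev j x)) oppeK.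
  apply: measurableT_comp => //; apply: measurable_fun_limn_esup => j.
  exact: measurableT_comp.
have L_ge0 x : (0 <= L x)%E.
  rewrite /L limn_einf_lim; apply: lime_ge; first exact: is_cvg_einfs.
  by apply: nearW => n; apply: le_ereal_inf_tmp => _ [j _ <-].
have : {ae measure_of nu, forall x, forall n : nat, ball (point : T) n.+1%:R x -> L x = 0%E}.
  apply: ae_foralln => n; set B := ball _ _; have mB : measurable (B : set M) by exact: mball.
  apply/(ae_eq_integral_abs (measure_of nu) mB (measurable_funS measurableT (@subsetT _ _) mL)).
  apply/eqP; rewrite eq_le; apply/andP; split; last by apply: integral_ge0.
  have mdB j : measurable_fun (B : set M) (dev j) by exact: measurable_funS (mdev j).
  have := fatou (measure_of nu) mB mdB (fun j x _ => dev0 j x).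
  have cv : (fun j => \int[measure_of nu]_(x in B) dev j x)%E @ \oo --> 0%E.
    have fin (t : R) : 0 < t -> exists N : nat, forall j, (N <= j)%N ->
      (\int[measure_of nu]_(x in B) dev j x <= t%:E)%E by exact: average_conv.
    have I0 j : (0 <= \int[measure_of nu]_(x in B) dev j x)%E by exact: integral_ge0.
    apply/fine_cvgP; split.
      have [N HN] := fin 1 ltr01; exists N => // j /= Nj.
      by rewrite ge0_fin_numE// (le_lt_trans (HN j Nj)) ?ltry.
    apply/cvgrPdist_le => t t0; have [N HN] := fin t t0; exists N => // j /= Nj.
    rewrite sub0r normrN ger0_norm ?fine_ge0// -lee_fin fineK ?HN//.
    by rewrite ge0_fin_numE// (le_lt_trans (HN j Nj)) ?ltry.
  rewrite (cvg_limn_einf_sup cv).1; apply: le_trans.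
  rewrite le_eqVlt; apply/orP; left; apply/eqP; apply: eq_integral => x _.
  by rewrite gee0_abs.
move=> [A [mA A0 AP]]; exists A; split=> // x nx; apply: AP => H; apply: nx => l Hl.
have Lx : L x = 0%E.
  apply: (H (Num.bound (mdist point x))).
  rewrite ballEmdist /=; apply: lt_trans (archi_boundP _) _; first exact: mdist_ge0.
  by rewrite ltr_nat.
have cv : (fun j => dev j x) @ \oo --> `|l - g x|%:E.
  apply/fine_cvgP; split; first by exists 0%N.
  apply/cvgrPdist_le => t t0; have [N HN] := Hl t t0; exists N => // j /= Nj.
  apply: le_trans (ler_dist_dist _ _) _.
  have -> : l - g x - (average (j%:Z, nearest cX j%:Z x) - g x) =
    l - average (j%:Z, nearest cX j%:Z x) by ring.
  by rewrite distrC ltW// HN.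
have := (cvg_limn_einf_sup cv).1; rewrite -/(L x) Lx => -[/esym/eqP].
by rewrite normr_eq0 subr_eq0 => /eqP.
Qed.

End averages_limit.

(** * The extension operator *)

Section emax_limit.
Context {R : realType} {T : pmetricType R} (X : hyperbolic_filling T) (a : R).
Hypothesis a0 : 0 < a.
Hypothesis cX : net_count X.
Implicit Types (u : int * T -> R[i]) (v w : int * T) (x : T).

Lemma emax_ladder (A : R) : 0 < A -> exists2 K : R, 0 <= K & forall u x B, 0 <= B ->
  (emax id X a (A + 1) u x <= B%:E)%E -> forall v w, net X v.1 v.2 -> net X w.1 w.2 ->
  v.1 <= w.1 -> mdist x v.2 < A * rr v.1 -> mdist x w.2 < A * rr w.1 ->
  normc (u v - u w) <= K * B * rr v.1 `^ a.
Proof.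
move=> A0; have A4 : 0 < 4 * A by rewrite mulr_gt0.
have [n /andP[_ rn]] := exists_level A4.
have L0 := ladder_const_gt0 a0.
(* Shifting the level of [v] by [d] enlarges its radius at least 4A times; as [v] and [w] are within
   2A radii of each other, that is at most half the new radius, as [ladder] asks. *)
have [d d0 rd] : exists2 d : int, d <= 0 & 4 * A <= rr d.
  exists (Num.min (n - 1) 0); first by rewrite ge_min lexx orbT.
  have h : rr (n - 1) <= rr (Num.min (n - 1) 0) :> R by apply: ler_rr; rewrite ge_min lexx.
  have : rr (n - 1 + 1) = rr (n - 1) / 2 :> R by exact: rrS.
  by rewrite subrK; lra.
exists ((2 * ladder_const a + 1) * rr d `^ a).
  by rewrite mulr_ge0 ?powR_ge0// addr_ge0// mulr_ge0// ltW.
move=> u x B B0 uB [n1 x1] [n2 x2] /= nv nw vw xv xw; pose m := n1 + d.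
have mv : m <= n1 by rewrite /m gerDl.
have rm : rr m = rr n1 * rr d :> R by exact: rrD.
have r1 := @rr_gt0 R n1; have r21 : rr n2 <= rr n1 :> R by exact: ler_rr.
have Ar := ler_wpM2l (ltW A0) r21.
have below k xi : mdist x xi < A * rr k -> edges_below X u a B m k xi.
  move=> xk e ee /andP[_ ek] d1; apply: (emax_edge ee _ uB).
  have rk : rr k <= rr e.1.1 :> R by exact: ler_rr.
  have := ler_wpM2l (ltW A0) rk; have := metric_triangle x xi e.1.2; lra.
have dd : mdist x1 x2 <= rr m / 2.
  rewrite rm; have := ler_wpM2r (ltW r1) rd.
  have := metric_triangle x1 x x2; rewrite (metric_sym x1 x); lra.
have := @ladder _ _ X u a B m a0 B0 (n1, x1) (n2, x2) nv nw mv (le_trans mv vw) dd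
  (below _ _ xv) (below _ _ xw).
rewrite rm powRM ?rr_ge0// => /le_trans; apply.
by rewrite le_eqVlt; apply/orP; left; apply/eqP; ring.
Qed.

Let sum_levels N : \sum_(j < N) rr j%:Z `^ a =
  ladder_const a * (rr 0 `^ a - rr N%:Z `^ a) :> R.
Proof.
elim: N => [|N IH]; first by rewrite big_ord0 subrr mulr0.
rewrite big_ord_recr /= IH [X in _ + X](ladder_constE a0) -addn1 PoszD; ring.
Qed.

(** Where the maximal function is finite, [u] is a Cauchy sequence along the vertices owning [x],
    and the Hoelder rate passes to the limit for every vertex in the cone of aperture [A] over
    [x]. *)
Lemma emax_limit (A : R) : 1 <= A -> exists2 K : R, 0 <= K & forall u x B, 0 <= B ->
  (emax id X a (A + 1) u x <= B%:E)%E -> exists l : R[i],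
  (forall t : R, 0 < t -> exists N : nat, forall j : nat, (N <= j)%N ->
    normc (u (j%:Z, nearest cX j%:Z x) - l) < t) /\
  forall v, net X v.1 v.2 -> mdist x v.2 < A * rr v.1 ->
    normc (u v - l) <= K * B * rr v.1 `^ a.
Proof.
move=> A1; have A0 : 0 < A by exact: lt_le_trans A1.
have [K K0 HK] := emax_ladder A0; exists K => // u x B B0 uB.
have L0 := ladder_const_gt0 a0.
have near (j : nat) : mdist x (nearest cX j%:Z x) < A * rr j%:Z.
  have := mdist_nearest cX j%:Z x; have rj := @rr_gt0 R j%:Z.
  by have := ler_wpM2r (ltW rj) A1; lra.
have net (j : nat) := net_nearest cX j%:Z x.
have [j|N|l [ul _]] := @complex_telescope R (fun j : nat => u (j%:Z, nearest cX j%:Z x))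
    (fun j : nat => K * B * rr j%:Z `^ a) (K * B * (ladder_const a * rr 0 `^ a)).
- rewrite normc_sub.
  apply: (HK u x B B0 uB (j%:Z, nearest cX j%:Z x) (j.+1%:Z, nearest cX j.+1%:Z x)) => //=.
  by rewrite lez_nat.
- rewrite /= -mulr_sumr sum_levels ler_wpM2l ?mulr_ge0//.
  by rewrite ler_wpM2l ?(ltW L0)// gerBl powR_ge0.
exists l; split=> // v nv xv; apply/ler_addgt0Pl => t t0.
have [N HN] := ul t t0; pose j := maxn N `|v.1|%N.
have vj : v.1 <= j%:Z by rewrite /j; lia.
have h1 := HK u x B B0 uB v (j%:Z, nearest cX j%:Z x) nv (net j) vj xv (near j).
have h2 := HN j (leq_maxl _ _).
apply: le_trans (normc_triangle (u (j%:Z, nearest cX j%:Z x)) _ _) _.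
by rewrite addrC; apply: lerD => //; exact: ltW.
Qed.

End emax_limit.

Section complex_extension.
Context {R : realType} {Z T : pmetricType R} (i : T -> Z).
Hypothesis iso : forall x y, mdist (i x) (i y) = mdist x y.
Hypothesis clF : closed (range i).
Variable X : hyperbolic_filling T.
Hypothesis cX : net_count X.
Implicit Types (u : int * T -> R[i]) (v w : int * T) (x : T) (y z : Z).

Definition cextend u y : R[i] :=
  Complex (extend iso clF cX (fun v => complex.Re (u v)) y)
          (extend iso clF cX (fun v => complex.Im (u v)) y).

Lemma cextend_lin (c : R[i]) u u' y :
  cextend (fun v => c * u v + u' v) y = c * cextend u y + cextend u' y.
Proof.
rewrite /cextend; case: c => c d.
have E (h h1 h2 h3 : int * T -> R) b1 b2 :
    h = (fun v => 1 * (b1 * h1 v + b2 * h2 v) + 1 * h3 v) ->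
    extend iso clF cX h y = b1 * extend iso clF cX h1 y + b2 * extend iso clF cX h2 y +
      extend iso clF cX h3 y.
  by move=> ->; rewrite !extendD !mul1r.
rewrite (E (fun v => complex.Re (Complex c d * u v + u' v))
  (fun v => complex.Re (u v)) (fun v => complex.Im (u v))
  (fun v => complex.Re (u' v)) c (- d)); last first.
  apply/funext => v; case: (u v) => p q; case: (u' v) => p' q'.
  by transitivity (c * p - d * q + p'); [reflexivity|rewrite /= !mul1r mulNr].
rewrite (E (fun v => complex.Im (Complex c d * u v + u' v))
  (fun v => complex.Re (u v)) (fun v => complex.Im (u v))
  (fun v => complex.Im (u' v)) d c); last first.
  apply/funext => v; case: (u v) => p q; case: (u' v) => p' q'.
  by transitivity (c * q + d * p + q'); [reflexivity|rewrite /= !mul1r [c * q + _]addrC].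
by apply/eqP; rewrite eq_complex /= mulNr [X in _ && (X + _ == _)]addrC !eqxx.
Qed.

Lemma cextend_cst (c : R[i]) y : ~ range i y -> cextend (fun=> c) y = c.
Proof. by move=> yF; rewrite /cextend !extend_cst//; case: c. Qed.

Lemma cmeasurable_cextend (mu : {outer_measure set Z -> \bar R}) u :
  borel_regular mu -> cmeasurable mu (cextend u).
Proof. by move=> mur; split; exact: measurable_extend. Qed.

(** On the range the extension has a default value, so the gradient is set to infinity there at no
    cost in L^p. The factor 2 accounts for real and imaginary parts. *)
Definition cextend_gradient u y : \bar R :=
  if y \in range i then +oo%E else ((2 * gradient_const iso clF cX)%:E * emax i X 1 6 u y)%E.

Let G0 := gradient_const_gt0 iso clF cX.

Lemma cextend_gradient_ge0 u y : (0 <= cextend_gradient u y)%E.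
Proof.
rewrite /cextend_gradient; case: ifP => // _.
by rewrite mule_ge0 ?emax_ge0// lee_fin mulr_ge0// ltW.
Qed.

Lemma cextend_gradientP u y z : ((normc (cextend u y - cextend u z))%:E <=
  (mdist y z)%:E * (cextend_gradient u y + cextend_gradient u z))%E.
Proof.
have [->|yz] := eqVneq y z.
  by rewrite subrr normc0 mdistxx mul0e.
have dyz : 0 < mdist y z by rewrite mdist_gt0.
have gy := cextend_gradient_ge0 u y; have gz := cextend_gradient_ge0 u z.
have [yF|yF] := pselect (range i y).
  rewrite {1}/cextend_gradient mem_set// addye ?gt0_muley ?lte_fin ?leey//.
  by rewrite -ltNye (lt_le_trans _ gz).
have [zF|zF] := pselect (range i z).
  rewrite {2}/cextend_gradient (mem_set zF) addey ?gt0_muley ?lte_fin ?leey//.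
  by rewrite -ltNye (lt_le_trans _ gy).
rewrite /cextend_gradient !memNset//.
have dRe : (`|complex.Re (cextend u y) - complex.Re (cextend u z)|%:E <= (mdist y z)%:E *
    ((gradient_const iso clF cX)%:E * emax i X 1 6 u y +
     (gradient_const iso clF cX)%:E * emax i X 1 6 u z))%E.
  by apply: extend_gradient => // v w; rewrite -ReB; exact: normc_Re.
have dIm : (`|complex.Im (cextend u y) - complex.Im (cextend u z)|%:E <= (mdist y z)%:E *
    ((gradient_const iso clF cX)%:E * emax i X 1 6 u y +
     (gradient_const iso clF cX)%:E * emax i X 1 6 u z))%E.
  by apply: extend_gradient => // v w; rewrite -ImB; exact: normc_Im.
have e1 := emax_ge0 i X 1 6 u y; have e2 := emax_ge0 i X 1 6 u z.
move: (gradient_const _ _ _) G0 (emax i X 1 6 u y) (emax i X 1 6 u z) e1 e2 dRe dIm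
  => G G1 a b a0 b0 dRe dIm.
have Ga : (0 <= G%:E * a)%E by rewrite mule_ge0// lee_fin ltW.
have Gb : (0 <= G%:E * b)%E by rewrite mule_ge0// lee_fin ltW.
have -> : ((2 * G)%:E * a + (2 * G)%:E * b =
    (G%:E * a + G%:E * b) + (G%:E * a + G%:E * b))%E.
  have -> : 2 * G = G + G by ring.
  by rewrite EFinD !ge0_muleDl ?lee_fin ?(ltW G1)// addeACA.
rewrite ge0_muleDr ?adde_ge0//; apply: le_trans (leeD dRe dIm).
by rewrite -EFinD lee_fin -ReB -ImB; exact: normc_ReIm.
Qed.

Lemma measurable_cextend_gradient (mu : {outer_measure set Z -> \bar R}) u :
  borel_regular mu -> measurable_fun [set: caratheodory_type mu] (cextend_gradient u).
Proof.
move=> mur; apply: measurable_fun_ifT => //.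
  apply: (measurable_fun_bool true) => /=.
  rewrite setTI (_ : _ @^-1` _ = range i); first exact: closed_measurable_cara.
  by apply/seteqP; split=> y h; [exact: set_mem h|exact: mem_set h].
by apply: measurable_funeM; exact: measurable_emax.
Qed.

Lemma cextend_gradient_integral (mu : {outer_measure set Z -> \bar R}) (Q p : R) :
  0 < Q -> 0 < p -> (exists x y : T, x <> y) -> ahlfors_regular Q mu -> porous (range i) ->
  exists2 C : R, 0 <= C & forall u, (\int[measure_of mu]_y (cextend_gradient u y `^ p) <=
    C%:E * energy X p (Q - p) u)%E.
Proof.
move=> Q0 p0 T2 muA por; have mur := muA.1.1.
have [C C0 HC] : exists2 C : R, 0 < C & forall z r, 0 < r -> (mu (ball z r) <= (C * r `^ Q)%:E)%E.
  apply: ahlfors_upper Q0 muA _; have [x [y xy]] := T2; exists (i x), (i y) => ixy.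
  by apply: xy; apply: mdist_positivity; rewrite -iso ixy mdistxx.
have F0 := porous_measure0 iso T2 Q0 muA por cX.
have G2 : 0 <= 2 * gradient_const iso clF cX by rewrite mulr_ge0// ltW.
exists ((2 * gradient_const iso clF cX) `^ p * (C * 6 `^ Q)).
  by rewrite !mulr_ge0 ?powR_ge0// ltW.
move=> u.
have six : 0 < 6 :> R by [].
have IE := integral_emax i 1 p0 six cX mur C0 HC u.
rewrite mul1r in IE.
have mE := measurable_emax i X 1 6 mur u.
have mP : measurable_fun [set: caratheodory_type mu] (fun y => (emax i X 1 6 u y `^ p)%E).
  exact: (measurableT_comp (measurable_poweR _)).
rewrite EFinM -muleA; apply: le_trans (lee_wpmul2l _ IE); last by rewrite lee_fin powR_ge0.
rewrite -ge0_integralZl_EFin ?powR_ge0//; last by move=> y _; exact: poweR_ge0.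
have mA : measurable_fun [set: caratheodory_type mu] (fun y => (cextend_gradient u y `^ p)%E).
  apply: (measurableT_comp (measurable_poweR _)) => //.
  exact: measurable_cextend_gradient.
have mB : measurable_fun [set: caratheodory_type mu]
    (fun y => (((2 * gradient_const iso clF cX) `^ p)%:E * emax i X 1 6 u y `^ p)%E).
  exact: measurable_funeM.
have AB : ae_eq (measure_of mu) [set: caratheodory_type mu]
    (fun y => (cextend_gradient u y `^ p)%E)
    (fun y => (((2 * gradient_const iso clF cX) `^ p)%:E * emax i X 1 6 u y `^ p)%E).
  exists (range i); split; [exact: closed_measurable_cara|exact: F0|].
  move=> y /= ny; apply: contrapT => yF; apply: ny => _.
  by rewrite /cextend_gradient memNset// poweRM ?lee_fin ?emax_ge0// poweR_EFin.
by rewrite (ae_eq_integral _ _ measurableT mA mB AB).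
Qed.

(** A point of the hole at level n has distance to the range between [hole_ratio] rr and rr / 8, so
    its active vertices have comparable radius and lie within 2 / [hole_ratio] + 5 of their radii
    from [x]. On holes of large level the exceptional set is empty. *)
Lemma cextend_trace_lim (mu : {outer_measure set Z -> \bar R}) (Q : R) (por : porous (range i))
    (u : int * T -> R[i]) (a K B : R) x (l : R[i]) :
  0 < a -> 0 <= K -> 0 <= B -> (exists x y : T, x <> y) ->
  (forall v, net X v.1 v.2 -> mdist x v.2 < (2 / hole_ratio por + 5) * rr v.1 ->
    normc (u v - l) <= K * B * rr v.1 `^ a) ->
  trace_lim mu por cX (cextend u) x l.
Proof.
move=> a0 K0 B0 T2 ul t t0; have h0 := hole_ratio_gt0 por.
have [n1 fn1] := exists_fine_level T2.
have KB : 0 < 2 * (K * B) + 1 by rewrite ltr_wpDl ?mulr_ge0.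
(* Chosen so that (2 K B + 1) r^a = t; the 2 serves the two parts of a complex number, the 1 keeps
   the divisor positive. *)
pose r := (t / (2 * (K * B) + 1)) `^ a^-1.
have r0 : 0 < r by rewrite powR_gt0// divr_gt0.
have [n2 /andP[rn2 _]] := exists_level r0.
exists (Num.max n1 n2) => n; rewrite ge_max => /andP[n1n n2n].
have fn : fine_level (T := T) n by exact: fine_level_le fn1.
have rn : 2 * (K * B * rr n `^ a) <= t.
  have h : rr n `^ a <= t / (2 * (K * B) + 1).
    have rnr : rr n <= r by apply: le_trans rn2; exact: ler_rr.
    have := ge0_ler_powR (ltW a0) (rr_ge0 n : rr n \is Num.nneg) (ltW r0 : r \is Num.nneg) rnr.
    rewrite /r -powRrM mulVf ?gt_eqF// powRr1// divr_ge0// ltW//.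
  rewrite ler_pdivlMr// in h; have := powR_ge0 (rr n) a.
  move: (K * B) (rr n `^ a) h => kb q h q0; lra.
rewrite (_ : _ `&` _ = set0) ?outer_measure0 ?mule_ge0 ?lee_fin ?(ltW t0)//.
apply/seteqP; split=> // y [hy /=]; apply/negP; rewrite -leNgt.
have hn := hole_near iso (fn : fine_level (T := T) (n, nearest cX n x).1) hy.
have hf (x1 : T) := hole_far iso x1 (fn : fine_level (T := T) (n, nearest cX n x).1) hy.
rewrite /= in hn hf; have rn0 := @rr_gt0 R n.
have hr0 : 0 < hole_ratio por * rr n by rewrite mulr_gt0.
have yF : ~ range i y.
  by move=> [z _ zy]; have := hf z; rewrite zy mdistxx leNgt hr0.
have dl := dist_to_le i y (nearest cX n x); have dg := dist_to_ge hf.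
have dev v : active i X v y -> normc (u v - l) <= K * B * rr n `^ a.
  case: v => m eta av; have [a1 a2 a3] := activeP av; have [nv _] := av.
  rewrite /= in a1 a2 a3; have rm := @rr_gt0 R m.
  have mn : rr m <= rr n :> R by lra.
  have xv : mdist x eta < (2 / hole_ratio por + 5) * rr m.
    have t1 := metric_triangle x (nearest cX n x) eta.
    rewrite -[mdist (nearest cX n x) eta]iso in t1.
    have t2 := metric_triangle (i (nearest cX n x)) y (i eta).
    rewrite (metric_sym _ y) in t2; have t3 := mdist_nearest cX n x.
    have : rr n * hole_ratio por <= 5 / 2 * rr m by lra.
    rewrite -ler_pdivlMr// => h5.
    rewrite mulrDl; have -> : 2 / hole_ratio por * rr m = 4 / 5 * (5 / 2 * rr m / hole_ratio por).
      by field; rewrite gt_eqF.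
    lra.
  apply: le_trans (ul (m, eta) nv xv) _; rewrite ler_wpM2l ?mulr_ge0//=.
  by apply: ge0_ler_powR; rewrite ?nnegrE ?rr_ge0// ltW.
have dRe : `|complex.Re (cextend u y) - complex.Re l| <= K * B * rr n `^ a.
  by apply: extend_dev => // v /dev; apply: le_trans; rewrite -ReB; exact: normc_Re.
have dIm : `|complex.Im (cextend u y) - complex.Im l| <= K * B * rr n `^ a.
  by apply: extend_dev => // v /dev; apply: le_trans; rewrite -ImB; exact: normc_Im.
apply: le_trans (normc_ReIm _) _; rewrite ReB ImB.
by move: dRe dIm rn; move: (`|_|) (`|_|) (K * B * _) => c d e; lra.
Qed.


End complex_extension.

(** * The trace operator *)

Lemma ae_imply2 d (U : measurableType d) (R : realType) (m : {measure set U -> \bar R})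
    (P P' S : U -> Prop) : {ae m, forall x, P x} -> {ae m, forall x, P' x} ->
  (forall x, P x -> P' x -> S x) -> {ae m, forall x, S x}.
Proof.
move=> aeP aeP' H; apply: negligibleS (negligibleU aeP aeP') => x nS.
apply: contrapT => /not_orP[nA nB]; apply: nS; apply: H.
  by apply: contrapT => nP; apply: nA.
by apply: contrapT => nP; apply: nB.
Qed.

Lemma poweR_root_le {R : realType} (p C : R) (x y : \bar R) : 0 < p -> 0 <= C ->
  (0 <= x)%E -> (0 <= y)%E -> (x `^ p <= C%:E * y `^ p)%E -> (x <= (C `^ p^-1)%:E * y)%E.
Proof.
move=> p0 C0 x0 y0 xy; have pn0 : p != 0 by rewrite gt_eqF.
rewrite -(poweRKV pn0 x0) -(poweRKV pn0 y0) -poweR_EFin -poweRM ?lee_fin ?poweR_ge0//.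
by apply: le_poweR2 xy; rewrite ?poweR_ge0// invr_ge0 ltW.
Qed.

Lemma le_mul_ereal_inf {R : realType} (C : R) (x : \bar R) (S : set (\bar R)) : 0 < C ->
  (forall y, S y -> (x <= C%:E * y)%E) -> (x <= C%:E * ereal_inf S)%E.
Proof.
move=> C0 H; rewrite -lee_pdivrMl//; apply: le_ereal_inf_tmp => y Sy.
by rewrite lee_pdivrMl//; exact: H.
Qed.

Section vaverage_linear.
Context {R : realType} {T : pmetricType R}.
Variables (nu : {outer_measure set T -> \bar R}) (s : R).
Hypothesis nuA : ahlfors_regular s nu.
Implicit Types (v : int * T) (f g : T -> R[i]).

Let mv v := measurable_vball nuA v.

Let lin3 v (b d : R) (h1 h2 h3 : T -> R) :
  (measure_of nu).-integrable (vball v) (EFin \o h1) ->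
  (measure_of nu).-integrable (vball v) (EFin \o h2) ->
  (measure_of nu).-integrable (vball v) (EFin \o h3) ->
  \int[measure_of nu]_(x in vball v) (b * h1 x + d * h2 x + h3 x) =
  b * \int[measure_of nu]_(x in vball v) h1 x + d * \int[measure_of nu]_(x in vball v) h2 x +
  \int[measure_of nu]_(x in vball v) h3 x.
Proof.
move=> i1 i2 i3.
have I1 : (measure_of nu).-integrable (vball v) (EFin \o (fun x => b * h1 x)).
  exact: (integrableZl (mv v) b i1).
have I2 : (measure_of nu).-integrable (vball v) (EFin \o (fun x => d * h2 x)).
  exact: (integrableZl (mv v) d i2).
have I12 : (measure_of nu).-integrable (vball v) (EFin \o (fun x => b * h1 x + d * h2 x)).
  exact: (integrableD (mv v) I1 I2).
rewrite (RintegralD (mv v) I12 i3) (RintegralD (mv v) I1 I2).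
by rewrite (RintegralZl b (mv v) i1) (RintegralZl d (mv v) i2).
Qed.

Lemma vaverage_lin (a : R[i]) f g v : L1loc nu f -> L1loc nu g ->
  vaverage nu (fun x => a * f x + g x) v = a * vaverage nu f v + vaverage nu g v.
Proof.
move=> [_ /(_ v.2 ((2 : R) ^ (- v.1)))[fRe fIm]] [_ /(_ v.2 ((2 : R) ^ (- v.1)))[gRe gIm]].
case: a => b d; set a := Complex b d.
have reE (z w : R[i]) : complex.Re (a * z + w) =
    b * complex.Re z + (- d) * complex.Im z + complex.Re w.
  by rewrite mulNr; case: z; case: w.
have imE (z w : R[i]) : complex.Im (a * z + w) =
    b * complex.Im z + d * complex.Re z + complex.Im w.
  by case: z; case: w.
have eqC (z w : R[i]) : complex.Re z = complex.Re w -> complex.Im z = complex.Im w -> z = w.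
  by case: z w => [? ?] [? ?] /= -> ->.
apply: eqC.
  rewrite reE !vaverage_Re vaverage_Im; under eq_Rintegral do rewrite reE.
  by rewrite (lin3 b (- d) fRe fIm gRe) !mulrDr !(mulrCA (fine _)^-1).
rewrite imE !vaverage_Im vaverage_Re; under eq_Rintegral do rewrite imE.
by rewrite (lin3 b d fIm fRe gIm) !mulrDr !(mulrCA (fine _)^-1).
Qed.

Lemma vaverage_ae f g v : cmeasurable nu f -> cmeasurable nu g -> ae_equal nu f g ->
  vaverage nu f v = vaverage nu g v.
Proof.
move=> [fRe fIm] [gRe gIm] [N [mN N0 NP]].
have part (h : R[i] -> R) : measurable_fun [set: caratheodory_type nu] (fun x => h (f x)) ->
    measurable_fun [set: caratheodory_type nu] (fun x => h (g x)) ->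
    \int[measure_of nu]_(x in vball v) h (f x) = \int[measure_of nu]_(x in vball v) h (g x).
  move=> mf mg; rewrite /Rintegral; congr fine; apply: ae_eq_integral (mv v) _ _ _.
  - by apply/measurable_EFinP; exact: measurable_funS mf.
  - by apply/measurable_EFinP; exact: measurable_funS mg.
  - exists N; split=> // x /= nx; apply: NP => fgx; apply: nx => _.
    by rewrite fgx.
by rewrite /vaverage /cintegral (part (@complex.Re R) fRe gRe) (part (@complex.Im R) fIm gIm).
Qed.

Lemma vaverage_cst (c : R[i]) v : vaverage nu (fun=> c) v = c.
Proof.
have nv : fine (nu (vball v)) != 0 by rewrite gt_eqF// (fine_vball_gt0 nuA).
have E (b : R) : (fine (nu (vball v)))^-1 * (b * fine (nu (vball v))) = b.
  by rewrite mulrCA mulVf// mulr1.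
have eqC (z w : R[i]) : complex.Re z = complex.Re w -> complex.Im z = complex.Im w -> z = w.
  by case: z w => [? ?] [? ?] /= -> ->.
by apply: eqC; rewrite ?vaverage_Re ?vaverage_Im (Rintegral_cst _ (mv v)); exact: E.
Qed.

(** The factor 1 gives the right-hand side the shape of [cextend_lin]. *)
Lemma vaverage_ae_cst (c : R[i]) f g v : L1loc nu f -> L1loc nu g ->
  ae_equal nu (fun x => f x - g x) (fun=> c) -> vaverage nu f v = 1 * vaverage nu g v + c.
Proof.
move=> Lf Lg fg; have [[fRe fIm] _] := Lf; have [[gRe gIm] _] := Lg.
have E : (fun x => f x - g x) = (fun x => -1 * g x + f x).
  by apply/funext => x; rewrite mulN1r addrC.
have := vaverage_lin (-1) v Lg Lf; rewrite -E (vaverage_ae (g := fun=> c) v _ _ fg).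
- by rewrite vaverage_cst mulN1r mul1r => ->; rewrite addrA subrr add0r.
- split.
    under eq_fun do rewrite ReB.
    exact: measurable_funB.
  under eq_fun do rewrite ImB.
  exact: measurable_funB.
- by split; exact: measurable_cst.
Qed.

End vaverage_linear.

Section trace_operator.
Context {R : realType} {Z T : pmetricType R} (i : T -> Z).
Hypothesis iso : forall x y, mdist (i x) (i y) = mdist x y.
Hypothesis T2 : exists x y : T, x <> y.
Variables (mu : {outer_measure set Z -> \bar R}) (Q p : R).
Hypothesis Q0 : 0 < Q.
Hypothesis p0 : 0 < p.
Hypothesis muA : ahlfors_regular Q mu.
Hypothesis por : porous (range i).
Variables (nu : {outer_measure set T -> \bar R}) (s : R).
Hypothesis s0 : 0 < s.
Hypothesis nuA : ahlfors_regular s nu.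
Hypothesis pQs : Q - s < p.
Hypothesis psQ : Q < s * p + p.
Variable X : hyperbolic_filling T.
Hypothesis cX : net_count X.

Lemma trace_bound : exists2 C : R, 0 <= C & forall (f : Z -> R[i]) (g : Z -> \bar R),
  (forall y, 0 <= g y)%E -> measurable_fun [set: caratheodory_type mu] g ->
  (\int[measure_of mu]_y (g y `^ p) < +oo)%E ->
  (forall y z, (normc (f y - f z))%:E <= (mdist y z)%:E * (g y + g z))%E ->
  [/\ L1loc nu (trace mu por cX f),
    (energy X p (Q - p) (vaverage nu (trace mu por cX f)) <=
      C%:E * \int[measure_of mu]_y (g y `^ p))%E &
    {ae measure_of nu, forall x, trace_lim mu por cX f x (trace mu por cX f x)}].
Proof.
have [cW cW0 HW] := hole_lower iso muA por.
have [M M0 HM] := hole_integral iso Q0 muA por cX.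
have [C1 C10 HC1] := energy_vaverage s0 nuA T2 cX p0 pQs psQ.
have [k fk] := exists_fine_level T2.
pose K : R := 36 * 2 `^ p^-1; have kap0 : 0 < 2 `^ p^-1 :> R by rewrite powR_gt0.
have K0 : 0 < K by rewrite mulr_gt0.
exists (C1 * K `^ p * (cW^-1 * M)).
  by rewrite !mulr_ge0 ?powR_ge0 ?invr_ge0// ltW.
move=> f g g0 mg Ioo fg; set tr := trace mu por cX f.
pose a := osc mu Q p por cW g; pose c := sample mu Q p por cW f g.
have a0 w : 0 <= a w by exact: osc_ge0.
(* The weight cancels the radius in [osc], leaving the integral of g^p over each hole; bounded
   overlap of the holes sums these. *)
have Sle : (\esum_(w in fvertex X) (rr w.1 `^ (Q - p) * a w `^ p)%:E <=
    (cW^-1 * M)%:E * \int[measure_of mu]_y (g y `^ p))%E.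
  have mh : measurable_fun [set: caratheodory_type mu] (fun y => (g y `^ p)%E).
    exact: (measurableT_comp (measurable_poweR _)).
  have h0 y : (0 <= g y `^ p)%E by exact: poweR_ge0.
  rewrite EFinM -muleA.
  have cWi : 0 <= cW^-1 by rewrite invr_ge0 ltW.
  apply: le_trans (lee_wpmul2l _ (HM _ h0 mh)); last by rewrite lee_fin.
  rewrite -esumZl//; last by move=> w; apply: integral_ge0.
  apply: le_esum => w _; rewrite (hole_massE muA por mg Ioo) -EFinM lee_fin.
  rewrite /a (osc_powR p0 muA por cW0 mg Ioo) mulrCA ler_wpM2l// mulrA -powRD; last first.
    by rewrite (gt_eqF (rr_gt0 _)) implybT.
  by have -> : Q - p + (p - Q) = 0 by [ring|]; rewrite powRr0 mul1r.
have Soo : (\esum_(w in fvertex X) (rr w.1 `^ (Q - p) * a w `^ p)%:E < +oo)%E.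
  apply: le_lt_trans Sle _; rewrite -ge0_fin_numE; last first.
    rewrite mule_ge0 ?lee_fin ?mulr_ge0 ?invr_ge0 ?(ltW cW0)//.
    by apply: integral_ge0 => y _; exact: poweR_ge0.
  by rewrite fin_numM// ge0_fin_numE// integral_ge0// => y _; exact: poweR_ge0.
have tail_fin n x : (cell_tail cX a n x < +oo)%E ->
    (cell_tail cX a n x <= (fine (cell_tail cX a n x))%:E)%E.
  by move=> h; rewrite fineK// ge0_fin_numE// cell_tail_ge0.
have lim n x : fine_level (T := T) n -> (cell_tail cX a n x < +oo)%E ->
    [/\ trace_lim mu por cX f x (tr x),
      normc (tr x - c (n, nearest cX n x)) <= 24 * 2 `^ p^-1 * fine (cell_tail cX a n x) &
      forall t : R, 0 < t -> exists N : nat, forall j : nat, (N <= j)%N ->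
        normc (c (n + j%:Z, nearest cX (n + j%:Z) x) - tr x) < t].
  move=> fn /tail_fin h.
  have [l [h1 h2 h3]] := trace_lim_tail iso p0 muA cW0 HW g0 mg Ioo fg fn h.
  by rewrite /tr (traceE muA h1).
have near x : ((normc (tr x - c (k, nearest cX k x)))%:E <= K%:E * cell_tail cX a k x)%E.
  have t0 := cell_tail_ge0 cX a0 k x.
  have [toot|] := ltP (cell_tail cX a k x) +oo%E; last first.
    by rewrite leye_eq => /eqP ->; rewrite gt0_muley ?lte_fin ?leey.
  have [_ h _] := lim k x fk toot.
  have tf : (cell_tail cX a k x \is a fin_num)%E by rewrite ge0_fin_numE.
  rewrite -(fineK tf) -EFinM lee_fin; apply: le_trans h _.
  rewrite /K ler_wpM2r ?fine_ge0// ler_wpM2r ?(ltW kap0)//.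
  by rewrite ler_nat.
have edges e x : edge X e -> fine_level (T := T) e.1.1 -> eball e x ->
    ((normc (tr x - c e.1))%:E <= K%:E * (cell_tail cX a e.1.1 x + (a e.1)%:E))%E.
  move=> ee fe ex; have t0 := cell_tail_ge0 cX a0 e.1.1 x.
  have [toot|] := ltP (cell_tail cX a e.1.1 x) +oo%E; last first.
    rewrite leye_eq => /eqP ->.
    by rewrite addye// gt0_muley ?lte_fin ?leey.
  have tf : (cell_tail cX a e.1.1 x \is a fin_num)%E by rewrite ge0_fin_numE.
  have := trace_edge iso p0 muA cW0 HW g0 mg Ioo fg ee fe ex (tail_fin _ _ toot).
  by rewrite -{2}(fineK tf) -EFinD -EFinM lee_fin.
have L1 : L1loc nu tr.
  exact: (trace_L1loc s0 nuA T2 p0 pQs psQ a0 (ltW K0)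
    (fun x h => let: And3 _ _ h3 := lim k x fk h in h3) near Soo).
split=> //.
  have intv v : cintegrable nu (vball v) tr by exact: L1.2.
  apply: le_trans (HC1 a tr c K a0 (ltW K0) intv edges) _.
  rewrite [(C1 * K `^ p * _)%:E]EFinM -muleA; apply: lee_wpmul2l; last exact: Sle.
  by rewrite lee_fin mulr_ge0 ?powR_ge0.
have [N [mN N0 NP]] := cell_tail_ae s0 nuA T2 cX p0 pQs psQ k a0 Soo.
exists N; split=> // x nx; apply: NP => h; apply: nx.
by have [] := lim k x fk h.
Qed.

Hypothesis clF : closed (range i).

(** Finite energy makes the maximal function of exponent sigma on [T] finite almost everywhere.
    There the averages converge with a rate in the cone over [x], which is what [cextend_trace_lim]
    needs, and [averages_limit] identifies the limit as f x. *)
Lemma trace_cextend (sigma : R) (f : T -> R[i]) : 0 < sigma -> L1loc nu f ->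
  (energy X p (s - sigma * p) (vaverage nu f) < +oo)%E ->
  {ae measure_of nu, forall x, trace_lim mu por cX (cextend iso clF cX (vaverage nu f)) x (f x)}.
Proof.
move=> sg0 Lf Eoo; set u := vaverage nu f.
have h0 := hole_ratio_gt0 por; pose A := 2 / hole_ratio por + 5.
have A1 : 1 <= A by have : 0 < 2 / hole_ratio por by [rewrite divr_gt0|]; rewrite /A; lra.
have A10 : 0 < A + 1 by lra.
have [K K0 HK] := emax_limit sg0 cX A1.
have [C C0 HC] := ahlfors_upper s0 nuA T2.
have nur := nuA.1.1.
have e0 x := emax_ge0 id X sigma (A + 1) u x.
have me := measurable_emax id X sigma (A + 1) nur u.
have mep : measurable_fun [set: caratheodory_type nu] (fun x => (emax id X sigma (A + 1) u x `^ p)%E).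
  exact: (measurableT_comp (measurable_poweR _)).
have fin : {ae measure_of nu, forall x, (emax id X sigma (A + 1) u x < +oo)%E}.
  have ip : (measure_of nu).-integrable setT (fun x => (emax id X sigma (A + 1) u x `^ p)%E).
    apply/integrableP; split=> //.
    under eq_integral do rewrite gee0_abs ?poweR_ge0//.
    apply: le_lt_trans (integral_emax id sigma p0 A10 cX nur C0 HC u) _.
    have en0 : (0 <= energy X p (s - sigma * p) u)%E.
      by apply: esum_ge0 => e _; rewrite lee_fin mulr_ge0 ?powR_ge0.
    rewrite -ge0_fin_numE; last by rewrite mule_ge0 ?lee_fin ?mulr_ge0 ?powR_ge0 ?(ltW C0).
    by rewrite fin_numM// ge0_fin_numE.
  have [N [mN N0 NP]] := integrable_ae measurableT ip.
  exists N; split=> // x nx; apply: NP => h; apply: nx; have := h I.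
  rewrite ge0_fin_numE ?poweR_ge0// => h'.
  have [//|] := ltP (emax id X sigma (A + 1) u x) +oo%E.
  rewrite leye_eq => /eqP E; move: h'; rewrite E poweRyr ?(gt_eqF p0)//.
have [[mRe mIm] iL] := Lf.
have aRe := averages_limit nuA cX mRe (fun x r => (iL x r).1).
have aIm := averages_limit nuA cX mIm (fun x r => (iL x r).2).
apply: (ae_imply2 fin (ae_imply2 aRe aIm (fun x p q => conj p q))) => x ex [xRe xIm].
have eb : (emax id X sigma (A + 1) u x <= (fine (emax id X sigma (A + 1) u x))%:E)%E.
  by rewrite fineK// ge0_fin_numE.
have [l [ul lv]] := HK u x _ (fine_ge0 (e0 x)) eb.
have -> : f x = l.
  have eqC (z w : R[i]) : complex.Re z = complex.Re w -> complex.Im z = complex.Im w -> z = w.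
    by case: z w => [? ?] [? ?] /= -> ->.
  apply: eqC; apply/esym.
    apply: xRe => t t0; have [N HN] := ul t t0; exists N => j Nj.
    apply: le_lt_trans (HN j Nj); rewrite /average -vaverage_Re -ReB; exact: normc_Re.
  apply: xIm => t t0; have [N HN] := ul t t0; exists N => j Nj.
  apply: le_lt_trans (HN j Nj); rewrite /average -vaverage_Im -ImB; exact: normc_Im.
exact: cextend_trace_lim sg0 K0 (fine_ge0 (e0 x)) T2 lv.
Qed.

End trace_operator.

(** * Boundedness and linearity of the two operators *)

Section operators.
Context {R : realType} {Z T : pmetricType R} (i : T -> Z).
Hypothesis iso : forall x y, mdist (i x) (i y) = mdist x y.
Hypothesis T2 : exists x y : T, x <> y.
Variables (mu : {outer_measure set Z -> \bar R}) (Q p : R).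
Hypothesis Q0 : 0 < Q.
Hypothesis p0 : 0 < p.
Hypothesis muA : ahlfors_regular Q mu.
Hypothesis por : porous (range i).
Variables (nu : {outer_measure set T -> \bar R}) (s : R).
Hypothesis s0 : 0 < s.
Hypothesis nuA : ahlfors_regular s nu.
Hypothesis pQs : Q - s < p.
Hypothesis psQ : Q < s * p + p.
Variable X : hyperbolic_filling T.
Hypothesis cX : net_count X.
Hypothesis clF : closed (range i).

Let sigma := 1 - (Q - s) / p.
Let V := hajlasz_space mu p.
Let W := besov_space nu X sigma p p.
Let Rop := trace mu por cX.
Let Eop (f : T -> R[i]) := cextend iso clF cX (vaverage nu f).

Let pn0 : p != 0. Proof. by rewrite gt_eqF. Qed.

(** This identity fixes the smoothness: the energies attached to the Besov norm on [T] and to the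
    gradient on [Z] coincide. *)
Let sigmaE : s - sigma * p = Q - p.
Proof. by rewrite /sigma; field. Qed.

Let sigma0 : 0 < sigma.
Proof. by rewrite subr_gt0 ltr_pdivrMr// mul1r. Qed.

Let gradient_powR f g : hajlasz_gradient mu p f g ->
  ('N[measure_of mu]_(p%:E)[g] `^ p = \int[measure_of mu]_y (g y `^ p))%E.
Proof.
move=> [g0 _ _ _]; rewrite poweR_Lnorm//; apply: eq_integral => y _.
by rewrite gee0_abs.
Qed.

Let gradient_fin f g : hajlasz_gradient mu p f g ->
  (\int[measure_of mu]_y (g y `^ p) < +oo)%E.
Proof. by move=> fg; rewrite -(gradient_powR fg); apply: poweR_lty; case: fg. Qed.

Let trace_besov : exists2 C : R, 0 <= C & forall f g, hajlasz_gradient mu p f g ->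
  [/\ L1loc nu (Rop f),
    (besov_norm nu X sigma p p (Rop f) <= C%:E * 'N[measure_of mu]_(p%:E)[g])%E &
    {ae measure_of nu, forall x, trace_lim mu por cX f x (Rop f x)}].
Proof.
have [C1 C10 H1] := trace_bound iso T2 Q0 p0 muA por s0 nuA pQs psQ cX.
have [C2 C20 H2] := besov_le_energy s0 nuA T2 X p0 sigma.
exists ((C2 * C1) `^ p^-1); first exact: powR_ge0.
move=> f g fg; have [g0 mg _ fgP] := fg.
have [L1 En ae] := H1 f g g0 mg (gradient_fin fg) fgP; split=> //.
apply: poweR_root_le => //; rewrite ?mulr_ge0 ?poweR_ge0 ?Lnorm_ge0//.
rewrite (gradient_powR fg) EFinM -muleA; apply: le_trans (H2 _) _.
by rewrite sigmaE; apply: lee_wpmul2l => //; rewrite lee_fin.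
Qed.

Let trace_ae f : V f -> {ae measure_of nu, forall x, trace_lim mu por cX f x (Rop f x)}.
Proof. by have [C _ H] := trace_besov; move=> [_ [g fg]]; have [] := H f g fg. Qed.

Lemma trace_bounded : bounded_linear_operator mu nu
  V (hajlasz_norm mu p) W (besov_norm nu X sigma p p) Rop.
Proof.
have [C C0 HC] := trace_besov.
(* Covers both compatibility clauses: c = 0 for equality almost everywhere, general c modulo
   constants. *)
have shift f g (c : R[i]) : V g -> ae_equal mu (fun y => f y - g y) (fun=> c) ->
    {ae measure_of nu, forall x, Rop f x = Rop g x + c}.
  move=> Vg fg; have [N [mN N0 NP]] := trace_ae Vg.
  exists N; split=> // x nx; apply: NP => h; apply: nx.
  exact: (traceE muA (trace_lim_ae fg h)).
split.
- move=> f [_ [g fg]]; have [L1 nb _] := HC f g fg; split=> //.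
  have [_ _ Nf _] := fg; apply: le_lt_trans nb _.
  have N0 : (0 <= 'N[measure_of mu]_(p%:E)[g])%E by exact: Lnorm_ge0.
  rewrite -ge0_fin_numE; last by rewrite mule_ge0 ?lee_fin.
  by rewrite fin_numM// ge0_fin_numE.
- move=> f g Vf Vg [N [mN N0 NP]].
  have [|A [mA A0 AP]] := shift f g 0 Vg.
    by exists N; split=> // y ny; apply: NP => h; apply: ny; rewrite /= h subrr.
  by exists A; split=> // x nx; apply: AP => h; apply: nx; rewrite /= h addr0.
- move=> f g Vf Vg [c fg]; exists c.
  have [A [mA A0 AP]] := shift f g c Vg fg.
  by exists A; split=> // x nx; apply: AP => h; apply: nx; rewrite /= h addrAC subrr add0r.
- move=> a f g Vf Vg; apply: (ae_imply2 (trace_ae Vf) (trace_ae Vg)) => x fx gx.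
  exact: (traceE muA (trace_lim_lin muA a fx gx)).
(* The 1 makes the constant positive, as passing to the infimum over gradients divides by it. *)
- exists (C + 1); first by rewrite addr_ge0.
  move=> f [_ _]; apply: le_mul_ereal_inf; first by rewrite ltr_wpDl.
  move=> _ [g fg <-]; have [_ nb _] := HC f g fg; apply: le_trans nb _.
  by apply: lee_wpmul2r; [exact: Lnorm_ge0|rewrite lee_fin lerDl].
Qed.

Let energy_fin f : W f -> (energy X p (s - sigma * p) (vaverage nu f) < +oo)%E.
Proof.
move=> [_ nf]; have [C C0 HC] := energy_le_besov s0 nuA T2 X p0 sigma.
have b0 : (0 <= besov_norm nu X sigma p p f `^ p)%E by exact: poweR_ge0.
apply: le_lt_trans (HC f) _; rewrite -ge0_fin_numE; last by rewrite mule_ge0 ?lee_fin.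
by rewrite fin_numM// ge0_fin_numE//; exact: poweR_lty.
Qed.

Lemma extension_bounded : bounded_linear_operator nu mu
  W (besov_norm nu X sigma p p) V (hajlasz_norm mu p) Eop.
Proof.
have [C1 C10 H1] := energy_le_besov s0 nuA T2 X p0 sigma.
have [C2 C20 H2] := cextend_gradient_integral iso clF cX Q0 p0 T2 muA por.
have mur := muA.1.1.
pose G f := cextend_gradient iso clF cX (vaverage nu f).
have Np f : ('N[measure_of mu]_(p%:E)[G f] `^ p = \int[measure_of mu]_y (G f y `^ p))%E.
  rewrite poweR_Lnorm//; apply: eq_integral => y _.
  by rewrite gee0_abs// cextend_gradient_ge0.
have Nle f : ('N[measure_of mu]_(p%:E)[G f] <=
    ((C2 * C1) `^ p^-1)%:E * besov_norm nu X sigma p p f)%E.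
  apply: poweR_root_le => //; rewrite ?mulr_ge0 ?poweR_ge0 ?Lnorm_ge0//.
  rewrite Np EFinM -muleA; apply: le_trans (H2 _) _.
  by apply: lee_wpmul2l; rewrite ?lee_fin// -sigmaE.
have grad f : W f -> hajlasz_gradient mu p (Eop f) (G f).
  move=> Wf; split.
  - by move=> y; exact: cextend_gradient_ge0.
  - exact: measurable_cextend_gradient.
  - have b0 : (0 <= besov_norm nu X sigma p p f)%E by exact: poweR_ge0.
    apply: le_lt_trans (Nle f) _; rewrite -ge0_fin_numE; last first.
      by rewrite mule_ge0 ?lee_fin ?powR_ge0.
    by rewrite fin_numM// ge0_fin_numE//; case: Wf.
  - by move=> y z; exact: cextend_gradientP.
split.
- by move=> f Wf; split; [exact: cmeasurable_cextend|exists (G f); exact: grad].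
- move=> f g [[mf _] _] [[mg _] _] fg.
  (* Averages ignore null sets, so the extensions agree at every point. *)
  have -> : Eop f = Eop g.
    rewrite /Eop; congr (cextend iso clF cX); apply/funext => v; exact: (vaverage_ae nuA v mf mg fg).
  by apply: aeW.
- move=> f g [Lf _] [Lg _] [c fg]; exists c.
  (* Constants are reproduced off the range, where the bumps do not all vanish, and the range is
     null. *)
  exists (range i); split.
  + exact: closed_measurable_cara.
  + exact: (porous_measure0 iso T2 Q0 muA por cX).
  + move=> y /= ny; apply: contrapT => yF; apply: ny.
    have -> : Eop f y = 1 * Eop g y + c.
      rewrite -[X in _ + X](cextend_cst iso clF cX c yF) -cextend_lin /Eop.
      by congr (cextend _ _ _ _ y); apply/funext => v; exact: (vaverage_ae_cst nuA v Lf Lg fg).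
    by rewrite mul1r addrAC subrr add0r.
- move=> a f g [Lf _] [Lg _].
  have -> : Eop (fun x => a * f x + g x) = (fun y => a * Eop f y + Eop g y).
    apply/funext => y; rewrite /Eop -cextend_lin.
    by congr (cextend _ _ _ _ y); apply/funext => v; exact: (vaverage_lin nuA).
  by apply: aeW.
- exists ((C2 * C1) `^ p^-1); first exact: powR_ge0.
  move=> f Wf; apply: le_trans (Nle f).
  by apply: ereal_inf_lbound; exists (G f) => //; exact: grad.
Qed.

Lemma trace_extension f : W f -> ae_equal nu (Rop (Eop f)) f.
Proof.
move=> Wf; have [N [mN N0 NP]] := trace_cextend iso T2 mu p0 por s0 nuA cX clF sigma0 Wf.1 (energy_fin Wf).
exists N; split=> // x nx; apply: NP => h; apply: nx.
exact: (traceE muA h).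
Qed.

Lemma trace_continuous f x : continuous (f : Z -> R[i]^o) -> Rop f x = f (i x).
Proof. by move=> cf; exact: (traceE muA (trace_lim_continuous iso T2 mu por cX x cf)). Qed.

End operators.

Theorem theorem1p5 (R : realType) (Z : pmetricType R)
    (mu : {outer_measure set Z -> \bar R}) (Q lambda p : R)
    (F : set Z) (F0 : F !=set0) (X : hyperbolic_filling (metric_subspace F0)) :
  0 < Q -> ahlfors_regular Q mu ->
  0 < lambda -> lambda <= Q ->
  ahlfors_regular_subset lambda F0 -> porous F ->
  Num.max (Q / (lambda + 1)) (Q - lambda) < p ->
  let nu : {outer_measure set (metric_subspace F0) -> \bar R} :=
    hausdorff_measure lambda in
  let sigma := 1 - (Q - lambda) / p in
  let M := hajlasz_space mu p in
  let B := besov_space nu X sigma p p in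
  exists (Rop : (Z -> R[i]) -> (metric_subspace F0 -> R[i]))
         (Eop : (metric_subspace F0 -> R[i]) -> (Z -> R[i])),
    [/\ bounded_linear_operator mu nu
          M (hajlasz_norm mu p) B (besov_norm nu X sigma p p) Rop,
        bounded_linear_operator nu mu
          B (besov_norm nu X sigma p p) M (hajlasz_norm mu p) Eop,
        forall f : Z -> R[i], M f -> continuous (f : Z -> R[i]^o) ->
          forall x : metric_subspace F0, Rop f x = f (subspace_val x) &
        forall f : metric_subspace F0 -> R[i], B f ->
          ae_equal nu (Rop (Eop f)) f].
Proof.
move=> Q0 muA l0 lQ [clF _ nuA] porF; rewrite gt_max => /andP[pQl pQ].
have p0 : 0 < p by apply: le_lt_trans pQ; rewrite subr_ge0.
(* The bound Q / (lambda + 1) < p, cleared of its denominator. *)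
have psQ : Q < lambda * p + p.
  by move: pQl; rewrite ltr_pdivrMr ?addr_gt0// mulrDr mulr1 mulrC.
pose i := @subspace_val R Z F F0.
have iso (x y : metric_subspace F0) : mdist (i x) (i y) = mdist x y by [].
have iF : range i = F.
  apply/seteqP; split=> [_ [x _ <-]|x Fx]; first exact: set_mem (valP (x : F)).
  by exists (exist _ x (mem_set Fx) : F).
have clI : closed (range i) by rewrite iF.
have por : porous (range i) by rewrite iF.
have T2 := hausdorff_nontrivial l0 nuA.1.
have cX := ahlfors_net_count l0 nuA T2 X.
move=> nu sigma M B.
exists (trace mu por cX), (fun f => cextend iso clI cX (vaverage nu f)); split.
- exact: (trace_bounded iso T2 Q0 p0 muA por l0 nuA pQ psQ cX).
- exact: (extension_bounded iso T2 Q0 p0 muA por l0 nuA cX clI).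
- by move=> f _ cf x; exact: (trace_continuous iso T2 muA por cX x cf).
- by move=> f Bf; exact: (trace_extension iso T2 p0 muA por l0 nuA pQ cX clI Bf).
Qed.
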